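(* Let $X=(X,d,\mu)$ be a metric measure space (as in the context), $x_0\in X$ a fixed point and $B_r=B(x_0,r)$. Assume that $p>1$ and that $\mu$ is doubling and supports a $p$-Poincaré inequality on $X$. Let $0<R_0\le\tfrac14\operatorname{diam}X$ (where $R_0=\infty$ is allowed if $X$ is unbounded). Then $$\operatorname{cap}_{p,\mu}^{X}(B_\rho,B_r)\gtrsim r^{-p}\mu(B_r)\quad\text{for all } 0<\rho<r<R_0\qquad(1)$$ if and only if $$p>Q:=\inf\Bigl\{Q'>0:\ \frac{\mu(B_\rho)}{\mu(B_r)}\gtrsim\Bigl(\frac\rho r\Bigr)^{Q'}\ \text{for all } 0<\rho<r<R_0\Bigr\}.\qquad(2)$$ If, in addition, there is a locally compact open set $G\subset X$ with $x_0\in G$, then also the condition $$\operatorname{cap}_{p,\mu}^{X}(\{x_0\},B_r)\gtrsim r^{-p}\mu(B_r)\quad\text{for all } 0<r<R_0$$ is equivalent to each of (1) and (2).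
   Context: $X=(X,d,\mu)$ is a metric space (not necessarily complete) with a positive complete Borel measure $\mu$ such that $0<\mu(B)<\infty$ for all balls $B$. $B(x,r)=\{y:d(x,y)<r\}$ and $cB(x,r)=B(x,cr)$. $\mu$ is doubling if there is $C>0$ with $0<\mu(2B)\le C\mu(B)<\infty$ for all balls $B$. Curves are nonconstant, compact and rectifiable, parameterized by arc length. A Borel function $g:X\to[0,\infty]$ is an upper gradient of $f:X\to[-\infty,\infty]$ if $|f(\gamma(0))-f(\gamma(l_\gamma))|\le\int_\gamma g\,ds$ for all curves $\gamma:[0,l_\gamma]\to X$, the left-hand side being $\infty$ if at least one of its terms is infinite. $N^{1,p}(X)$ is the set of measurable, everywhere defined $f:X\to[-\infty,\infty]$ with $\int_X|f|^p\,d\mu+\inf_g\int_Xg^p\,d\mu<\infty$, infimum over upper gradients $g$ of $f$. $\mu$ supports a $p$-Poincaré inequality on $X$ if there are $C>0$, $\lambda\ge1$ such that for all balls $B=B(x,r)$, all integrable $f$ on $X$ and all upper gradients $g$ of $f$, $\frac1{\mu(B)}\int_B|f-f_B|\,d\mu\le Cr\bigl(\frac1{\mu(\lambda B)}\int_{\lambda B}g^p\,d\mu\bigr)^{1/p}$, where $f_B=\frac1{\mu(B)}\int_Bf\,d\mu$. For $\Omega\subset X$ open and $E\subset\Omega$, $\operatorname{cap}_{p,\mu}^{X}(E,\Omega)=\inf_u\int_\Omega g^p\,d\mu$, infimum over all $u\in N^{1,p}(X)$ with $u=1$ in $E$, $u=0$ on $X\setminus\Omega$, and all upper gradients $g$ of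 $u$. $a\gtrsim b$ means $b\le Ca$ with a constant $C>0$ independent of the radii $\rho,r$. *)

(* Defs.v *)
From HB Require Import structures.
From mathcomp Require Import all_boot all_order all_algebra.
From mathcomp Require Import all_classical all_reals all_analysis measurable_realfun.

Set Implicit Arguments.
Unset Strict Implicit.
Unset Printing Implicit Defensive.

Import Order.TTheory GRing.Theory Num.Theory.
Import numFieldNormedType.Exports.

Local Open Scope classical_set_scope.
Local Open Scope ring_scope.

(* A metric space together with a sigma-algebra; the two are related by
   [complete_borel_measure] below. *)
#[short(type="metricMeasurableType")]
HB.structure Definition MetricMeasurable (R : realType) (d : measure_display) :=
  {T of Metric R T & Measurable d T}.

Section metric_measure_space.
Context {R : realType} {d : measure_display} {X : metricMeasurableType R d}.
Implicit Types (mu : {measure set X -> \bar R}) (p : R) (E Omega : set X).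

(* The sigma-algebra contains the Borel sets, mu is complete on it, and
   0 < mu B < +oo for all balls. [ball x r] is the open ball
   {y | mdist x y < r} (lemma [ballEmdist]). *)
Definition complete_borel_measure mu :=
  [/\ forall A : set X, open A -> measurable A,
      measure_is_complete mu &
      forall (x : X) (r : R), 0 < r -> (0 < mu (ball x r) < +oo)%E].

Definition doubling mu :=
  exists2 C : R, 0 < C &
    forall (x : X) (r : R), 0 < r ->
      (mu (ball x (2 * r)) <= C%:E * mu (ball x r))%E.

Definition diam : \bar R :=
  ereal_sup [set (mdist xy.1 xy.2)%:E | xy in [set: X * X]].

(* Metric counterparts of [variation] and [total_variation], which are only
   available for real-valued functions. *)
Definition mvariation (a b : R) (gamma : R -> X) (s : seq R) : R :=
  let F := gamma \o nth b (a :: s) in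
  \sum_(0 <= n < size s) mdist (F n) (F n.+1).

Definition curve_length (a b : R) (gamma : R -> X) : \bar R :=
  ereal_sup [set (mvariation a b gamma s)%:E | s in itv_partition a b].

(* gamma restricted to [0, l] is a nonconstant (0 < l), compact, rectifiable
   curve parameterized by arc length; it is 1-Lipschitz, hence continuous, on
   [0, l]. Its values outside [0, l] are irrelevant. *)
Definition arclength_curve (l : R) (gamma : R -> X) :=
  0 < l /\
  forall t : R, 0 <= t <= l -> curve_length 0 t gamma = t%:E.

(* Borel measurability with respect to the sigma-algebra generated by the open
   sets, which may be smaller than the one carried by X. *)
Definition borel_fun (g : X -> \bar R) :=
  measurable_fun [set: g_sigma_algebraType (@open X)]
    (g : g_sigma_algebraType (@open X) -> \bar R).

(* In \bar R, `|a - b| = +oo as soon as a or b is infinite, including the cases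
   +oo - +oo = -oo - -oo = -oo, as required on the left-hand side. *)
Definition upper_gradient (f g : X -> \bar R) :=
  [/\ forall x, (0 <= g x)%E,
      borel_fun g &
      forall (l : R) (gamma : R -> X), arclength_curve l gamma ->
        (`|f (gamma 0%R) - f (gamma l)| <=
         \int[lebesgue_measure]_(t in `[0%R, l]) g (gamma t))%E].

Definition newtonian mu p (f : X -> \bar R) :=
  measurable_fun [set: X] f /\
  (\int[mu]_x (`|f x| `^ p) +
   ereal_inf [set \int[mu]_x (g x `^ p) | g in upper_gradient f] < +oo)%E.

Definition average mu (B : set X) (f : X -> \bar R) : \bar R :=
  ((mu B)^-1 * \int[mu]_(x in B) f x)%E.

Definition poincare mu p :=
  exists C lambda : R, [/\ 0 < C, 1 <= lambda &
    forall (x : X) (r : R) (f g : X -> \bar R), 0 < r ->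
      mu.-integrable [set: X] f -> upper_gradient f g ->
      let B := ball x r in
      let lambdaB := ball x (lambda * r) in
      (average mu B (fun y => `|f y - average mu B f|) <=
       (C * r)%:E * (average mu lambdaB (fun y => g y `^ p)) `^ p^-1)%E].

Definition capacity mu p E Omega : \bar R :=
  ereal_inf [set c | exists u g : X -> \bar R,
    [/\ newtonian mu p u,
        forall x, E x -> u x = 1%E,
        forall x, ~ Omega x -> u x = 0%E,
        upper_gradient u g &
        c = (\int[mu]_(x in Omega) (g x `^ p))%E]].

Definition annulus_capacity_bound mu p (x0 : X) (R0 : \bar R) :=
  exists2 C : R, 0 < C &
    forall rho r : R, 0 < rho -> rho < r -> (r%:E < R0)%E ->
      ((r `^ (- p))%:E * mu (ball x0 r) <=
       C%:E * capacity mu p (ball x0 rho) (ball x0 r))%E.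

Definition point_capacity_bound mu p (x0 : X) (R0 : \bar R) :=
  exists2 C : R, 0 < C &
    forall r : R, 0 < r -> (r%:E < R0)%E ->
      ((r `^ (- p))%:E * mu (ball x0 r) <=
       C%:E * capacity mu p [set x0] (ball x0 r))%E.

Definition lower_mass_bound mu (x0 : X) (R0 : \bar R) (q : R) :=
  exists2 C : R, 0 < C &
    forall rho r : R, 0 < rho -> rho < r -> (r%:E < R0)%E ->
      (((rho / r) `^ q)%:E <= C%:E * (mu (ball x0 rho) / mu (ball x0 r)))%E.

Definition lower_dimension mu (x0 : X) (R0 : \bar R) : \bar R :=
  ereal_inf [set q%:E | q in [set q : R | 0 < q /\
                                          lower_mass_bound mu x0 R0 q]].

End metric_measure_space.

Arguments diam {R d} X.

(* Main.v *)
Require Import Defs.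
From HB Require Import structures.
From mathcomp Require Import all_boot all_order all_algebra.
From mathcomp Require Import all_classical all_reals all_analysis measurable_realfun.
From mathcomp Require Import lra ring.

Set Implicit Arguments.
Unset Strict Implicit.
Unset Printing Implicit Defensive.

Import Order.TTheory GRing.Theory Num.Theory.
Import numFieldNormedType.Exports.

Local Open Scope classical_set_scope.
Local Open Scope ring_scope.

(** Write m(r) = mu(B_r) and let lambda, p be as in the Poincare inequality.

    Mass bound with q < p implies the annulus bound: telescoping the Poincare
    inequality over the balls B_{2^-k r} gives a geometric series of ratio
    2^{-(1-q/p)}, so a function 0 <= f <= 1 vanishing off B_r has averages
    <= A r (m(r)^-1 int g^p)^{1/p} on all smaller concentric balls; the average
    over B_4r is controlled because f = 0 on a fixed proportion of B_4r. The upper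
    gradient may be cut off outside B_r since f vanishes there.

    Annulus bound implies a mass bound with q < p: the logarithmic test function
    made of n dyadic ramps has energy comparable to n^-p times the sum of
    (2^-k r)^-p m(2^-k r). For n large the annulus bound therefore forces
    2 r^-p m(r) <= (2^-k r)^-p m(2^-k r) for some 1 <= k <= n, and iterating this
    gives the exponent q = p - 1/n.

    Mass bound implies the point bound: let f(x0) = 1. A lower semicontinuous
    majorant of g is the limit of increasing Lipschitz functions G_j >= 1/s. The
    cost of going from x0 to y along chains of small steps, weighted by G_j, is a
    Lipschitz function of y with upper gradient G_j, so by telescoping its average
    over a small ball B_t is small (unless int g^p is large), and on half of B_t it
    is < 1/4 for every j at once. In a compact neighbourhood of x0 the chains
    converge to a curve from x0 to y along which the integral of g is <= 1/4, so
    f(y) >= 3/4. Hence f has average >= 3/8 over B_t, and the first part applies. *)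

(** * Curves *)

(** Three obstacles shape the implication from the mass bound to the point bound. Averages do not
    see the value of [f] at the single point [x0], and [f] need not be continuous: only curves
    through [x0] carry the information. They have to be constructed, and as [X] need not be
    complete, this is done inside a compact set; the bound [G_j >= 1/s] confines the chains to it,
    since a chain of cost at most 1/4 gets at most [s/4] away from its starting ball. Second, [g] is
    only Borel, while chains sample a function at their vertices; a lower semicontinuous majorant is
    a supremum of Lipschitz functions, and each of these passes to the limit along the chains. The
    majorant costs a constant factor in the integral of [g^p], which is harmless here. Third, the
    constants must not depend on [r], although the compact neighbourhood has a fixed size. The
    auxiliary radius [t] is a fixed fraction of the smaller of [r] and that size; if the integral of
    [g^p] is not small compared with [t^-p m(t)], the mass bound with [q < p] gives
    [r^-p m(r) <= C t^-p m(t)] and the estimate follows at once. *)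

Section curves.
Context {R : realType} {d : measure_display} {X : metricMeasurableType R d}.
Implicit Types (gam : R -> X) (a b c t : R) (s : seq R).

Fixpoint polygon_length gam a s : R :=
  if s is x :: s' then mdist (gam a) (gam x) + polygon_length gam x s' else 0.

Lemma mvariationE a b gam s : mvariation a b gam s = polygon_length gam a s.
Proof.
elim: s a => [|x s ih] a; first by rewrite /mvariation big_nil.
by rewrite /mvariation /= big_nat_recl//= -ih /mvariation.
Qed.

Lemma polygon_length_ge0 gam a s : 0 <= polygon_length gam a s.
Proof. by elim: s a => //= x s ih a; rewrite addr_ge0 ?mdist_ge0. Qed.

Lemma polygon_length_rcons gam a s x :
  polygon_length gam a (rcons s x) =
  polygon_length gam a s + mdist (gam (last a s)) (gam x).
Proof. by elim: s a => [|y s ih] a /=; rewrite ?addr0 ?add0r// ih addrA. Qed.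

Lemma curve_lengthP a b gam (M : \bar R) :
  (forall s, path <%R a s -> last a s = b -> ((polygon_length gam a s)%:E <= M)%E) <->
  (curve_length a b gam <= M)%E.
Proof.
split=> [h|h s ps ls].
  apply: ge_ereal_sup => _ [s [ps /eqP ls] <-].
  by rewrite mvariationE; exact: h.
apply: le_trans h; apply: ereal_sup_ubound; exists s.
  by split=> //; apply/eqP.
by rewrite mvariationE.
Qed.

Lemma polygon_length_le_curve_length a b gam s :
  path <%R a s -> last a s = b -> ((polygon_length gam a s)%:E <= curve_length a b gam)%E.
Proof. by move=> ps ls; exact: (@curve_lengthP a b gam _).2. Qed.

Lemma curve_length_ge0 a b gam : a <= b -> (0 <= curve_length a b gam)%E.
Proof.
rewrite le_eqVlt => /predU1P[->|ab].
  by apply: (@polygon_length_le_curve_length _ _ _ [::]).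
apply: (@le_trans _ _ (polygon_length gam a [:: b])%:E).
  by rewrite lee_fin polygon_length_ge0.
by apply: polygon_length_le_curve_length; rewrite //= ab.
Qed.

Lemma mdist_le_curve_length a b gam : a <= b ->
  ((mdist (gam a) (gam b))%:E <= curve_length a b gam)%E.
Proof.
rewrite le_eqVlt => /predU1P[->|ab]; first by rewrite mdistxx curve_length_ge0.
rewrite -[mdist _ _]addr0.
by apply: (@polygon_length_le_curve_length _ _ _ [:: b]); rewrite //= ab.
Qed.

Lemma curve_length_cons a b x gam : a < x ->
  ((mdist (gam a) (gam x))%:E + curve_length x b gam <= curve_length a b gam)%E.
Proof.
move=> ax; rewrite -leeBrDl//; apply/curve_lengthP => s ps ls.
rewrite leeBrDl// -EFinD.
by apply: (@polygon_length_le_curve_length _ _ _ (x :: s)); rewrite //= ax.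
Qed.

Lemma curve_length_rcons a b x gam : x < b ->
  (curve_length a x gam + (mdist (gam x) (gam b))%:E <= curve_length a b gam)%E.
Proof.
move=> xb; rewrite -leeBrDr//; apply/curve_lengthP => s ps ls.
rewrite leeBrDr// -EFinD -ls -polygon_length_rcons.
apply: polygon_length_le_curve_length; last by rewrite last_rcons.
by rewrite rcons_path ps ls xb.
Qed.

(** Repeated times contribute nothing and may be dropped from a partition. This is needed for images
    of partitions under a nondecreasing map, which need not be strictly increasing. *)
Lemma polygon_length_le_weak a b gam s :
  path <=%R a s -> last a s = b -> ((polygon_length gam a s)%:E <= curve_length a b gam)%E.
Proof.
elim: s a => [|x s ih] a /=; first by move=> _ ->; rewrite curve_length_ge0.
move=> /andP[+ xs] sb; rewrite le_eqVlt => /predU1P[->|ax].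
  by rewrite mdistxx add0r ih.
rewrite EFinD; apply: le_trans (curve_length_cons b gam ax).
by rewrite leeD2l// ih.
Qed.

Lemma curve_length_le a b k gam : 0 <= k ->
  (forall x y, a <= x -> x <= y -> y <= b -> mdist (gam x) (gam y) <= k * (y - x)) ->
  (curve_length a b gam <= (k * (b - a))%:E)%E.
Proof.
move=> k0 h; apply/curve_lengthP => s; rewrite lee_fin.
elim: s a h => [|x s ih] a h /=; first by move=> _ ->; rewrite subrr mulr0.
move=> /andP[ax xs] sb.
have xb : x <= b.
  by rewrite -sb; elim: s x xs {ih ax sb} => //= y s ih x /andP[xy /ih]; apply: le_trans; exact: ltW.
rewrite (_ : k * (b - a) = k * (x - a) + k * (b - x)); last ring.
rewrite lerD ?h ?(ltW ax)//; apply: ih => // y z xy yz zb; apply: h => //.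
exact: le_trans (ltW ax) xy.
Qed.

(** The point [c] is inserted into the given partition; by the triangle inequality this does not
    shorten the polygon. *)
Lemma curve_length_split a b c gam : a <= c -> c <= b ->
  (curve_length a b gam <= curve_length a c gam + curve_length c b gam)%E.
Proof.
move=> ac cb; apply/curve_lengthP => s.
elim: s a ac => [|x s ih] a ac /=.
  by move=> _ ab; rewrite adde_ge0// curve_length_ge0.
move=> /andP[ax xs] sb; rewrite EFinD.
have [xc|cx] := leP x c.
  apply: (@le_trans _ _ ((mdist (gam a) (gam x))%:E +
    (curve_length x c gam + curve_length c b gam))%E).
    by rewrite leeD2l// ih.
  by rewrite addeA leeD2r// curve_length_cons.
apply: (@le_trans _ _ ((mdist (gam a) (gam c))%:E +
    (polygon_length gam c (x :: s))%:E)%E).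
  by rewrite /= -!EFinD lee_fin addrA lerD2r metric_triangle.
rewrite leeD ?mdist_le_curve_length//.
by apply: polygon_length_le_curve_length; rewrite //= cx.
Qed.

Lemma arclength_lipschitz l gam : arclength_curve l gam ->
  forall a b, 0 <= a -> a <= b -> b <= l -> mdist (gam a) (gam b) <= b - a.
Proof.
move=> [l0 h] a b a0; rewrite le_eqVlt => /predU1P[->|ab] bl.
  by rewrite mdistxx subrr.
have := curve_length_rcons 0 gam ab.
rewrite !h ?a0 ?bl ?(le_trans (ltW ab) bl) ?(le_trans a0 (ltW ab))//.
by rewrite -EFinD lee_fin; lra.
Qed.

Lemma arclength_prefix l l' gam : arclength_curve l gam -> 0 < l' -> l' <= l ->
  arclength_curve l' gam.
Proof.
move=> [l0 h] l'0 l'l; split=> // t /andP[t0 tl']; apply: h.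
by rewrite t0 (le_trans tl').
Qed.

Lemma polygon_length_shift gam a c s :
  polygon_length (fun t => gam (c + t)) a s =
  polygon_length gam (c + a) (map (+%R c) s).
Proof. by elim: s a => //= x s ih a; rewrite ih. Qed.

Lemma curve_length_shift a b c gam :
  curve_length a b (fun t => gam (c + t)) = curve_length (c + a) (c + b) gam.
Proof.
have mono : {mono +%R c : x y / x < y} by move=> x y; rewrite ltrD2l.
apply/le_anti/andP; split; apply/curve_lengthP => s ps ls.
  rewrite polygon_length_shift; apply: polygon_length_le_curve_length.
    by rewrite path_map (eq_path mono).
  by rewrite last_map ls.
have -> : s = map (+%R c) (map (+%R (- c)) s).
  by rewrite -map_comp map_id_in// => x _ /=; rewrite addrA subrr add0r.
rewrite -polygon_length_shift; apply: polygon_length_le_curve_length.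
  rewrite -(eq_path mono) -path_map -map_comp map_id_in// => x _ /=.
  by rewrite addrA subrr add0r.
by rewrite -(addKr c a) last_map ls addKr.
Qed.

(** The length is at most [t] because the curve is 1-Lipschitz, and at least [t] because length is
    subadditive and the prefixes up to [a] and up to [a + t] have lengths [a] and [a + t]. *)
Lemma arclength_suffix l a gam : arclength_curve l gam -> 0 <= a -> a < l ->
  arclength_curve (l - a) (fun t => gam (a + t)).
Proof.
move=> lg a0 al; have [l0 h] := lg.
split=> [|t /andP[t0 tl]]; first by rewrite subr_gt0.
rewrite curve_length_shift addr0; apply/le_anti/andP; split.
  rewrite -[leRHS]/(t%:E) -[t in leRHS]mul1r.
  rewrite -{2}(addrK a t) (addrC t a).
  apply: curve_length_le => // x y ax xy yt; rewrite mul1r.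
  by apply: (arclength_lipschitz lg); lra.
have := @curve_length_split 0 (a + t) a gam.
rewrite !h; [|lra..].
move=> /(_ a0 ltac:(lra)); rewrite EFinD leeD2lE//.
Qed.

End curves.

Section lipschitz_continuity.
Context {R : realType} {d : measure_display} {X : metricMeasurableType R d}.

Lemma lipschitz_curve_continuous (k : R) (gam : R -> X) :
  (forall a b, mdist (gam a) (gam b) <= k * `|a - b|) -> continuous gam.
Proof.
move=> h a; apply/metricType_numDomainType.cvgrPdist_lt => e e0.
have k0 : 0 < `|k| + 1 by rewrite ltr_wpDl.
have := nbhsx_ballx a _ (divr_gt0 e0 k0); apply: filterS => b.
rewrite /ball/= ltr_pdivlMr// mulrC; apply: le_lt_trans.
apply: le_trans (h a b) _; rewrite ler_wpM2r//.
by rewrite (le_trans (ler_norm k))// lerDl.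
Qed.

Lemma lipschitz_continuous (k : R) (f : X -> R) :
  (forall x y, `|f x - f y| <= k * mdist x y) -> continuous f.
Proof.
move=> h x; apply/cvgrPdist_lt => e e0.
have k0 : 0 < `|k| + 1 by rewrite ltr_wpDl.
have := nbhsx_ballx x _ (divr_gt0 e0 k0); apply: filterS => b.
rewrite ballEmdist/= ltr_pdivlMr// mulrC; apply: le_lt_trans.
apply: le_trans (h x b) _; rewrite ler_wpM2r ?mdist_ge0//.
by rewrite (le_trans (ler_norm k))// lerDl.
Qed.

(** Composing a curve with this retraction onto [[0, l]] makes it Lipschitz on all of [R], so
    measurability is obtained globally despite the arbitrary values of the curve outside
    [[0, l]]. *)
Definition clamp (l t : R) : R := Num.max 0 (Num.min t l).

Lemma clamp_in l t : 0 <= l -> 0 <= clamp l t <= l.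
Proof. by move=> l0; rewrite /clamp le_max lexx ge_max l0 ge_min lexx orbT. Qed.

Lemma clamp_id l t : 0 <= t <= l -> clamp l t = t.
Proof.
by move=> /andP[t0 tl]; rewrite /clamp (min_idPl tl) (max_idPr t0).
Qed.

Lemma clamp_lipschitz l a b : 0 <= l -> `|clamp l a - clamp l b| <= `|a - b|.
Proof.
move=> l0; wlog ab : a b / a <= b => [h|].
  by have [/h//|/ltW/h] := leP a b; rewrite (distrC b) (distrC (clamp l b)).
rewrite distrC (distrC a) ger0_norm ?ger0_norm; rewrite ?subr_ge0//; last first.
  by rewrite /clamp; apply: le_max2; rewrite ?le_min2.
rewrite /clamp !maxEle !minEle.
by do ?case: ifPn; rewrite -?ltNge => *; lra.
Qed.

Lemma arclength_clamp_lipschitz l (gam : R -> X) : arclength_curve l gam ->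
  forall a b, mdist (gam (clamp l a)) (gam (clamp l b)) <= 1 * `|a - b|.
Proof.
move=> lg a b; rewrite mul1r; have [l0 _] := lg.
apply: le_trans (clamp_lipschitz a b (ltW l0)).
have /andP[a0 al] := clamp_in a (ltW l0); have /andP[b0 bl] := clamp_in b (ltW l0).
have [ab|ba] := leP (clamp l a) (clamp l b).
  by rewrite distrC ger0_norm ?subr_ge0//; apply: (arclength_lipschitz lg).
rewrite metric_sym gtr0_norm ?subr_gt0//.
by apply: (arclength_lipschitz lg) => //; exact: ltW.
Qed.

Lemma arclength_clamp_continuous l (gam : R -> X) : arclength_curve l gam ->
  continuous (gam \o clamp l).
Proof.
by move=> lg; apply: (@lipschitz_curve_continuous 1); exact: arclength_clamp_lipschitz.
Qed.

Lemma continuous_borel_comp (gam : R -> X) (g : X -> \bar R) :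
  continuous gam -> borel_fun g -> measurable_fun [set: R] (g \o gam).
Proof.
move=> cg bg.
have mg : measurable_fun [set: R] (gam : R -> g_sigma_algebraType (@open X)).
  apply: (@measurability _ _ (measurableTypeR R) (g_sigma_algebraType (@open X)) _ _ (@open X)) => //.
  move=> _ [U oU <-]; rewrite setTI.
  by apply: open_measurable; move/continuousP : cg; exact.
exact: (measurableT_comp bg mg).
Qed.

Lemma continuous_borel (f : X -> R) : continuous f -> borel_fun (EFin \o f).
Proof.
move=> cf; apply/measurable_EFinP.
apply: (@measurability _ _ (g_sigma_algebraType (@open X)) (measurableTypeR R) _ _
  (@RGenOInfty.G R)).
  exact: RGenOInfty.measurableE.
move=> _ [_ [a ->] <-]; rewrite setTI; apply: sub_sigma_algebra.
by move/continuousP : cf; apply; exact: interval_open.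
Qed.

Lemma borel_measurable (g : X -> \bar R) :
  (forall A : set X, open A -> measurable A) ->
  borel_fun g -> measurable_fun [set: X] g.
Proof.
move=> h bg _ A mA; have := bg measurableT A mA.
rewrite !setTI => + ; apply: (@smallest_sub _ _ _ (d.-measurable)) => //.
exact: sigma_algebra_measurable.
Qed.

Lemma borel_restrict (g : X -> \bar R) (U : set X) : open U -> borel_fun g ->
  borel_fun (g \_ U).
Proof.
move=> oU bg.
apply: (@measurable_restrictT _ _ (g_sigma_algebraType (@open X)) (\bar R) U g _).1.
  exact: sub_sigma_algebra.
by apply: measurable_funS bg.
Qed.

End lipschitz_continuity.

(** * Upper gradients along subcurves, and their restriction to open sets *)

Section upper_gradients.
Context {R : realType} {d : measure_display} {X : metricMeasurableType R d}.
Local Notation leb := (@lebesgue_measure R).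

Lemma ge0_integral_shift (h : R -> \bar R) (a b c : R) :
  measurable_fun [set: R] h -> (forall t, 0 <= h t)%E ->
  (\int[leb]_(t in `[a, b]) h (c + t)%R = \int[leb]_(t in `[(c + a)%R, (c + b)%R]) h t)%E.
Proof.
move=> mh h0.
have mc : measurable_fun [set: R] (+%R c : measurableTypeR R -> measurableTypeR R).
  exact: measurable_funD.
have -> : `[a, b]%classic = (+%R c : measurableTypeR R -> measurableTypeR R) @^-1` `[c + a, c + b].
  by apply/seteqP; split=> t /=; rewrite !in_itv/= !lerD2l.
rewrite -[LHS]/(\int[leb]_(t in _) (h \o (+%R c : _ -> measurableTypeR R)) t)%E.
rewrite -ge0_integral_pushforward//; last exact: measurable_funS mh.
(* Translation invariance: the image measure agrees with Lebesgue measure on half-open intervals,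
   hence everywhere by uniqueness. *)
apply: eq_measure_integral => //= A mA _.
apply/esym/lebesgue_measure_unique => //= _ [[u v]] _ <-.
rewrite /pushforward.
have -> : +%R c @^-1` `]u, v]%classic = `](u - c)%R, (v - c)%R]%classic.
  by apply/seteqP; split=> t /=; rewrite !in_itv/= ltrBlDl lerBrDl.
rewrite !lebesgue_measure_itv/= !lte_fin ltrD2r; case: ifP => // _; rewrite -!EFinB; congr EFin; lra.
Qed.

(** The integral runs over the open interval because, when the gradient is restricted to a set, only
    the interior times are known to be mapped into that set. *)
Lemma upper_gradient_subcurve (f g : X -> \bar R) l gam a b :
  upper_gradient f g -> arclength_curve l gam -> 0 <= a -> a < b -> b <= l ->
  (`|f (gam a) - f (gam b)| <= \int[leb]_(t in `]a, b[) (g (gam (clamp l t))))%E.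
Proof.
move=> [g0 bg h] lg a0 ab bl; have [l0 _] := lg.
have lb : arclength_curve b gam by apply: (arclength_prefix lg); lra.
have := h _ _ (arclength_suffix lb a0 ab).
rewrite addr0 (addrC a) subrK => /le_trans; apply.
have mG := continuous_borel_comp (arclength_clamp_continuous lg) bg.
rewrite le_eqVlt; apply/orP; left; apply/eqP.
transitivity (\int[leb]_(t in `[0%R, (b - a)%R]) ((g \o (gam \o clamp l)) (a + t)%R))%E.
  apply: eq_integral => t; rewrite inE/= in_itv/= => /andP[t0 tb].
  by rewrite clamp_id//; lra.
rewrite ge0_integral_shift//; last by move=> t; exact: g0.
rewrite addr0 addrC subrK.
by rewrite (@integral_itv_bndoo _ _ _ _ true false)//; exact: measurable_funS mG.
Qed.

(** On a curve that leaves [U], let [inf A] and [sup A] be the first and last times outside [U]. The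
    function equals [c] at both, so only the two end pieces contribute, and these run inside [U],
    where the gradient is unchanged. *)
Lemma upper_gradient_restrict (f : X -> R) (g : X -> \bar R) (U : set X) (c : R) :
  open U -> (forall x, ~ U x -> f x = c) ->
  upper_gradient (EFin \o f) g -> upper_gradient (EFin \o f) (g \_ U).
Proof.
move=> oU fc ug; have [g0 bg h] := ug.
have g0' x : (0 <= (g \_ U) x)%E by apply: erestrict_ge0.
have bg' := borel_restrict oU bg.
split=> // l gam lg; have [l0 _] := lg.
have cg := arclength_clamp_continuous lg.
have mG := continuous_borel_comp cg bg.
have mG' := continuous_borel_comp cg bg'.
have -> : (\int[leb]_(t in `[0%R, l]) (g \_ U) (gam t) =
           \int[leb]_(t in `[0%R, l]) (g \_ U) (gam (clamp l t)))%E.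
  by apply: eq_integral => t; rewrite inE/= in_itv/= => tl; rewrite clamp_id.
have edge a b : 0 <= a -> a <= b -> b <= l ->
    (forall t, a < t -> t < b -> U (gam t)) ->
    (`|(f (gam a))%:E - (f (gam b))%:E| <=
      \int[leb]_(t in `]a, b[) (g \_ U) (gam (clamp l t)))%E.
  move=> a0; rewrite le_eqVlt => /predU1P[<- _ _|ab bl hU].
    by rewrite subee// abse0 integral_ge0.
  apply: le_trans (upper_gradient_subcurve ug lg a0 ab bl) _.
  rewrite le_eqVlt; apply/orP; left; apply/eqP; apply: eq_integral => t.
  rewrite inE/= in_itv/= => /andP[at1 tb]; rewrite patchT// inE clamp_id; last lra.
  exact: hU.
pose A := [set t | 0 <= t <= l /\ ~ U (gam t)].
have inU t : 0 <= t <= l -> ~ A t -> U (gam t).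
  by move=> tl At; apply: contrapT => Ut; apply: At.
have [A0|/eqP/set0P[t At]] := pselect (A = set0).
  have := edge 0 l (lexx _) (ltW l0) (lexx _).
  rewrite -(@integral_itv_bndoo _ _ _ _ true false); last exact: measurable_funS mG'.
  by apply=> t t0 tl; apply: inU; [lra|rewrite A0].
have Ub s : A s -> 0 <= s <= l by case.
(* [U] is open, so a limit of times outside [U] is itself outside; this applies to [inf A] and
   [sup A]. *)
have nU s : (forall e, 0 < e -> exists2 t, A t & `|s - t| < e) -> 0 <= s <= l -> ~ U (gam s).
  move=> hs sl Us.
  have : \forall t \near s, U (gam (clamp l t)).
    by apply: cg; apply: open_nbhs_nbhs; split=> //=; rewrite clamp_id.
  move=> /nbhs_ballP[e/= e0 he]; have [t0 At0 st0] := hs e e0.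
  by have := he t0 st0; rewrite clamp_id//; [case: At0|exact: Ub].
have hiA : has_inf A by split; [exists t|exists 0 => s /Ub /andP[]].
have hsA : has_sup A by split; [exists t|exists l => s /Ub /andP[]].
have iA s : A s -> inf A <= s by apply: ge_inf; exact: hiA.2.
have sA s : A s -> s <= sup A by apply: ub_le_sup; exact: hsA.2.
have i0 : 0 <= inf A by apply: lb_le_inf; [exists t|move=> s /Ub /andP[]].
have sl : sup A <= l by apply: ge_sup; [exists t|move=> s /Ub /andP[]].
have is' : inf A <= sup A by apply: le_trans (iA _ At) (sA _ At).
have fi : f (gam (inf A)) = c.
  apply: fc; apply: nU; last lra.
  move=> e e0; have [u Au ue] := inf_adherent e0 hiA; exists u => //.
  by rewrite distrC ger0_norm; [lra|rewrite subr_ge0 iA].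
have fs : f (gam (sup A)) = c.
  apply: fc; apply: nU; last lra.
  move=> e e0; have [u Au ue] := sup_adherent e0 hsA; exists u => //.
  by rewrite ger0_norm; [lra|rewrite subr_ge0 sA].
have E1 := edge _ _ (lexx 0) i0 (le_trans is' sl).
have E2 := edge _ _ (le_trans i0 is') sl (lexx l).
apply: (@le_trans _ _ (\int[leb]_(t in `]0%R, (inf A)[) (g \_ U) (gam (clamp l t)) +
  \int[leb]_(t in `](sup A), l[) (g \_ U) (gam (clamp l t)))%E).
  apply: le_trans (leeD (E1 _) (E2 _)).
  - by rewrite fi fs -!EFinB !abse_EFin -EFinD lee_fin ler_distD.
  - by move=> s s0 si; apply: inU; [lra|move=> /iA; lra].
  - by move=> s s0 si; apply: inU; [lra|move=> /sA; lra].
rewrite -ge0_integral_setU//=.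
- apply: ge0_subset_integral => //.
  + exact: measurableU.
  + exact: measurable_funS mG'.
  + by move=> s [] /=; rewrite !in_itv/=; lra.
- exact: measurable_funS mG'.
- rewrite disj_set2E; apply/eqP/seteqP; split=> // s [] /=; rewrite !in_itv/=; lra.
Qed.

End upper_gradients.

(** * Integrals along curves *)

Section increments.
Context {R : realType}.
Local Notation leb := (@lebesgue_measure R).
Implicit Types (F G : R -> R).

Lemma lipschitz_real_continuous G (L : R) :
  (forall a b, `|G a - G b| <= L * `|a - b|) -> continuous G.
Proof.
move=> h x; apply/cvgrPdist_lt => e e0.
have k0 : 0 < `|L| + 1 by rewrite ltr_wpDl.
have := nbhsx_ballx x _ (divr_gt0 e0 k0); apply: filterS => b.
rewrite /ball/= ltr_pdivlMr// mulrC; apply: le_lt_trans.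
apply: le_trans (h x b) _; rewrite ler_wpM2r//.
by rewrite (le_trans (ler_norm L))// lerDl.
Qed.

Lemma lipschitz_measurable G (L : R) :
  (forall a b, `|G a - G b| <= L * `|a - b|) -> measurable_fun [set: R] G.
Proof. by move=> /lipschitz_real_continuous; exact: continuous_measurable_fun. Qed.

Lemma ge0_integral_itv_split (G : R -> \bar R) (a b c : R) : a <= b -> b <= c ->
  measurable_fun [set: R] G -> (forall t, 0 <= G t)%E ->
  (\int[leb]_(t in `[a, c[) G t =
   \int[leb]_(t in `[a, b[) G t + \int[leb]_(t in `[b, c[) G t)%E.
Proof.
move=> ab bc mG G0; rewrite -ge0_integral_setU//.
- by congr integral; apply/seteqP; split=> t /=; rewrite !in_itv/=; [have := leP b t => -[]|]; lra.
- exact: measurable_funS mG.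
- by rewrite disj_set2E; apply/eqP/seteqP; split=> // s [] /=; rewrite !in_itv/=; lra.
Qed.

Lemma integral_ge_telescope G F (h e : R) n : 0 <= h -> measurable_fun [set: R] G ->
  (forall t, 0 <= G t) ->
  (forall k, (k < n)%N -> ((F (k.+1%:R * h) - F (k%:R * h) - e)%:E <=
     \int[leb]_(t in `[(k%:R * h)%R, (k.+1%:R * h)%R[) (G t)%:E)%E) ->
  ((F (n%:R * h) - F 0 - n%:R * e)%:E <= \int[leb]_(t in `[0%R, (n%:R * h)%R[) (G t)%:E)%E.
Proof.
move=> h0 mG G0; elim: n => [|n ih] H.
  by rewrite !mul0r subrr subr0 integral_ge0// => t _; rewrite lee_fin.
rewrite (@ge0_integral_itv_split _ _ (n%:R * h)); last 4 first.
- by rewrite mulr_ge0.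
- by rewrite ler_wpM2r// ler_nat.
- exact/measurable_EFinP.
- by move=> t; rewrite lee_fin.
apply: le_trans (leeD (ih _) (H n _)) => //; last by move=> k kn; apply: H; exact: ltnW.
by rewrite -EFinD lee_fin -natr1; lra.
Qed.

Lemma integral_le_telescope G F (h e : R) n : 0 <= h -> measurable_fun [set: R] G ->
  (forall t, 0 <= G t) ->
  (forall k, (k < n)%N ->
     (\int[leb]_(t in `[(k%:R * h)%R, (k.+1%:R * h)%R[) (G t)%:E <=
      (F (k.+1%:R * h) - F (k%:R * h) + e)%:E)%E) ->
  (\int[leb]_(t in `[0%R, (n%:R * h)%R[) (G t)%:E <= (F (n%:R * h) - F 0 + n%:R * e)%:E)%E.
Proof.
move=> h0 mG G0; elim: n => [|n ih] H.
  by rewrite !mul0r subrr addr0 set_itv_ge ?bnd_simp ?ltxx// integral_set0.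
rewrite (@ge0_integral_itv_split _ _ (n%:R * h)); last 4 first.
- by rewrite mulr_ge0.
- by rewrite ler_wpM2r// ler_nat.
- exact/measurable_EFinP.
- by move=> t; rewrite lee_fin.
apply: le_trans (leeD (ih _) (H n _)) _ => //; first by move=> k kn; apply: H; exact: ltnW.
by rewrite -EFinD lee_fin -natr1; lra.
Qed.

Lemma integral_cst_itv (a b r : R) : a <= b ->
  (\int[leb]_(t in `[a, b[) r%:E = (r * (b - a))%:E)%E.
Proof.
move=> ab; rewrite integral_cst//= lebesgue_measure_itv/= lte_fin.
case: ltP => [_|ba]; first by rewrite -EFinB -EFinM.
by rewrite (_ : b - a = 0) ?mulr0 ?mule0//; lra.
Qed.

Section lipschitz_integrand.
Variables (G : R -> R) (L l : R).
Hypotheses (l0 : 0 <= l) (L0 : 0 <= L) (G0 : forall t, 0 <= G t).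
Hypothesis GL : forall a b, `|G a - G b| <= L * `|a - b|.

Let mG : measurable_fun [set: R] G.
Proof. exact: lipschitz_measurable GL. Qed.

Let piece_ge a b : a <= b ->
  (((G a - L * (b - a)) * (b - a))%:E <= \int[leb]_(t in `[a, b[) (G t)%:E)%E.
Proof.
move=> ab; apply: (@le_trans _ _ (\int[leb]_(t in `[a, b[) (Num.max 0 (G a - L * (b - a)))%:E)%E).
  by rewrite integral_cst_itv// lee_fin ler_wpM2r ?subr_ge0// le_max lexx orbT.
apply: ge0_le_integral => //=.
- by move=> t _; rewrite lee_fin le_max lexx.
- by apply/measurable_EFinP; exact: measurable_funS mG.
- move=> t; rewrite in_itv/= => /andP[at_ tb]; rewrite lee_fin ge_max G0/=.
  have := GL a t; rewrite (distrC a) (ger0_norm (_ : 0 <= t - a)) ?subr_ge0//.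
  move=> /(le_trans (ler_norm _)) h.
  have : L * (t - a) <= L * (b - a) by rewrite ler_wpM2l// lerD2r ltW.
  by lra.
Qed.

Let piece_le a b : a <= b ->
  (\int[leb]_(t in `[a, b[) (G t)%:E <= ((G a + L * (b - a)) * (b - a))%:E)%E.
Proof.
move=> ab; rewrite -integral_cst_itv//.
apply: ge0_le_integral => //=.
- by move=> t _; rewrite lee_fin.
- by apply/measurable_EFinP; exact: measurable_funS mG.
- move=> t; rewrite in_itv/= => /andP[at_ tb]; rewrite lee_fin.
  have := GL a t; rewrite (distrC a) (ger0_norm (_ : 0 <= t - a)) ?subr_ge0//.
  rewrite distrC => /(le_trans (ler_norm _)) h.
  have : L * (t - a) <= L * (b - a) by rewrite ler_wpM2l// lerD2r ltW.
  by lra.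
Qed.

Let mesh e : 0 < e -> exists n : nat, 0 < n%:R :> R /\ l / n%:R < e.
Proof.
move=> e0; exists (Num.truncn (l / e)).+1; split; first by rewrite ltr0n.
by rewrite ltr_pdivrMr ?ltr0n// mulrC -ltr_pdivrMr// truncnS_gt.
Qed.

Let itv_mesh n : 0 < n%:R :> R ->
  (\int[leb]_(t in `[0%R, l]) (G t)%:E = \int[leb]_(t in `[0%R, (n%:R * (l / n%:R))%R[) (G t)%:E)%E.
Proof.
move=> n0; rewrite mulrCA divff ?mulr1 ?gt_eqF//.
have mG' : measurable_fun `]0, l[ (EFin \o G).
  by apply/measurable_EFinP; exact: measurable_funS mG.
by rewrite (@integral_itv_bndoo _ _ _ _ true true)// (@integral_itv_bndoo _ _ _ _ true false).
Qed.

Let mesh_in n k : 0 < n%:R :> R -> (k <= n)%N -> 0 <= k%:R * (l / n%:R) <= l.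
Proof.
move=> n0 kn; rewrite mulr_ge0 ?divr_ge0// mulrCA ler_piMr// ler_pdivrMr// mul1r.
by rewrite ler_nat.
Qed.

Let mesh_step n k : k.+1%:R * (l / n%:R) - k%:R * (l / n%:R) = l / n%:R.
Proof. by rewrite -mulrBl -natr1 addrC addKr mul1r. Qed.

(** No derivative of [F] is needed: a first-order bound on the increments over short intervals
    suffices, because on a mesh of size [h] the errors add up to [2 * L * l * h]. *)
Lemma integral_ge_increment F (eta : R) : 0 < eta ->
  (forall a b, 0 <= a -> a <= b -> b <= l -> b - a < eta ->
    F b - F a <= (G a + L * (b - a)) * (b - a)) ->
  ((F l - F 0)%:E <= \int[leb]_(t in `[0%R, l]) (G t)%:E)%E.
Proof.
move=> eta0 hF; apply/lee_addgt0Pr => e e0.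
have Ll : 0 < 2 * L * l + 1 by rewrite ltr_wpDl// !mulr_ge0.
have [n [n0 hn]] := @mesh (Num.min eta (e / (2 * L * l + 1))) ltac:(by rewrite lt_min eta0 divr_gt0).
move: hn; rewrite lt_min ltr_pdivlMr// => /andP[hn1 hn2].
rewrite (itv_mesh n0); set h := l / n%:R in hn1 hn2 *.
have h0 : 0 <= h by rewrite divr_ge0// ltW.
have -> : F l = F (n%:R * h) by rewrite /h mulrCA divff ?mulr1 ?gt_eqF.
rewrite -leeBlDr// -EFinB.
apply: le_trans (@integral_ge_telescope G F h (2 * L * h * h) n h0 mG G0 _).
  rewrite lee_fin lerD2l lerN2.
  have -> : n%:R * (2 * L * h * h) = (2 * L * l) * h.
    by rewrite /h; field; rewrite gt_eqF.
  by apply: ltW; apply: le_lt_trans hn2; rewrite mulrC ler_wpM2l// lerDl.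
move=> k kn; apply: le_trans (piece_ge _); last by rewrite ler_wpM2r// ler_nat.
have /andP[k0 _] := mesh_in n0 (ltnW kn); have /andP[_ k1] := mesh_in n0 kn.
rewrite lee_fin.
have := hF _ _ k0 _ k1; rewrite mesh_step -/h => /(_ _ hn1) H.
have := H ltac:(by rewrite ler_wpM2r// ler_nat).
lra.
Qed.

(** Only increments of [F] enter, so [F] may jump; the lemma is applied to a time change that is
    monotone but possibly discontinuous. On a mesh of size [h] the factor [1 + C * h] costs
    [C * h * (F l - F 0)], and the oscillation of [G] costs [L * l * h]. *)
Lemma integral_le_increment F (C : R) : 0 <= C -> F 0 <= F l ->
  (forall a b, 0 <= a -> a <= b -> b <= l ->
     G a * (b - a) <= (1 + C * (b - a)) * (F b - F a)) ->
  (\int[leb]_(t in `[0%R, l]) (G t)%:E <= (F l - F 0)%:E)%E.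
Proof.
move=> C0 F0l hF; apply/lee_addgt0Pr => e e0.
have D0 : 0 < L * l + C * (F l - F 0) + 1.
  by rewrite ltr_wpDl// addr_ge0 ?mulr_ge0 ?subr_ge0.
have [n [n0 hn]] := mesh (divr_gt0 e0 D0).
move: hn; rewrite ltr_pdivlMr// => hn.
rewrite (itv_mesh n0); set h := l / n%:R in hn *.
have h0 : 0 <= h by rewrite divr_ge0// ltW.
have nh : n%:R * h = l by rewrite /h mulrCA divff ?mulr1 ?gt_eqF.
apply: le_trans (@integral_le_telescope G (fun t => (1 + C * h) * F t) h (L * h * h) n h0 mG G0 _) _.
  move=> k kn; apply: le_trans (piece_le _) _; first by rewrite ler_wpM2r// ler_nat.
  have /andP[k0 _] := mesh_in n0 (ltnW kn); have /andP[_ k1] := mesh_in n0 kn.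
  rewrite lee_fin.
  have := hF _ _ k0 _ k1; rewrite mesh_step -/h => /(_ ltac:(by rewrite ler_wpM2r// ler_nat)).
  lra.
rewrite nh -EFinD lee_fin.
have -> : n%:R * (L * h * h) = (L * l) * h.
  by rewrite /h; field; rewrite gt_eqF.
nra.
Qed.

End lipschitz_integrand.
End increments.

(** * Reparametrization by arclength *)

Section reparametrization.
Context {R : realType} {d : measure_display} {X : metricMeasurableType R d}.
Implicit Types (gam : R -> X) (a b c t : R).

Lemma polygon_length_comp gam s a l :
  polygon_length (gam \o s) a l = polygon_length gam (s a) (map s l).
Proof. by elim: l a => //= x l ih a; rewrite ih. Qed.

Lemma eq_polygon_length gam gam' a l : (forall t, t \in a :: l -> gam t = gam' t) ->
  polygon_length gam a l = polygon_length gam' a l.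
Proof.
elim: l a => //= x l ih a h; rewrite !h ?mem_head ?inE ?eqxx ?orbT// ih// => t tl.
by rewrite h// in_cons tl orbT.
Qed.

(** The arclength function is continuous, and [sigma] is a right inverse of it, possibly with jumps.
    The choice of the inverse does not affect [gam \o sigma], since arclength is constant on an
    interval only if [gam] is. The last clause stands in for a derivative of [sigma]: it turns
    length bounds for [gam] into bounds for increments of the new parameter. *)
Lemma arclength_reparametrization gam (T k : R) : 0 < T -> 0 <= k ->
  (forall a b, 0 <= a -> a <= b -> b <= T -> mdist (gam a) (gam b) <= k * (b - a)) ->
  gam 0 <> gam T ->
  exists l gam' (sigma : R -> R), [/\ arclength_curve l gam',
    gam' 0 = gam 0 /\ gam' l = gam T,
    forall t, 0 <= t <= l -> 0 <= sigma t <= T /\ gam' t = gam (sigma t),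
    forall s t, 0 <= s -> s <= t -> t <= l -> sigma s <= sigma t &
    forall s t, 0 <= s -> s <= t -> t <= l ->
      ((t - s)%:E <= curve_length (sigma s) (sigma t) gam)%E].
Proof.
move=> T0 k0 lip neq.
have CLle a b : 0 <= a -> a <= b -> b <= T -> (curve_length a b gam <= (k * (b - a))%:E)%E.
  move=> a0 ab bT; apply: curve_length_le => // x y ax xy yb.
  by apply: lip => //; [exact: le_trans ax|exact: le_trans yb bT].
have CLfin a b : 0 <= a -> a <= b -> b <= T -> curve_length a b gam \is a fin_num.
  move=> a0 ab bT; rewrite ge0_fin_numE ?curve_length_ge0//.
  exact: le_lt_trans (CLle _ _ a0 ab bT) (ltry _).
pose s t := fine (curve_length 0 t gam).
have sE t : 0 <= t -> t <= T -> curve_length 0 t gam = (s t)%:E.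
  by move=> t0 tT; rewrite fineK// CLfin.
have s_dist a b : 0 <= a -> a <= b -> b <= T -> s a + mdist (gam a) (gam b) <= s b.
  move=> a0; rewrite le_eqVlt => /predU1P[->|ab] bT; first by rewrite mdistxx addr0.
  have := curve_length_rcons 0 gam ab.
  by rewrite !sE ?(le_trans a0 (ltW ab)) ?(le_trans (ltW ab) bT)// -EFinD lee_fin.
have s_split a b : 0 <= a -> a <= b -> b <= T -> ((s b - s a)%:E <= curve_length a b gam)%E.
  move=> a0 ab bT; have := curve_length_split gam a0 ab.
  by rewrite !sE ?(le_trans a0 ab) ?(le_trans ab bT)// EFinB leeBlDl.
have s_nd a b : 0 <= a -> a <= b -> b <= T -> s a <= s b.
  move=> a0 ab bT; apply: le_trans (s_dist _ _ a0 ab bT).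
  by rewrite lerDl mdist_ge0.
have s_lip a b : 0 <= a -> a <= b -> b <= T -> s b - s a <= k * (b - a).
  by move=> a0 ab bT; rewrite -lee_fin (le_trans (s_split _ _ a0 ab bT))// CLle.
have s0 : s 0 = 0.
  apply/le_anti; rewrite -!lee_fin -!sE ?(ltW T0)// curve_length_ge0// andbT.
  by have := CLle 0 0 (lexx _) (lexx _) (ltW T0); rewrite subrr mulr0.
pose l := s T.
have l0 : 0 < l.
  apply: lt_le_trans (s_dist 0 T (lexx _) (ltW T0) (lexx _)).
  by rewrite s0 add0r mdist_gt0; apply/eqP.
(* A preimage of [t] under [s] is the supremum of the times with arclength at most [t]; for [t]
   outside [[0, l]] the value 0 is a dummy that makes the choice total. *)
have ivt t : exists u, 0 <= t <= l -> 0 <= u <= T /\ s u = t.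
  have [tl|tl] := pselect (0 <= t <= l); last by exists 0.
  pose A := [set u | 0 <= u <= T /\ s u <= t].
  have A0 : A 0 by split; [rewrite lexx ltW|rewrite s0; case/andP: tl].
  have hA : has_sup A by split; [exists 0|exists T => u [/andP[]]].
  have u0 : 0 <= sup A by apply: ub_le_sup => //; exact: hA.2.
  have uT : sup A <= T by apply: ge_sup; [exists 0|move=> u [/andP[]]].
  exists (sup A) => _; split; first by rewrite u0.
  apply/le_anti/andP; split; apply/ler_addgt0Pr => e e0; have k1 : 0 < k + 1 by rewrite ltr_wpDl.
    have [v Av ve] := sup_adherent (divr_gt0 e0 k1) hA.
    have [/andP[v0 vT] vt] := Av.
    have vs : v <= sup A by apply: ub_le_sup => //; exact: hA.2.
    have := s_lip _ _ v0 vs uT.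
    have : (k + 1) * (sup A - v) <= e.
      by rewrite mulrC -ler_pdivlMr//; lra.
    nra.
  have [->|uT'] := eqVneq (sup A) T.
    by case/andP: tl => _ tl; apply: le_trans tl _; rewrite lerDl ltW.
  have {}uT : sup A < T by rewrite lt_neqAle uT'.
  pose v := Num.min T (sup A + e / (k + 1)).
  have uv : sup A < v by rewrite lt_min uT ltrDl divr_gt0.
  have vT : v <= T by rewrite ge_min lexx.
  have ve : v <= sup A + e / (k + 1) by rewrite ge_min lexx orbT.
  have v0 : 0 <= v by rewrite (le_trans u0)// ltW.
  have := s_lip _ _ u0 (ltW uv) vT.
  have : (k + 1) * (v - sup A) <= e.
    by rewrite mulrC -ler_pdivlMr//; lra.
  have : t < s v.
    rewrite ltNge; apply/negP => svt.
    have : v <= sup A by apply: ub_le_sup; [exact: hA.2|split=> //; rewrite v0].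
    by rewrite leNgt uv.
  nra.
have /boolp.choice[sg sgP] := ivt.
have sgl t : 0 <= t <= l -> 0 <= sg t <= T by move=> /sgP[].
have ssg t : 0 <= t <= l -> s (sg t) = t by move=> /sgP[].
have sg_nd a b : 0 <= a -> a <= b -> b <= l -> sg a <= sg b.
  move=> a0 ab bl; have [//|ba] := leP (sg a) (sg b).
  have al : 0 <= a <= l by rewrite a0 (le_trans ab).
  have bl' : 0 <= b <= l by rewrite bl (le_trans a0).
  have /andP[_ h1] := sgl _ al; have /andP[h2 _] := sgl _ bl'.
  have := s_nd _ _ h2 (ltW ba) h1; rewrite !ssg// => ba'.
  by move: ba; rewrite (_ : a = b) ?ltxx//; apply/le_anti; rewrite ab.
have geq a b : 0 <= a <= T -> 0 <= b <= T -> s a = s b -> gam a = gam b.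
  wlog ab : a b / a <= b => [h|] aT bT sab.
    by have [/h|/ltW/h] := leP a b; [exact|move=> H; apply/esym/H].
  have/andP[a0 _] := aT; have /andP[_ b1] := bT.
  apply: mdist_positivity; apply/le_anti; rewrite mdist_ge0 andbT.
  by have := s_dist _ _ a0 ab b1; rewrite sab gerDl.
have gsg u : 0 <= u <= T -> gam (sg (s u)) = gam u.
  move=> uT; have su : 0 <= s u <= l.
    by case/andP : uT => u0 uT; rewrite -{1}s0 !s_nd.
  by apply: geq => //; [exact: sgl|exact: ssg].
have TT : 0 <= T <= T by apply/andP; split => //; exact: ltW.
have T00 : 0 <= (0 : R) <= T by apply/andP; split => //; exact: ltW.
have ss a b : 0 <= a -> a <= b -> b <= l ->
    ((b - a)%:E <= curve_length (sg a) (sg b) gam)%E.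
  move=> a0 ab bl.
  have al : 0 <= a <= l by rewrite a0 (le_trans ab).
  have bl' : 0 <= b <= l by rewrite bl (le_trans a0).
  have /andP[h1 _] := sgl _ al; have /andP[_ h2] := sgl _ bl'.
  by have := s_split _ _ h1 (sg_nd _ _ a0 ab bl) h2; rewrite !ssg.
exists l, (gam \o sg), sg; split => //.
- split=> // t /andP[t0 tl]; apply/le_anti/andP; split.
    rewrite -[X in (_ <= X%:E)%E]mul1r -[X in (1 * X)]subr0.
    apply: curve_length_le => // x y x0 xy yt; rewrite mul1r /=.
    have yl := le_trans yt tl.
    have xl : 0 <= x <= l by rewrite x0 (le_trans xy).
    have yl' : 0 <= y <= l by rewrite yl (le_trans x0).
    have /andP[h1 _] := sgl _ xl; have /andP[_ h2] := sgl _ yl'.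
    by have := s_dist _ _ h1 (sg_nd _ _ x0 xy yl) h2; rewrite !ssg//; lra.
  (* Lower bound: each vertex [u] of a partition of [[0, sg t]] has the same image as the parameter
     [s u] of the new curve, so the polygon is inscribed in the new curve, with possibly repeated
     parameters. *)
  have tl' : 0 <= t <= l by rewrite t0.
  rewrite -{1}(ssg _ tl'); have /andP[st0 stT] := sgl _ tl'.
  rewrite -sE//; apply/curve_lengthP => q pq lq.
  have qT u : u \in 0 :: q -> 0 <= u <= sg t.
    have H : forall x, u \in x :: q -> path <%R x q -> x <= u <= last x q.
      elim: q {pq lq} => [|y q ih] x /=.
        by rewrite inE => /eqP -> _; rewrite lexx.
      rewrite inE => /predU1P[->|uq] /andP[xy yq]; last first.
        by have /andP[h1 ->] := ih _ uq yq; rewrite (le_trans (ltW xy)).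
      rewrite lexx/= (le_trans (ltW xy))//.
      by elim: q y {ih xy} yq => //= z q ih y /andP[/ltW yz /ih]; exact: le_trans.
    by move=> /H/(_ pq); rewrite lq.
  have qTT u : u \in 0 :: q -> 0 <= u <= T.
    by move=> /qT/andP[-> h]; exact: le_trans stT.
  rewrite (@eq_polygon_length _ ((gam \o sg) \o s)); last first.
    by move=> u /qTT uT /=; rewrite gsg.
  rewrite polygon_length_comp s0; apply: polygon_length_le_weak; last first.
    by rewrite -{1}s0 last_map lq ssg.
  rewrite -s0 path_map.
  have : path <=%R 0 q by apply: sub_path pq => x y; exact: ltW.
  apply: (@sub_in_path _ (mem (0 :: q))); last exact/allP.
  move=> x y /qTT/andP[x0 _] /qTT/andP[_ yT] xy; exact: s_nd.
- split=> /=; last exact: gsg.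
  by rewrite -{1}s0 gsg.
- by move=> t tl; split=> //; exact: sgl.
Qed.

End reparametrization.

(** * Averages over balls and the Poincare inequality *)

Section balls.
Context {R : realType} {d : measure_display} {X : metricMeasurableType R d}.
Variable mu : {measure set X -> \bar R}.
Hypothesis cbm : complete_borel_measure mu.
Implicit Types (x y : X) (r p : R) (f h : X -> R) (E B : set X).

Definition ball_mass x r : R := fine (mu (ball x r)).
Definition ball_average f x r : R :=
  (ball_mass x r)^-1 * \int[mu]_(y in ball x r) f y.

Lemma open_mball x r : open (ball x r).
Proof.
rewrite ballEmdist openE => y /= xy; apply/nbhs_ballP; exists (r - mdist x y).
  by rewrite /= subr_gt0.
move=> z; rewrite ballEmdist/= => yz.
by have := metric_triangle x y z; lra.
Qed.

Lemma measurable_mball x r : measurable (ball x r).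
Proof. by have [oB _ _] := cbm; apply: oB; exact: open_mball. Qed.

Lemma ball_massE x r : 0 < r -> mu (ball x r) = (ball_mass x r)%:E.
Proof.
have [_ _ H] := cbm; move=> /(H x)/andP[h0 h1]; rewrite fineK// ge0_fin_numE//.
Qed.

Lemma ball_mass_gt0 x r : 0 < r -> 0 < ball_mass x r.
Proof.
by have [_ _ H] := cbm; move=> r0; have /andP[h0 _] := H x _ r0; rewrite -lte_fin -ball_massE.
Qed.

Lemma sub_ball_mass x y r r' : 0 < r -> ball x r `<=` ball y r' -> ball_mass x r <= ball_mass y r'.
Proof.
move=> r0 sub.
have r'0 : 0 < r'.
  by have := sub x (ballxx x r0); rewrite ballEmdist/=; exact: le_lt_trans (mdist_ge0 _ _).
rewrite -lee_fin -!ball_massE//.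
by apply: le_measure; rewrite ?inE//; exact: measurable_mball.
Qed.

Lemma le_ball_mass x r r' : 0 < r -> r <= r' -> ball_mass x r <= ball_mass x r'.
Proof. by move=> r0 rr'; apply: sub_ball_mass => //; exact: le_ball. Qed.

Lemma mu_sub_ball_fin E x r : E `<=` ball x r -> measurable E -> (mu E < +oo)%E.
Proof.
move=> sub mE; have [r0|r0] := ltP 0 r; last first.
  suff -> : E = set0 by rewrite measure0.
  apply/seteqP; split=> // y /sub; rewrite ballEmdist/= => /(le_lt_trans (mdist_ge0 _ _)).
  by rewrite ltNge r0.
apply: (@le_lt_trans _ _ (mu (ball x r))).
  by apply: le_measure; rewrite ?inE//; exact: measurable_mball.
by rewrite ball_massE// ltry.
Qed.

Lemma bounded_integrable_sub_ball f E x r (M : R) : E `<=` ball x r -> measurable E ->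
  measurable_fun [set: X] f -> (forall y, E y -> `|f y| <= M) ->
  mu.-integrable E (EFin \o f).
Proof.
move=> sub mE mf fM; apply: measurable_bounded_integrable => //.
- exact: mu_sub_ball_fin sub mE.
- exact: measurable_funS mf.
- exists M; split; first exact: num_real.
  by move=> z Mz y /= /fM/le_trans; apply; exact: ltW.
Qed.

Lemma bounded_integrable_ball f x r (M : R) :
  measurable_fun [set: X] f -> (forall y, ball x r y -> `|f y| <= M) ->
  mu.-integrable (ball x r) (EFin \o f).
Proof. by move=> mf fM; apply: (@bounded_integrable_sub_ball f _ x r M) => //; exact: measurable_mball. Qed.

Lemma averageE f x r : 0 < r -> mu.-integrable (ball x r) (EFin \o f) ->
  average mu (ball x r) (EFin \o f) = (ball_average f x r)%:E.
Proof.
move=> r0 fi; rewrite /average ball_massE// inver gt_eqF ?ball_mass_gt0//.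
rewrite /ball_average EFinM; congr (_ * _)%E.
by rewrite /Rintegral fineK//; apply: (integrable_fin_num (measurable_mball x r) fi).
Qed.

(** Chebyshev's inequality, applied below to oscillations, to chain costs and to test functions. *)
Lemma Rintegral_ge_cst f B E (k : R) : measurable B -> measurable E -> E `<=` B ->
  mu.-integrable B (EFin \o f) -> (mu B < +oo)%E -> (forall y, B y -> 0 <= f y) ->
  (forall y, E y -> k <= f y) ->
  k * fine (mu E) <= \int[mu]_(y in B) f y.
Proof.
move=> mB mE EB fi Bfin f0 fk.
have muE : (mu E < +oo)%E.
  by apply: le_lt_trans Bfin; apply: le_measure; rewrite ?inE.
have fiE : mu.-integrable E (EFin \o f) by apply: integrableS fi.
rewrite -(Rintegral_cst mu mE).
apply: (@le_trans _ _ (\int[mu]_(y in E) f y)).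
  apply: le_Rintegral => //; apply: measurable_bounded_integrable => //.
  exists `|k|; split; first exact: num_real.
  by move=> z kz y /= _; exact: ltW.
rewrite /Rintegral fine_le//; [exact: integrable_fin_num..|].
apply: ge0_subset_integral => //; exact: measurable_int fi.
Qed.

Definition poincare_with p (C lam : R) : Prop :=
  forall (x : X) (r : R) (f g : X -> \bar R), 0 < r ->
  mu.-integrable [set: X] f -> upper_gradient f g ->
  let B := ball x r in
  let lambdaB := ball x (lam * r) in
  (average mu B (fun y => `|f y - average mu B f|) <=
   (C * r)%:E * (average mu lambdaB (fun y => g y `^ p)) `^ p^-1)%E.

Definition doubling_with (Cd : R) : Prop :=
  forall x r, 0 < r -> ball_mass x (2 * r) <= Cd * ball_mass x r.

Lemma doubling_withP : doubling mu -> exists2 Cd, 1 <= Cd & doubling_with Cd.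
Proof.
move=> [Cd Cd0 h]; exists (Num.max 1 Cd); first by rewrite le_max lexx.
move=> x r r0; have := h x r r0.
rewrite !ball_massE ?mulr_gt0// -EFinM lee_fin => /le_trans; apply.
by rewrite ler_wpM2r ?(ltW (ball_mass_gt0 x r0))// le_max lexx orbT.
Qed.

Section poincare_step.
Variables (p C lam : R).
Hypotheses (p1 : 1 < p) (C0 : 0 < C) (lam1 : 1 <= lam).
Hypothesis poinc : poincare_with p C lam.

Variables (f : X -> R) (g : X -> \bar R).
Hypotheses (mf : measurable_fun [set: X] f) (f01 : forall x, 0 <= f x <= 1).
Hypotheses (fi : mu.-integrable [set: X] (EFin \o f)) (ug : upper_gradient (EFin \o f) g).

Let f_itg x r : mu.-integrable (ball x r) (EFin \o f).
Proof. by apply: integrableS fi => //; exact: measurable_mball. Qed.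

Lemma ball_average_itv x r : 0 < r -> 0 <= ball_average f x r <= 1.
Proof.
move=> r0; have m0 := ball_mass_gt0 x r0.
rewrite /ball_average mulr_ge0 ?invr_ge0 ?(ltW m0)//=; last first.
  by apply: Rintegral_ge0 => y _; case/andP: (f01 y).
rewrite mulrC ler_pdivrMr//.
rewrite (_ : 1 * _ = \int[mu]_(y in ball x r) 1); last first.
  by rewrite Rintegral_cst//; exact: measurable_mball.
apply: le_Rintegral => //; first exact: measurable_mball.
- apply: (@bounded_integrable_ball _ _ _ 1) => //.
  by move=> y _; rewrite normr1.
- by move=> y _; case/andP: (f01 y).
Qed.

Lemma osc_measurable (c : R) : measurable_fun [set: X] (fun y => `|f y - c|).
Proof. by apply: measurableT_comp => //; exact: measurable_funB. Qed.

Lemma osc_integrable x r (c : R) : mu.-integrable (ball x r) (EFin \o (fun y => `|f y - c|)).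
Proof.
apply: (@bounded_integrable_ball _ _ _ (1 + `|c|)) => //; first exact: osc_measurable.
move=> y _; rewrite normr_id (le_trans (ler_normB _ _))// lerD2r.
by have /andP[h0 h1] := f01 y; rewrite ger0_norm.
Qed.

(** Dividing by the mass of the ball instead of that of its dilate only enlarges the right-hand
    side, and it removes [lam] from all later formulas except the domain of integration. *)
Lemma poincare_ball x r (J : R) : 0 < r ->
  (\int[mu]_(y in ball x (lam * r)) (g y `^ p) <= J%:E)%E ->
  (ball_mass x r)^-1 * \int[mu]_(y in ball x r) `|f y - ball_average f x r| <=
  C * r * (J / ball_mass x r) `^ p^-1.
Proof.
move=> r0 gJ; have m0 := ball_mass_gt0 x r0.
have lr0 : 0 < lam * r by rewrite mulr_gt0// (lt_le_trans _ lam1).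
have [g0 bg _] := ug.
have gp0 : (0 <= \int[mu]_(y in ball x (lam * r)) (g y `^ p))%E.
  by apply: integral_ge0 => y _; exact: poweR_ge0.
have J0 : 0 <= J by rewrite -lee_fin (le_trans gp0).
have := @poinc x r _ _ r0 fi ug; cbv zeta.
rewrite (averageE r0 (f_itg x r)).
rewrite (_ : (fun y => _) = EFin \o (fun y => `|f y - ball_average f x r|))//.
rewrite averageE//; last exact: osc_integrable.
move=> /le_trans h; rewrite -lee_fin; apply: h.
rewrite (EFinM (C * r)) lee_wpmul2l ?lee_fin ?mulr_ge0 ?(ltW C0) ?(ltW r0)//.
rewrite -poweR_EFin; apply: gt0_ler_poweR.
- by rewrite invr_ge0 (le_trans ler01)// ltW.
- rewrite in_itv/= leey andbT /average mule_ge0// inve_ge0.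
  by rewrite measure_ge0.
- by rewrite in_itv/= leey andbT lee_fin divr_ge0// ltW.
rewrite /average ball_massE// inver gt_eqF ?ball_mass_gt0//.
apply: (@le_trans _ _ ((ball_mass x (lam * r))^-1%:E * J%:E)%E).
  by rewrite lee_wpmul2l// lee_fin invr_ge0 ltW// ball_mass_gt0.
rewrite -EFinM lee_fin mulrC ler_wpM2l//.
rewrite lef_pV2 ?posrE ?ball_mass_gt0// le_ball_mass// ler_peMl// ltW//.
Qed.

(** The difference of the averages is at most the mean of [|f - f_b|] over the small ball, and that
    is at most [Cd] times its mean over the large one. *)
Lemma ball_average_step (Cd : R) x a b (J : R) : 0 < a -> a <= b ->
  ball_mass x b <= Cd * ball_mass x a ->
  (\int[mu]_(y in ball x (lam * b)) (g y `^ p) <= J%:E)%E ->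
  `|ball_average f x a - ball_average f x b| <= Cd * C * b * (J / ball_mass x b) `^ p^-1.
Proof.
move=> a0 ab mab gJ; have b0 := lt_le_trans a0 ab.
have ma := ball_mass_gt0 x a0; have mb := ball_mass_gt0 x b0.
have Cd0 : 0 < Cd by have := lt_le_trans mb mab; rewrite pmulr_lgt0.
apply: (@le_trans _ _ (Cd * ((ball_mass x b)^-1 *
    \int[mu]_(y in ball x b) `|f y - ball_average f x b|))); last first.
  by rewrite -!mulrA ler_wpM2l ?(ltW Cd0)// mulrA; exact: poincare_ball.
set c := ball_average f x b.
have -> : ball_average f x a - c = (ball_mass x a)^-1 * \int[mu]_(y in ball x a) (f y - c).
  rewrite RintegralB ?Rintegral_cst//; [|exact: measurable_mball..|]; last first.
    by apply: (@bounded_integrable_ball _ _ _ `|c|).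
  by rewrite mulrBr mulrCA mulVf ?mulr1 ?gt_eqF.
have foi r : mu.-integrable (ball x r) (EFin \o (fun y => f y - c)).
  apply: (@bounded_integrable_ball _ _ _ (1 + `|c|)) => //; first exact: measurable_funB.
  move=> y _; rewrite (le_trans (ler_normB _ _))// lerD2r.
  by have /andP[h0 h1] := f01 y; rewrite ger0_norm.
rewrite normrM (gtr0_norm (_ : 0 < _^-1)) ?invr_gt0//.
apply: (@le_trans _ _ ((ball_mass x a)^-1 * \int[mu]_(y in ball x b) `|f y - c|)).
  rewrite ler_wpM2l ?invr_ge0 ?(ltW ma)//.
  apply: le_trans (le_normr_Rintegral _ _) _ => //; first exact: measurable_mball.
  rewrite /Rintegral fine_le//.
  - by apply: (integrable_fin_num (measurable_mball x a)); exact: osc_integrable.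
  - by apply: (integrable_fin_num (measurable_mball x b)); exact: osc_integrable.
  apply: ge0_subset_integral; [exact: measurable_mball|exact: measurable_mball| | |].
  - by apply: measurable_int; exact: (osc_integrable x b c).
  - by move=> y _; rewrite lee_fin.
  - exact: le_ball.
rewrite mulrA ler_wpM2r//; first by apply: Rintegral_ge0 => y _.
by rewrite ler_pdivlMr// mulrC ler_pdivrMr.
Qed.

Section telescope.
Variables (Cd : R) (x : X) (q Cq t J : R).
Hypotheses (Cd1 : 1 <= Cd) (dbl : doubling_with Cd).
Hypotheses (qp : q < p) (Cq0 : 0 < Cq) (t0 : 0 < t).
Hypothesis mass : forall b, 0 < b -> b <= t ->
  (b / t) `^ q * ball_mass x t <= Cq * ball_mass x b.
Hypothesis gJ : (\int[mu]_(y in ball x (lam * t)) (g y `^ p) <= J%:E)%E.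

Let beta := 1 - q / p.
Let K := Cd * C * Cq `^ p^-1.
Let N := (J / ball_mass x t) `^ p^-1.

Let p0 : 0 < p. Proof. exact: lt_trans p1. Qed.

Let J0 : 0 <= J.
Proof.
by rewrite -lee_fin (le_trans _ gJ)// integral_ge0// => y _; exact: poweR_ge0.
Qed.

Let beta0 : 0 < beta.
Proof. by rewrite subr_gt0 ltr_pdivrMr// mul1r. Qed.

Let gJ_sub b : b <= t -> (\int[mu]_(y in ball x (lam * b)) (g y `^ p) <= J%:E)%E.
Proof.
move=> bt; apply: le_trans gJ; apply: ge0_subset_integral.
- exact: measurable_mball.
- exact: measurable_mball.
- apply: (measurable_funS measurableT) => //.
  apply: (measurableT_comp (measurable_poweR p)).
  by have [oB _ _] := cbm; have [_ bg _] := ug; exact: borel_measurable bg.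
- by move=> y _; exact: poweR_ge0.
- by apply: le_ball; rewrite ler_wpM2l// (le_trans ler01).
Qed.

(** By the mass bound, [b * m(b)^(-1/p)] is at most a constant times [t * m(t)^(-1/p) * (b/t)^beta];
    since [q < p], the exponent is positive and the steps decay geometrically. *)
Let step a b : 0 < a -> a <= b -> b <= 2 * a -> b <= t ->
  `|ball_average f x a - ball_average f x b| <= K * t * N * (b / t) `^ beta.
Proof.
move=> a0 ab ba bt; have b0 := lt_le_trans a0 ab.
have mt := ball_mass_gt0 x t0; have mb := ball_mass_gt0 x b0.
have bt0 : 0 < b / t by rewrite divr_gt0.
apply: le_trans (@ball_average_step Cd x a b J a0 ab _ (gJ_sub bt)) _.
  by apply: le_trans (dbl x a0); exact: le_ball_mass.
apply: (@le_trans _ _ (Cd * C * b * ((J / ball_mass x t) * (Cq * (b / t) `^ (- q))) `^ p^-1)).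
  rewrite ler_wpM2l ?mulr_ge0 ?(ltW C0) ?(ltW b0) ?(le_trans ler01)//.
  apply: ge0_ler_powR; rewrite ?nnegrE ?invr_ge0 ?(ltW p0)//.
  - by rewrite divr_ge0// ltW.
  - by rewrite !mulr_ge0 ?invr_ge0 ?powR_ge0 ?(ltW mt) ?(ltW Cq0).
  rewrite -mulrA ler_wpM2l// powRN.
  have P0 : 0 < (b / t) `^ q by exact: powR_gt0.
  have -> : (ball_mass x t)^-1 * (Cq * ((b / t) `^ q)^-1) = Cq / ((b / t) `^ q * ball_mass x t).
    by field; rewrite !gt_eqF.
  rewrite -[leLHS]mul1r ler_pdivrMr// mulrAC ler_pdivlMr ?mulr_gt0// mul1r.
  exact: mass.
rewrite (powRM _ (divr_ge0 J0 (ltW mt))) ?mulr_ge0 ?powR_ge0 ?(ltW Cq0)//.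
rewrite (powRM _ (ltW Cq0)) ?powR_ge0// -powRrM mulNr -/N.
have -> : (b / t) `^ beta = (b / t) * (b / t) `^ (- (q / p)).
  by rewrite /beta powRD ?powRr1 ?(ltW bt0)//; apply/implyP => _; rewrite gt_eqF.
rewrite le_eqVlt; apply/orP; left; apply/eqP.
by rewrite /K; field; rewrite gt_eqF.
Qed.

Lemma ball_average_telescope rho : 0 < rho -> rho <= t ->
  `|ball_average f x rho - ball_average f x t| <=
  K / (1 - 2 `^ (- beta)) * t * N.
Proof.
move=> rho0 rhot.
have th1 : 2 `^ (- beta) < 1 :> R.
  rewrite powRN invf_lt1 ?powR_gt0//.
  have : (1 : R) < 2 by rewrite ltr1n.
  by move=> /(gt0_ltr_powR beta0); rewrite powR1; apply; rewrite nnegrE.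
have th0 : 0 < 2 `^ (- beta) :> R by exact: powR_gt0.
have K0 : 0 <= K.
  by rewrite /K !mulr_ge0 ?powR_ge0 ?(ltW C0)// (le_trans ler01).
have N0 : 0 <= N by exact: powR_ge0.
set A := K / _.
have A0 : 0 <= A by rewrite divr_ge0// subr_ge0 ltW.
(* [A] is the sum of the geometric series with first term [K]. This fixed-point equation closes the
   induction below, whose bound carries the factor [(b/t)^beta]. *)
have KA : K + A * 2 `^ (- beta) = A.
  by rewrite /A; field; rewrite gt_eqF// subr_gt0.
suff H : forall n b, rho <= b -> b <= 2 ^+ n * rho -> b <= t ->
    `|ball_average f x rho - ball_average f x b| <= A * t * N * (b / t) `^ beta.
  have [n hn] : exists n : nat, t <= 2 ^+ n * rho.
    exists (Num.truncn (t / rho)).+1; rewrite -ler_pdivrMr//.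
    apply: le_trans (ltW (truncnS_gt _)) _.
    by rewrite -natrX ler_nat ltnW// ltn_expl.
  by have := H n t rhot hn (lexx _); rewrite divff ?gt_eqF// powR1 mulr1.
elim=> [|n ih] b rb bn bt.
  have -> : b = rho by apply/le_anti; rewrite rb andbT; move: bn; rewrite expr0 mul1r.
  by rewrite subrr normr0 mulr_ge0 ?powR_ge0// mulr_ge0// mulr_ge0// ltW.
have b0 := lt_le_trans rho0 rb.
have AK : K <= A.
  by rewrite -KA lerDl mulr_ge0 ?powR_ge0.
have [b2|b2] := leP b (2 * rho).
  apply: le_trans (step rho0 rb b2 bt) _.
  by do 3 (rewrite ler_wpM2r ?powR_ge0 ?(ltW t0)//).
have hb : rho <= b / 2 by rewrite ler_pdivlMr// mulrC ltW.
have hb0 := lt_le_trans rho0 hb.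
have hbb : b / 2 <= b by rewrite ler_pdivrMr// ler_peMr ?ler1n// ltW.
have hbn : b / 2 <= 2 ^+ n * rho.
  by rewrite ler_pdivrMr// mulrAC -exprSr.
apply: le_trans (ler_distD (ball_average f x (b / 2)) _ _) _.
apply: le_trans (lerD (ih _ hb hbn (le_trans hbb bt)) (step hb0 hbb _ bt)) _.
  by rewrite mulrCA divff ?mulr1.
have -> : (b / 2 / t) `^ beta = 2 `^ (- beta) * (b / t) `^ beta.
  rewrite (_ : b / 2 / t = 2^-1 * (b / t)); last by ring.
  rewrite powRM ?divr_ge0 ?(ltW b0) ?(ltW t0)//; congr (_ * _).
  by rewrite -(powR_inv1 (ler0n _ 2)) -powRrM mulN1r.
rewrite -[in leRHS]KA le_eqVlt; apply/orP; left; apply/eqP; ring.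
Qed.

End telescope.

End poincare_step.

End balls.

(** * Averages of functions that vanish off a ball *)

Section capacity_lower_bound.
Context {R : realType} {d : measure_display} {X : metricMeasurableType R d}.
Variables (mu : {measure set X -> \bar R}) (p C lam Cd : R) (x0 : X) (R0 : \bar R).
Hypothesis cbm : complete_borel_measure mu.
Hypotheses (p1 : 1 < p) (C0 : 0 < C) (lam1 : 1 <= lam).
Hypothesis poinc : poincare_with mu p C lam.
Hypotheses (Cd1 : 1 <= Cd) (dbl : doubling_with mu Cd).
Hypothesis R0diam : (R0 <= (4^-1)%:E * diam X)%E.
Implicit Types (x y : X) (r : R).

Lemma mdist_lip x y z : `|mdist x y - mdist x z| <= mdist y z.
Proof.
rewrite ler_norml; apply/andP; split.
  by have := metric_triangle x y z; lra.
by have := metric_triangle x z y; rewrite (metric_sym z y); lra.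
Qed.

Lemma ball_subset_ball x y r s : mdist y x + r <= s -> ball x r `<=` ball y s.
Proof.
by move=> h z; rewrite !ballEmdist/= => xz; have := metric_triangle y x z; lra.
Qed.

Lemma integrable_zero_off_ball (f : X -> R) x r :
  measurable_fun [set: X] f -> (forall y, 0 <= f y <= 1) ->
  (forall y, ~ ball x r y -> f y = 0) -> mu.-integrable [set: X] (EFin \o f).
Proof.
move=> mf f01 f0; have mB := measurable_mball cbm x r.
have -> : EFin \o f = (EFin \o f) \_ (ball x r).
  apply/funext => y; rewrite patchE; case: ifPn => // /negP.
  by rewrite inE => /f0 /= ->.
apply/(integrable_mkcond _ mB).
apply: (@bounded_integrable_ball _ _ _ mu cbm f _ _ 1) => //.
by move=> y _; have /andP[h0 h1] := f01 y; rewrite ger0_norm.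
Qed.

(** The restriction on [R0] gives two points more than [4 * r] apart, and they cannot both lie
    within [2 * r] of [x0]. *)
Lemma exists_far_point r : 0 < r -> (r%:E < R0)%E -> exists y, 2 * r <= mdist x0 y.
Proof.
move=> r0 rR.
have : ((4 * r)%:E < diam X)%E.
  have := lt_le_trans rR R0diam.
  by rewrite muleC EFinM lte_pdivlMr// muleC.
move=> /ereal_sup_gt[_ [[x y] _ <-]]; rewrite lte_fin/= => xy.
have [h|h] := leP (2 * r) (mdist x0 x); first by exists x.
exists y; have := metric_triangle x x0 y; rewrite (metric_sym x x0); lra.
Qed.

(* If no point had distance in [2r, 3r) from x0, then the indicator of B_2r
   would have upper gradient 0, against the Poincare inequality. *)
Lemma exists_mid_point r : 0 < r -> (r%:E < R0)%E ->
  exists y, 2 * r <= mdist x0 y < 3 * r.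
Proof.
move=> r0 rR; apply: contrapT => H.
have gap y : mdist x0 y < 2 * r \/ 3 * r <= mdist x0 y.
  have [h|h] := ltP (mdist x0 y) (2 * r); first by left.
  right; rewrite leNgt; apply/negP => h'; apply: H; exists y; exact/andP.
have [z hz] := exists_far_point r0 rR.
have {}hz : 3 * r <= mdist x0 z by have := gap z; lra.
have mB := measurable_mball cbm.
pose f : X -> R := \1_(ball x0 (2 * r)).
have f1 y : mdist x0 y < 2 * r -> f y = 1.
  by move=> h; rewrite /f indicE mem_set// ballEmdist.
have f0 y : 3 * r <= mdist x0 y -> f y = 0.
  by move=> h; rewrite /f indicE memNset// ballEmdist/= => ?; lra.
have f01 y : 0 <= f y <= 1 by rewrite /f indicE; case: (_ \in _); rewrite ?lexx ?ler01.
have mf : measurable_fun [set: X] f by exact: measurable_indic.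
have r20 : 0 < 2 * r by rewrite mulr_gt0.
have fi : mu.-integrable [set: X] (EFin \o f).
  apply: (@integrable_zero_off_ball _ x0 (2 * r)) => // y.
  by move=> yB; rewrite /f indicE memNset.
have ug : upper_gradient (EFin \o f) (cst 0%E).
  split=> //; first exact: measurable_cst.
  move=> l gam lg; rewrite integral0.
  suff -> : (EFin \o f) (gam 0) = (EFin \o f) (gam l) by rewrite subee// abse0.
  rewrite /=; congr EFin; have [l0 _] := lg.
  pose D t := mdist x0 (gam (clamp l t)).
  have cD : continuous D.
    apply: (@lipschitz_real_continuous _ _ 1) => a b.
    exact: le_trans (mdist_lip _ _ _) (arclength_clamp_lipschitz lg a b).
  have D0 : D 0 = mdist x0 (gam 0) by rewrite /D clamp_id// lexx ltW.
  have Dl : D l = mdist x0 (gam l) by rewrite /D clamp_id// lexx ltW.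
  (* A curve from one side of the gap to the other would pass through the distance [5 / 2 * r] from
     [x0]. *)
  have ivt v : Num.min (D 0) (D l) <= v <= Num.max (D 0) (D l) -> 2 * r <= v < 3 * r -> False.
    move=> vD vr; have [c _ Dc] := IVT (ltW l0) (continuous_subspaceT cD) vD.
    by apply: H; exists (gam (clamp l c)); rewrite -[mdist _ _]/(D c) Dc.
  have [h0|h0] := gap (gam 0); have [hl|hl] := gap (gam l).
  - by rewrite !f1.
  - exfalso; apply: (ivt (5 / 2 * r)); last lra.
    by rewrite ge_min le_max D0 Dl; apply/andP; split; apply/orP; [left|right]; lra.
  - exfalso; apply: (ivt (5 / 2 * r)); last lra.
    by rewrite ge_min le_max D0 Dl; apply/andP; split; apply/orP; [right|left]; lra.
  - by rewrite !f0.
(* A radius for which the ball contains both [B_2r], where [f] is 1, and a ball around [z], where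
   [f] is 0. The Poincare inequality leaves no oscillation, so the average would have to be both 1
   and 0. *)
pose s := mdist x0 z + 3 * r.
have s0 : 0 < s by rewrite ltr_wpDl ?mdist_ge0// mulr_gt0.
have J0 : (\int[mu]_(y in ball x0 (lam * s)) (cst 0 y `^ p) <= 0%:E)%E.
  by rewrite integral0_eq// => y _; rewrite /cst poweR0r// gt_eqF// (lt_trans ltr01).
have := @poincare_ball _ _ _ mu cbm _ _ _ p1 C0 lam1 poinc f _ mf f01 fi ug x0 s 0 s0 J0.
rewrite mul0r powR0 ?mulr0; last by rewrite invr_eq0 gt_eqF// (lt_trans ltr01).
have ms := ball_mass_gt0 cbm x0 s0; set c := ball_average _ _ _ _.
rewrite mulrC ler_pdivrMr// mul0r => Ile.
have bound (E : set X) k : measurable E -> E `<=` ball x0 s ->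
    (forall y, E y -> k <= `|f y - c|) -> k * fine (mu E) <= 0.
  move=> mE sub hk; apply: le_trans Ile.
  apply: (@Rintegral_ge_cst _ _ _ mu (fun y => `|f y - c|)) => //.
  - exact: (@osc_integrable _ _ _ mu cbm f mf f01).
  - by rewrite (ball_massE cbm)// ltry.
have c1 : `|1 - c| <= 0.
  have := bound (ball x0 (2 * r)) `|1 - c| (mB _ _) _ _.
  rewrite -[fine _]/(ball_mass mu x0 (2 * r)) pmulr_lle0 ?ball_mass_gt0//; apply.
  - by apply: ball_subset_ball; rewrite mdistxx /s; have := mdist_ge0 x0 z; lra.
  - by move=> y; rewrite ballEmdist/= => /f1 ->.
have c2 : `|c| <= 0.
  have := bound (ball z r) `|c| (mB _ _) _ _.
  rewrite -[fine _]/(ball_mass mu z r) pmulr_lle0 ?ball_mass_gt0//; apply.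
  - by apply: ball_subset_ball; rewrite /s; lra.
  - move=> y; rewrite ballEmdist/= => zy; rewrite f0 ?sub0r ?normrN//.
    by have [|//] := gap y; have := metric_triangle x0 y z; rewrite (metric_sym y z); lra.
by move: c1 c2; rewrite !normr_le0 => /eqP h1 /eqP h2; clearbody c; lra.
Qed.

(** For [y] at distance between [2 * r] and [3 * r] from [x0], the ball [B(y, r)] lies in the
    annulus while [B(y, 8r)] contains [B_4r]; three doublings link the two. *)
Lemma annulus_mass r : 0 < r -> (r%:E < R0)%E ->
  ball_mass mu x0 (4 * r) <= Cd ^+ 3 * fine (mu (ball x0 (4 * r) `\` ball x0 r)).
Proof.
move=> r0 rR; have [y /andP[y2 y3]] := exists_mid_point r0 rR.
have mB := measurable_mball cbm.
have r80 : 0 < 4 * r by rewrite mulr_gt0.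
apply: (@le_trans _ _ (ball_mass mu y (2 * (2 * (2 * r))))).
  apply: sub_ball_mass => //; apply: ball_subset_ball; rewrite metric_sym; lra.
apply: le_trans (dbl y _) _; first by rewrite !mulr_gt0.
rewrite exprS -mulrA ler_wpM2l ?(le_trans ler01)//.
apply: le_trans (dbl y _) _; first by rewrite !mulr_gt0.
rewrite exprS -mulrA ler_wpM2l ?(le_trans ler01)//.
apply: le_trans (dbl y _) _ => //.
rewrite ler_wpM2l ?(le_trans ler01)//.
have mD : measurable (ball x0 (4 * r) `\` ball x0 r) by exact: measurableD.
apply: fine_le.
- by rewrite (ball_massE cbm).
- by rewrite ge0_fin_numE// (@mu_sub_ball_fin _ _ _ mu cbm _ x0 (4 * r))// => z [].
apply: le_measure; rewrite ?inE//.
move=> z; rewrite !ballEmdist/= => yz; split.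
  by have := metric_triangle x0 y z; lra.
by move=> xz; have := metric_triangle x0 z y; rewrite (metric_sym z y); lra.
Qed.

Section lower_bound.
Variables (f : X -> R) (g : X -> \bar R) (r J : R).
Hypotheses (mf : measurable_fun [set: X] f) (f01 : forall x, 0 <= f x <= 1).
Hypotheses (r0 : 0 < r) (rR : (r%:E < R0)%E).
Hypotheses (f0 : forall x, ~ ball x0 r x -> f x = 0) (ug : upper_gradient (EFin \o f) g).
Hypothesis gJ : (\int[mu]_y (g y `^ p) <= J%:E)%E.

Lemma integral_sub_ball x s : (\int[mu]_(y in ball x s) (g y `^ p) <= J%:E)%E.
Proof.
apply: le_trans gJ; apply: ge0_subset_integral => //; first exact: (measurable_mball cbm).
- apply: (measurableT_comp (measurable_poweR p)).
  by have [oB _ _] := cbm; have [_ bg _] := ug; exact: borel_measurable bg.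
- by move=> y _; exact: poweR_ge0.
Qed.

(** On the annulus [f] vanishes, so the oscillation [|f - c|] there equals the average [c] itself.
    This anchors the telescoping sum at its large end. *)
Lemma ball_average_4 :
  ball_average mu f x0 (4 * r) <= Cd ^+ 3 * C * (4 * r) * (J / ball_mass mu x0 (4 * r)) `^ p^-1.
Proof.
have mB := measurable_mball cbm; have fi := integrable_zero_off_ball mf f01 f0.
have r40 : 0 < 4 * r by rewrite mulr_gt0.
have := @poincare_ball _ _ _ mu cbm _ _ _ p1 C0 lam1 poinc f _ mf f01 fi ug x0 _ J r40 (integral_sub_ball _ _).
have m4 := ball_mass_gt0 cbm x0 r40; set c := ball_average _ _ _ _.
have /andP[c0 _] : 0 <= c <= 1 by exact: ball_average_itv.
have am := annulus_mass r0 rR; set F := _ `\` _ in am.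
have : c * fine (mu F) <= \int[mu]_(y in ball x0 (4 * r)) `|f y - c|.
  apply: (@Rintegral_ge_cst _ _ _ mu (fun y => `|f y - c|)) => //.
  - exact: measurableD.
  - by move=> z [].
  - exact: (@osc_integrable _ _ _ mu cbm f mf f01).
  - by rewrite (ball_massE cbm)// ltry.
  - by move=> y [_ /f0 ->]; rewrite sub0r normrN ger0_norm.
set I := \int[mu]_(_ in _) _ => cI PI.
have Cd30 : 0 < Cd ^+ 3 by rewrite exprn_gt0// (lt_le_trans ltr01).
set N := (_ / _) `^ _ in PI *.
rewrite (_ : Cd ^+ 3 * C * (4 * r) * N = Cd ^+ 3 * (C * (4 * r) * N)); last by ring.
apply: le_trans (ler_wpM2l (ltW Cd30) PI).
rewrite mulrCA ler_pdivlMl//.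
apply: le_trans (ler_wpM2l (ltW Cd30) cI).
by rewrite mulrC mulrCA ler_wpM2l.
Qed.

Variables (q Cq : R).
Hypotheses (qp : q < p) (Cq0 : 0 < Cq).
Hypothesis mass : forall b, 0 < b -> b <= r ->
  (b / r) `^ q * ball_mass mu x0 r <= Cq * ball_mass mu x0 b.

(** The first summand is the geometric series for radii up to [r]. The steps from [r] to [2r] and
    from [2r] to [4r] contribute [2 * Cd * C] and [4 * Cd * C], and the average over [B_4r]
    contributes [4 * Cd ^+ 3 * C]. *)
Definition capacity_constant := Cd * C * Cq `^ p^-1 / (1 - 2 `^ (- (1 - q / p))) +
  (6 * Cd + 4 * Cd ^+ 3) * C.

(** Radii above [r] are treated by doubling alone, since [2 * r] and [4 * r] may exceed [R0], where
    no mass bound is assumed. *)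
Lemma ball_average_le rho : 0 < rho -> rho <= r ->
  ball_average mu f x0 rho <= capacity_constant * r * (J / ball_mass mu x0 r) `^ p^-1.
Proof.
move=> rho0 rhor; have fi := integrable_zero_off_ball mf f01 f0.
have J0 : 0 <= J.
  by rewrite -lee_fin (le_trans _ gJ)// integral_ge0// => y _; exact: poweR_ge0.
have r20 : 0 < 2 * r by rewrite mulr_gt0.
have r40 : 0 < 4 * r by rewrite mulr_gt0.
have r2 : r <= 2 * r by lra.
have r4 : 2 * r <= 4 * r by lra.
have m0 := ball_mass_gt0 cbm x0 r0.
have mono b : r <= b -> (J / ball_mass mu x0 b) `^ p^-1 <= (J / ball_mass mu x0 r) `^ p^-1.
  move=> rb; have b0 := lt_le_trans r0 rb; have mb := ball_mass_gt0 cbm x0 b0.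
  apply: ge0_ler_powR; rewrite ?nnegrE ?invr_ge0 ?(le_trans ler01 (ltW p1))//.
  - by rewrite divr_ge0// ltW.
  - by rewrite divr_ge0// ltW.
  by rewrite ler_wpM2l// lef_pV2 ?posrE// (le_ball_mass cbm).
have H1 := @ball_average_telescope _ _ _ mu cbm p C lam p1 C0 lam1 poinc f g mf f01 fi ug
  Cd x0 q Cq r J Cd1 dbl qp Cq0 r0 mass (integral_sub_ball _ _) rho rho0 rhor.
have H2 := @ball_average_step _ _ _ mu cbm p C lam p1 C0 lam1 poinc f g mf f01 fi ug
  Cd x0 r (2 * r) J r0 r2 (dbl _ r0) (integral_sub_ball _ _).
have H3 := @ball_average_step _ _ _ mu cbm p C lam p1 C0 lam1 poinc f g mf f01 fi ug
  Cd x0 (2 * r) (4 * r) J r20 r4.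
have {}H3 := H3 ltac:(by rewrite (_ : 4 * r = 2 * (2 * r)); [exact: dbl|ring]) (integral_sub_ball _ _).
have H4 := ball_average_4.
have M2 := mono _ r2; have M4 := mono _ (le_trans r2 r4).
rewrite /capacity_constant; set N := (J / ball_mass mu x0 r) `^ _ in H1 H2 H3 H4 M2 M4 *.
set N2 := (J / ball_mass mu x0 (2 * r)) `^ _ in H2 M2.
set N4 := (J / ball_mass mu x0 (4 * r)) `^ _ in H3 H4 M4.
have Cd0 : 0 <= Cd by exact: le_trans ler01 Cd1.
have {}H2 : ball_average mu f x0 r - ball_average mu f x0 (2 * r) <= Cd * C * (2 * r) * N.
  apply: le_trans (ler_norm _) (le_trans H2 _).
  by rewrite ler_wpM2l// !mulr_ge0// ltW.
have {}H3 : ball_average mu f x0 (2 * r) - ball_average mu f x0 (4 * r) <= Cd * C * (4 * r) * N.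
  apply: le_trans (ler_norm _) (le_trans H3 _).
  by rewrite ler_wpM2l// !mulr_ge0// ltW.
have {}H4 : ball_average mu f x0 (4 * r) <= Cd ^+ 3 * C * (4 * r) * N.
  apply: (le_trans H4).
  by rewrite ler_wpM2l// !mulr_ge0// ?exprn_ge0// ltW.
have {}H1 := le_trans (ler_norm _) H1.
by lra.
Qed.

End lower_bound.
End capacity_lower_bound.

(** * Lower bounds for the capacity of annuli *)

Section truncation.
Context {R : realType} {d : measure_display} {X : metricMeasurableType R d}.

(** Competitors for the capacity take values in [\bar R]; truncation makes them real and bounded
    without changing the prescribed values 0 and 1 or losing the upper gradient. *)
Definition trunc01 (u : \bar R) : R := fine (maxe 0 (mine 1 u))%E.

Lemma trunc01E (u : \bar R) : (trunc01 u)%:E = maxe 0%E (mine 1%E u).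
Proof.
rewrite /trunc01 fineK// ge0_fin_numE; last by rewrite le_max lexx.
by apply: le_lt_trans (ltry 1); rewrite ge_max lee_fin ler01 ge_min lexx.
Qed.

Lemma trunc01_itv u : 0 <= trunc01 u <= 1.
Proof.
by rewrite -!lee_fin trunc01E le_max lexx ge_max lee_fin ler01 ge_min lexx.
Qed.

Lemma trunc01_1 : trunc01 1 = 1.
Proof. by rewrite /trunc01 minxx (max_idPr _). Qed.

Lemma trunc01_0 : trunc01 0 = 0.
Proof. by rewrite /trunc01 (min_idPr _)// maxxx. Qed.

Lemma trunc01_fin (a : R) : trunc01 a%:E = Num.max 0 (Num.min 1 a).
Proof. by rewrite /trunc01 -EFin_min -EFin_max. Qed.

Lemma trunc01_contract u v : ((`|trunc01 u - trunc01 v|)%:E <= `|u - v|)%E.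
Proof.
case: u v => [a| |] [b| |] /=; rewrite ?leey//.
rewrite lee_fin !trunc01_fin.
wlog ab : a b / a <= b => [h|].
  by have [/h//|/ltW/h] := leP a b; rewrite (distrC b) (distrC (Num.max 0 (Num.min 1 b))).
rewrite distrC (distrC a) !ger0_norm ?subr_ge0//; last first.
  by apply: le_max2 => //; apply: le_min2.
rewrite !maxEle !minEle.
by do ?case: ifPn; rewrite -?ltNge => *; lra.
Qed.

Lemma measurable_trunc01 (u : X -> \bar R) : measurable_fun [set: X] u ->
  measurable_fun [set: X] (trunc01 \o u).
Proof.
move=> mu'; apply/measurable_EFinP.
rewrite (_ : EFin \o _ = (fun x => maxe 0 (mine 1 (u x)))%E); last first.
  by apply/funext => x /=; rewrite trunc01E.
by apply: measurable_maxe => //; exact: measurable_mine.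
Qed.

Lemma upper_gradient_trunc01 (u g : X -> \bar R) : upper_gradient u g ->
  upper_gradient (EFin \o (trunc01 \o u)) g.
Proof.
move=> [g0 bg h]; split=> // l gam lg; apply: le_trans (h l gam lg).
exact: trunc01_contract.
Qed.

End truncation.

Section annulus_lower_bound.
Context {R : realType} {d : measure_display} {X : metricMeasurableType R d}.
Variables (mu : {measure set X -> \bar R}) (p C lam Cd : R) (x0 : X) (R0 : \bar R).
Hypothesis cbm : complete_borel_measure mu.
Hypotheses (p1 : 1 < p) (C0 : 0 < C) (lam1 : 1 <= lam).
Hypothesis poinc : poincare_with mu p C lam.
Hypotheses (Cd1 : 1 <= Cd) (dbl : doubling_with mu Cd).
Hypothesis R0diam : (R0 <= (4^-1)%:E * diam X)%E.

Let p0 : 0 < p. Proof. exact: lt_trans p1. Qed.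

Lemma integral_restrict_poweR (U : set X) (g : X -> \bar R) :
  (\int[mu]_y ((g \_ U) y `^ p) = \int[mu]_(y in U) (g y `^ p))%E.
Proof.
rewrite [RHS]integral_mkcond; apply: eq_integral => y _.
rewrite !patchE; case: ifPn => // _.
by rewrite poweR0r// gt_eqF.
Qed.

Lemma ge_capacity (E U : set X) (a K : R) : 0 < K ->
  (forall (f : X -> R) g, measurable_fun [set: X] f -> (forall x, 0 <= f x <= 1) ->
     (forall x, E x -> f x = 1) -> (forall x, ~ U x -> f x = 0) ->
     upper_gradient (EFin \o f) g ->
     (a%:E <= K%:E * \int[mu]_(x in U) (g x `^ p))%E) ->
  (a%:E <= K%:E * capacity mu p E U)%E.
Proof.
move=> K0 h; rewrite -lee_pdivrMl//; apply: le_ereal_inf_tmp => _ [u [g [[mu' _] u1 u0 ug ->]]].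
rewrite lee_pdivrMl//; apply: (h (trunc01 \o u)).
- exact: measurable_trunc01.
- by move=> x; exact: trunc01_itv.
- by move=> x /u1 /= ->; rewrite trunc01_1.
- by move=> x /u0 /= ->; rewrite trunc01_0.
- exact: upper_gradient_trunc01.
Qed.

Definition mass_bound_with (q Cq : R) := forall b r, 0 < b -> b <= r -> (r%:E < R0)%E ->
  (b / r) `^ q * ball_mass mu x0 r <= Cq * ball_mass mu x0 b.

Lemma mass_bound_withP q : lower_mass_bound mu x0 R0 q ->
  exists2 Cq, 0 < Cq & mass_bound_with q Cq.
Proof.
(* The maximum with 1 takes care of [b = r], which [lower_mass_bound] does not cover. *)
move=> [Cq Cq0 h]; exists (Num.max 1 Cq); first by rewrite lt_max ltr01.
move=> b r b0; have mb := ball_mass_gt0 cbm x0 b0.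
rewrite le_eqVlt => /predU1P[<- _|br rR].
  by rewrite divff ?gt_eqF// powR1 ler_wpM2r ?(ltW mb)// le_max lexx.
have r0 := lt_trans b0 br; have mr := ball_mass_gt0 cbm x0 r0.
have := h b r b0 br rR.
rewrite !(ball_massE cbm)// inver gt_eqF// -!EFinM lee_fin mulrA ler_pdivlMr//.
move=> /le_trans; apply; rewrite ler_wpM2r ?(ltW mb)//.
by rewrite le_max lexx orbT.
Qed.

Section fixed_radius.
Variables (q Cq r : R) (f : X -> R) (g : X -> \bar R).
Hypotheses (qp : q < p) (Cq0 : 0 < Cq) (mass : mass_bound_with q Cq).
Hypotheses (mf : measurable_fun [set: X] f) (f01 : forall x, 0 <= f x <= 1).
Hypotheses (r0 : 0 < r) (rR : (r%:E < R0)%E).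
Hypotheses (f0 : forall x, ~ ball x0 r x -> f x = 0) (ug : upper_gradient (EFin \o f) g).

Let A := capacity_constant p C Cd q Cq.

Lemma capacity_constant_gt0 : 0 < A.
Proof.
have Cd0 : 0 < Cd by exact: lt_le_trans ltr01 Cd1.
rewrite ltr_wpDl//; last first.
  by rewrite mulr_gt0// addr_gt0// mulr_gt0// exprn_gt0.
rewrite !mulr_ge0 ?powR_ge0 ?(ltW C0) ?(ltW Cd0)// invr_ge0 subr_ge0.
rewrite powRN invf_le1 ?powR_gt0// -[leLHS](powRr0 2).
by apply: ler_powR; rewrite ?ler1n// subr_ge0 ler_pdivrMr// mul1r ltW.
Qed.

(** The bound on the average is solved for the energy; [rho] may be arbitrarily small without effect
    on the constant. [v] is 1 for annuli and [3 / 8] for points. *)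
Lemma le_integral_of_ball_average rho v : 0 < rho -> rho <= r -> 0 < v ->
  v <= ball_average mu f x0 rho ->
  ((r `^ (- p) * ball_mass mu x0 r)%:E <=
   ((A / v) `^ p)%:E * \int[mu]_(y in ball x0 r) (g y `^ p))%E.
Proof.
move=> rho0 rhor v0 hv.
have A0 := capacity_constant_gt0; have m0 := ball_mass_gt0 cbm x0 r0.
have I0 : (0 <= \int[mu]_(y in ball x0 r) (g y `^ p))%E.
  by apply: integral_ge0 => y _; exact: poweR_ge0.
move: I0; rewrite -integral_restrict_poweR.
case EI: (\int[mu]_y _)%E => [J| |]//; last first.
  by rewrite gt0_muley ?leey// lte_fin powR_gt0 ?divr_gt0.
rewrite lee_fin => J0.
have ugr := upper_gradient_restrict (@open_mball _ _ _ x0 r) f0 ug.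
have gJ : (\int[mu]_y ((g \_ (ball x0 r)) y `^ p) <= J%:E)%E by rewrite EI.
have mass' b (b0 : 0 < b) (br : b <= r) := mass b0 br rR.
have := ball_average_le cbm p1 C0 lam1 poinc Cd1 dbl R0diam mf f01 r0 rR f0 ugr gJ qp Cq0 mass' rho0 rhor.
move=> /(le_trans hv); rewrite -/A => vA.
have {}vA : 1 <= (A / v * r) * (J / ball_mass mu x0 r) `^ p^-1.
  rewrite (_ : _ * _ = (A * r * (J / ball_mass mu x0 r) `^ p^-1) / v); last by ring.
  by rewrite ler_pdivlMr// mul1r.
have Av0 : 0 < A / v by rewrite divr_gt0.
have Jm : 0 <= J / ball_mass mu x0 r by rewrite divr_ge0// ltW.
have : 1 `^ p <= ((A / v * r) * (J / ball_mass mu x0 r) `^ p^-1) `^ p.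
  apply: ge0_ler_powR; rewrite ?nnegrE ?ler01 ?(ltW p0)//.
  exact: le_trans vA.
rewrite powR1 (powRM _ (ltW (mulr_gt0 Av0 r0)) (powR_ge0 _ _)).
rewrite (powRM _ (ltW Av0) (ltW r0)) -powRrM mulVf ?gt_eqF// powRr1// => H.
rewrite -EFinM lee_fin powRN ler_pdivrMl ?powR_gt0//.
rewrite -[leLHS]mul1r; move: H; rewrite mulrA ler_pdivlMr//.
by rewrite mul1r => /le_trans; apply; rewrite mulrA (mulrC (r `^ p)).
Qed.

End fixed_radius.

Lemma annulus_bound_of_mass_bound q : q < p -> lower_mass_bound mu x0 R0 q ->
  annulus_capacity_bound mu p x0 R0.
Proof.
move=> qp /mass_bound_withP[Cq Cq0 mass].
have A0 : 0 < capacity_constant p C Cd q Cq by exact: capacity_constant_gt0.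
exists ((capacity_constant p C Cd q Cq / 1) `^ p).
  by rewrite powR_gt0// divr_gt0.
move=> rho r rho0 rhor rR; have r0 := lt_trans rho0 rhor.
rewrite (ball_massE cbm)// -EFinM; apply: ge_capacity.
  by rewrite powR_gt0// divr_gt0.
move=> f g mf f01 f1 f0 ug.
apply: (le_integral_of_ball_average qp Cq0 mass mf f01 r0 rR f0 ug rho0 (ltW rhor) ltr01).
have mr := ball_mass_gt0 cbm x0 rho0.
rewrite /ball_average (@eq_Rintegral _ _ _ _ _ (cst 1)); last first.
  by move=> y; rewrite inE => /f1.
rewrite Rintegral_cst; last exact: (measurable_mball cbm).
by rewrite mul1r mulVf ?gt_eqF.
Qed.

End annulus_lower_bound.

(** * Upper bounds for the capacity of annuli *)

Section ramps.
Context {R : realType} {d : measure_display} {X : metricMeasurableType R d}.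
Variable x0 : X.

Lemma upper_gradient_lipschitz (f : X -> R) (L : R) : 0 <= L ->
  (forall x y, `|f x - f y| <= L * mdist x y) ->
  upper_gradient (EFin \o f) (cst L%:E).
Proof.
move=> L0 fL; split=> //; first exact: measurable_cst.
move=> l gam lg; have [l0 _] := lg.
rewrite integral_cst//= lebesgue_measure_itv/= lte_fin l0 -EFinB subr0.
rewrite -EFinM lee_fin; apply: le_trans (fL _ _) _.
rewrite ler_wpM2l// -[leRHS]subr0.
by apply: (arclength_lipschitz lg) => //; exact: ltW.
Qed.

Lemma upper_gradientD (f1 f2 : X -> R) (g1 g2 : X -> \bar R) :
  upper_gradient (EFin \o f1) g1 -> upper_gradient (EFin \o f2) g2 ->
  upper_gradient (EFin \o (f1 \+ f2)) (g1 \+ g2)%E.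
Proof.
move=> [g10 b1 h1] [g20 b2 h2]; split.
- by move=> x; exact: adde_ge0.
- exact: emeasurable_funD.
- move=> l gam lg; have [l0 _] := lg.
  have cg := arclength_clamp_continuous lg.
  have E g : (\int[lebesgue_measure]_(t in `[0%R, l]) g (gam t) =
      \int[lebesgue_measure]_(t in `[0%R, l]) (g \o (gam \o clamp l)) t)%E.
    by apply: eq_integral => t; rewrite inE/= in_itv/= => tl; rewrite clamp_id.
  rewrite (E (g1 \+ g2)%E) /= ge0_integralD//=; last 2 first.
  - exact: measurable_funS (continuous_borel_comp cg b1).
  - exact: measurable_funS (continuous_borel_comp cg b2).
  rewrite -[X in (_ <= X + _)%E](E g1) -[X in (_ <= _ + X)%E](E g2).
  apply: le_trans (leeD (h1 l gam lg) (h2 l gam lg)).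
  by rewrite /= lee_fin opprD addrACA ler_normD.
Qed.

Lemma upper_gradient0 : upper_gradient (EFin \o (cst 0 : X -> R)) (cst 0%E).
Proof.
split=> //; first exact: measurable_cst.
by move=> l gam lg; rewrite /= subrr normr0 integral_ge0.
Qed.

Lemma upper_gradient_sum (f : nat -> X -> R) (g : nat -> X -> \bar R) n :
  (forall k, upper_gradient (EFin \o f k) (g k)) ->
  upper_gradient (EFin \o (fun x => \sum_(k < n) f k x))
    (fun x => \sum_(k < n) g k x)%E.
Proof.
move=> h; elim: n => [|n ih].
  rewrite (_ : (fun x => \sum_(k < 0) f k x) = cst 0); last by apply/funext => x; rewrite big_ord0.
  rewrite (_ : (fun x => \sum_(k < 0) g k x)%E = cst 0%E); last by apply/funext => x; rewrite big_ord0.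
  exact: upper_gradient0.
rewrite (_ : (fun x => \sum_(k < n.+1) f k x) = (fun x => \sum_(k < n) f k x) \+ f n); last first.
  by apply/funext => x; rewrite big_ord_recr.
rewrite (_ : (fun x => \sum_(k < n.+1) g k x)%E = ((fun x => \sum_(k < n) g k x) \+ g n)%E); last first.
  by apply/funext => x; rewrite big_ord_recr.
exact: upper_gradientD.
Qed.

Definition ramp (a s : R) (x : X) : R :=
  a * Num.max 0 (Num.min 1 ((2 * s - mdist x0 x) / s)).

Definition shell (s : R) : set X := [set x | s < mdist x0 x < 2 * s].

Lemma ramp_itv a s x : 0 <= a -> 0 <= ramp a s x <= a.
Proof.
move=> a0; rewrite mulr_ge0 ?le_max ?lexx//= ler_piMr//.
by rewrite ge_max ler01 ge_min lexx.
Qed.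

Lemma ramp_in a s x : 0 < s -> mdist x0 x <= s -> ramp a s x = a.
Proof.
move=> s0 xs; rewrite /ramp (min_idPl _) ?(max_idPr _) ?mulr1//.
by rewrite ler_pdivlMr//; lra.
Qed.

Lemma ramp_out a s x : 0 < s -> 2 * s <= mdist x0 x -> ramp a s x = 0.
Proof.
move=> s0 xs; rewrite /ramp (max_idPl _) ?mulr0//.
by rewrite ge_min; apply/orP; right; rewrite ler_pdivrMr// mul0r; lra.
Qed.

Lemma ramp_lipschitz a s x y : 0 <= a -> 0 < s ->
  `|ramp a s x - ramp a s y| <= a / s * mdist x y.
Proof.
move=> a0 s0; rewrite -mulrBr normrM (ger0_norm a0) -mulrA ler_wpM2l//.
pose u z := (2 * s - mdist x0 z) / s.
have c01 b c : `|Num.max 0 (Num.min 1 b) - Num.max 0 (Num.min 1 c)| <= `|b - c| :> R.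
  by rewrite -lee_fin -!trunc01_fin; exact: trunc01_contract.
apply: le_trans (c01 _ _) _.
rewrite -mulrBl normrM (gtr0_norm (_ : 0 < s^-1)) ?invr_gt0// mulrC.
rewrite ler_wpM2l ?invr_ge0 ?(ltW s0)//.
have -> : 2 * s - mdist x0 x - (2 * s - mdist x0 y) = mdist x0 y - mdist x0 x by ring.
by rewrite (metric_sym x y); exact: mdist_lip.
Qed.

Lemma open_far s : open [set x | s < mdist x0 x].
Proof.
rewrite openE => y /= xy; apply/nbhs_ballP; exists (mdist x0 y - s).
  by rewrite /= subr_gt0.
move=> z; rewrite ballEmdist/= => yz.
by have := metric_triangle x0 z y; rewrite (metric_sym z y); lra.
Qed.

Lemma shellE s : shell s = ball x0 (2 * s) `&` [set x | s < mdist x0 x].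
Proof.
by apply/seteqP; split=> x; rewrite ballEmdist /shell/= => H; [split|]; lra.
Qed.

Lemma open_shell s : open (shell s).
Proof. by rewrite shellE; apply: openI; [exact: open_mball|exact: open_far]. Qed.

(** The slope is cut off twice: to [B_2s], outside which the ramp is 0, and to the exterior of the
    closed ball of radius [s], inside which it is [a]. Both sets are open, as the cutoff requires,
    and the resulting dyadic shells are disjoint. *)
Lemma ramp_upper_gradient a s : 0 <= a -> 0 < s ->
  upper_gradient (EFin \o ramp a s) (cst (a / s)%:E \_ (shell s)).
Proof.
move=> a0 s0.
have H1 := upper_gradient_lipschitz (divr_ge0 a0 (ltW s0)) (fun x y => ramp_lipschitz x y a0 s0).
have H2 : upper_gradient (EFin \o ramp a s) (cst (a / s)%:E \_ (ball x0 (2 * s))).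
  apply: (upper_gradient_restrict (c := 0)) H1; first exact: open_mball.
  by move=> x; rewrite ballEmdist/= => /negP; rewrite -leNgt => /ramp_out; exact.
rewrite shellE; have := upper_gradient_restrict (c := a) (open_far s) _ H2.
rewrite -patch_setI setIC; apply => x /= /negP; rewrite -leNgt => /ramp_in; exact.
Qed.

End ramps.

Section annulus_upper_bound.
Context {R : realType} {d : measure_display} {X : metricMeasurableType R d}.
Variables (mu : {measure set X -> \bar R}) (p Cd : R) (x0 : X) (R0 : \bar R).
Hypothesis cbm : complete_borel_measure mu.
Hypothesis p1 : 1 < p.
Hypotheses (Cd1 : 1 <= Cd) (dbl : doubling_with mu Cd).

Let p0 : 0 < p. Proof. exact: lt_trans p1. Qed.

Section log_test_function.
Variables (n : nat) (r : R).
Hypotheses (n0 : (0 < n)%N) (r0 : 0 < r).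

Let rad (k : nat) : R := r / 2 ^+ k.
Let a : R := n%:R^-1.

Let test (x : X) : R := \sum_(k < n) ramp x0 a (rad k.+1) x.
Let grad (x : X) : \bar R := (\sum_(k < n) (cst (a / rad k.+1)%:E \_ (shell x0 (rad k.+1))) x)%E.

Let rad0 k : 0 < rad k. Proof. by rewrite divr_gt0// exprn_gt0. Qed.
Let radS k : 2 * rad k.+1 = rad k.
Proof. by rewrite /rad exprS; field; rewrite expf_neq0. Qed.
Let rad_le j k : (j <= k)%N -> rad k <= rad j.
Proof.
move=> jk; rewrite /rad ler_wpM2l ?(ltW r0)// lef_pV2 ?posrE ?exprn_gt0//.
by rewrite ler_eXn2l// ltr1n.
Qed.
Let a0 : 0 <= a. Proof. by rewrite invr_ge0. Qed.
Let na : n%:R * a = 1. Proof. by rewrite divff// pnatr_eq0 -lt0n. Qed.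

Let test_itv x : 0 <= test x <= 1.
Proof.
rewrite sumr_ge0/=; last by move=> k _; have /andP[] := ramp_itv x0 (rad k.+1) x a0.
apply: (@le_trans _ _ (\sum_(k < n) a)).
  by apply: ler_sum => k _; have /andP[] := ramp_itv x0 (rad k.+1) x a0.
by rewrite sumr_const card_ord -mulr_natl na.
Qed.

Let test_in x : ball x0 (rad n) x -> test x = 1.
Proof.
rewrite ballEmdist/= => xn; rewrite /test (eq_bigr (fun=> a)); last first.
  by move=> k _; apply: ramp_in => //; rewrite (le_trans (ltW xn))// rad_le.
by rewrite sumr_const card_ord -mulr_natl na.
Qed.

Let test_out x : ~ ball x0 r x -> test x = 0.
Proof.
rewrite ballEmdist/= => /negP; rewrite -leNgt => xr; apply: big1 => k _.
apply: ramp_out => //; rewrite radS (le_trans _ xr)//.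
by apply: le_trans (rad_le (leq0n k)) _; rewrite /rad expr0 divr1.
Qed.

Let test_measurable : measurable_fun [set: X] test.
Proof.
apply: measurable_sum => k; apply/measurable_EFinP.
have [oB _ _] := cbm; apply: borel_measurable => //; apply: continuous_borel.
apply: lipschitz_continuous => x y; exact: ramp_lipschitz.
Qed.

Let ug : upper_gradient (EFin \o test) grad.
Proof.
exact: (@upper_gradient_sum _ _ _ (fun k => ramp x0 a (rad k.+1))
  (fun k => cst (a / rad k.+1)%:E \_ (shell x0 (rad k.+1)))) (fun k => ramp_upper_gradient x0 a0 (rad0 _)).
Qed.

(* The shells are pairwise disjoint, so at most one term of the sum is nonzero. *)
Let gradp x : (grad x `^ p = \sum_(k < n) (cst ((a / rad k.+1) `^ p)%:E \_ (shell x0 (rad k.+1))) x)%E.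
Proof.
have [[k xk]|h] := pselect (exists k : 'I_n, shell x0 (rad k.+1) x).
  have other (j : 'I_n) : j != k -> ~ shell x0 (rad j.+1) x.
    move: xk; rewrite /shell/= !radS => xk; rewrite -val_eqE neq_ltn /= => /orP[jk|kj] xj.
      by have := rad_le jk; lra.
    by have := rad_le kj; lra.
  rewrite /grad (bigD1 k)//= big1 ?adde0; last first.
    by move=> j /other jk; rewrite patchC// inE.
  rewrite [RHS](bigD1 k)//= big1 ?adde0; last first.
    by move=> j /other jk; rewrite patchC// inE.
  by rewrite !patchT ?inE// /cst poweR_EFin.
have hn (k : 'I_n) : x \notin shell x0 (rad k.+1).
  by apply/negP; rewrite inE => xk; apply: h; exists k.
rewrite /grad !big1 ?poweR0r ?gt_eqF// => k _; rewrite patchE (negbTE (hn k))//.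
Qed.

Let integral_gradp (U : set X) : measurable U ->
  (\int[mu]_(x in U) (grad x `^ p) <=
   (\sum_(k < n) (a / rad k.+1) `^ p * ball_mass mu x0 (rad k))%:E)%E.
Proof.
have [oB _ _] := cbm; move=> mU.
have mS k : measurable (shell x0 (rad k)) by apply: oB; exact: open_shell.
under eq_integral do rewrite gradp.
rewrite ge0_integral_sum//; last 2 first.
- move=> k; apply: (measurable_funS measurableT) => //.
  by apply/(measurable_restrictT _ (mS _)).1; exact: measurable_cst.
- by move=> k x _; apply: erestrict_ge0 => y _; rewrite lee_fin powR_ge0.
rewrite -sumEFin; apply: lee_sum => k _.
rewrite -integral_mkcondr integral_cst//; last exact: measurableI.
rewrite EFinM; apply: lee_wpmul2l; first by rewrite lee_fin powR_ge0.
rewrite -(ball_massE cbm)//; apply: le_measure; rewrite ?inE//.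
- exact: measurableI.
- exact: (measurable_mball cbm).
- by move=> x [_]; rewrite /shell/= radS ballEmdist/= => /andP[].
Qed.

Lemma capacity_le_log :
  (capacity mu p (ball x0 (r / 2 ^+ n)) (ball x0 r) <=
   (\sum_(k < n) (n%:R^-1 / (r / 2 ^+ k.+1)) `^ p * ball_mass mu x0 (r / 2 ^+ k))%:E)%E.
Proof.
have [oB _ _] := cbm.
apply: le_trans (integral_gradp (measurable_mball cbm x0 r)).
apply: ereal_inf_lbound; exists (EFin \o test), grad; split => //.
(* Membership in the Newtonian space: the test function is at most 1 and vanishes off [B_r], which
   has finite mass, and its energy is bounded by the same finite sum. *)
- split; first by apply/measurable_EFinP.
  apply: lte_add_pinfty.
    apply: (@le_lt_trans _ _ (\int[mu]_x ((cst 1%E \_ (ball x0 r)) x)))%E.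
      apply: ge0_le_integral => //.
      - by move=> x _; exact: poweR_ge0.
      - apply: (measurableT_comp (measurable_poweR p)) => //.
        apply: measurableT_comp => //; exact/measurable_EFinP.
      - apply/(measurable_restrictT _ (measurable_mball cbm _ _)).1; exact: measurable_cst.
      - move=> x _; rewrite patchE; case: ifPn => [_|].
          have /andP[t0 t1] := test_itv x.
          rewrite /= ger0_norm// lee_fin; apply: (@le_trans _ _ (1 `^ p)); last by rewrite powR1.
          by apply: ge0_ler_powR; rewrite ?nnegrE// ltW.
        move=> /negP; rewrite inE => /test_out /= ->.
        by rewrite normr0 powR0// gt_eqF.
    rewrite -integral_mkcond integral_cst ?mul1e//; last exact: (measurable_mball cbm).
    by rewrite (ball_massE cbm)// ltry.
  apply: le_lt_trans (ltry (\sum_(k < n) (a / rad k.+1) `^ p * ball_mass mu x0 (rad k))).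
  apply: le_trans (integral_gradp measurableT).
  by apply: ereal_inf_lbound; exists grad.
- by move=> x /test_in /= ->.
- by move=> x /test_out /= ->.
Qed.

End log_test_function.

Lemma iter_doubling n r : 0 < r -> ball_mass mu x0 (2 ^+ n * r) <= Cd ^+ n * ball_mass mu x0 r.
Proof.
move=> r0; elim: n => [|n ih]; first by rewrite !expr0 !mul1r.
rewrite exprS -mulrA; apply: le_trans (dbl _ _) _; first by rewrite mulr_gt0// exprn_gt0.
by rewrite exprS -mulrA ler_wpM2l// (le_trans ler01).
Qed.

Lemma mass_bound_of_annulus_bound : annulus_capacity_bound mu p x0 R0 ->
  exists q, [/\ 0 < q, q < p & lower_mass_bound mu x0 R0 q].
Proof.
move=> [C1 C10 h].
(* The factor 2^p arises because each ramp has its slope measured at the inner radius of the shell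
   and its mass at the outer one; the factor 2 is the one in [key]. Since [p > 1], the [n] terms of
   size [n^-p] have total [n^(1 - p) < 1 / B] for large [n]. *)
pose B := C1 * (2 `^ p * 2).
have B0 : 0 < B by rewrite !mulr_gt0// powR_gt0.
have pm : 0 < p - 1 by rewrite subr_gt0.
pose n := (Num.truncn (B `^ (p - 1)^-1)).+1.
have n0 : 0 < n%:R :> R by rewrite ltr0n.
have n1 : 1 <= n%:R :> R by rewrite ler1n.
have Bn : B < n%:R `^ (p - 1).
  rewrite [ltLHS](_ : B = (B `^ (p - 1)^-1) `^ (p - 1)); last first.
    by rewrite -powRrM mulVf ?lt0r_neq0// powRr1// ltW.
  by apply: gt0_ltr_powR => //; rewrite ?nnegrE ?powR_ge0 ?(ltW n0)//; exact: truncnS_gt.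
(* If no [k] worked, all [n] terms of the energy would be at most [T], and the annulus bound would
   give [n^(p - 1) <= B]. The terms have indices 0 to [n - 1], and for index 0 the bound is
   trivial. *)
have key r : 0 < r -> (r%:E < R0)%E -> exists k, [/\ (0 < k)%N, (k <= n)%N &
    2 * ball_mass mu x0 r <= (2 ^+ k) `^ p * ball_mass mu x0 (r / 2 ^+ k)].
  move=> r0 rR; apply: contrapT => H; have m0 := ball_mass_gt0 cbm x0 r0.
  have small k : (k < n)%N -> (2 ^+ k) `^ p * ball_mass mu x0 (r / 2 ^+ k) <= 2 * ball_mass mu x0 r.
    case: k => [_|k kn]; first by rewrite expr0 powR1 divr1 mul1r ler_peMl ?ler1n// ltW.
    by rewrite leNgt; apply/negP => /ltW hk; apply: H; exists k.+1; split=> //; exact: ltnW.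
  have rn : r / 2 ^+ n < r.
    by rewrite ltr_pdivrMr ?exprn_gt0// ltr_pMr// exprn_egt1// ltr1n.
  have := h _ _ (divr_gt0 r0 (exprn_gt0 n (ltr0n R 2))) rn rR.
  have C1e : (0 <= C1%:E)%E by rewrite lee_fin ltW.
  move=> /le_trans/(_ (lee_wpmul2l C1e (capacity_le_log (ltn0Sn _) r0))).
  rewrite (ball_massE cbm)// -!EFinM lee_fin.
  have rp0 : 0 < r `^ p by exact: powR_gt0.
  have term k : (k < n)%N -> (n%:R^-1 / (r / 2 ^+ k.+1)) `^ p * ball_mass mu x0 (r / 2 ^+ k) <=
      (n%:R `^ p)^-1 * (r `^ p)^-1 * 2 `^ p * (2 * ball_mass mu x0 r).
    move=> /small hk.
    have -> : n%:R^-1 / (r / 2 ^+ k.+1) = n%:R^-1 * (r^-1 * (2 * 2 ^+ k)).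
      by rewrite exprS; field; rewrite ?gt_eqF ?expf_neq0.
    have p2k : 0 <= 2 ^+ k :> R by rewrite exprn_ge0.
    rewrite powRM ?invr_ge0 ?(ltW n0) ?mulr_ge0 ?invr_ge0 ?(ltW r0)//.
    rewrite powRM ?invr_ge0 ?mulr_ge0 ?(ltW r0)// powRM//.
    have inv b : 0 <= b -> b^-1 `^ p = (b `^ p)^-1 :> R.
      by move=> b0; rewrite -(powR_inv1 b0) -powRrM mulN1r powRN.
    rewrite !inv ?(ltW n0) ?(ltW r0)//.
    rewrite -!mulrA !ler_wpM2l ?invr_ge0 ?powR_ge0//.
  set T := (_^-1 * _ * _ * _) in term.
  have S : \sum_(k < n) (n%:R^-1 / (r / 2 ^+ k.+1)) `^ p * ball_mass mu x0 (r / 2 ^+ k) <= n%:R * T.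
    apply: (@le_trans _ _ (\sum_(k < n) T)).
      by apply: ler_sum => k _; exact: (term k (ltn_ord k)).
    by rewrite sumr_const card_ord -[leLHS]mulr_natl.
  move=> /le_trans/(_ (ler_wpM2l (ltW C10) S)).
  rewrite powRN /T.
  have -> : C1 * (n%:R * ((n%:R `^ p)^-1 * (r `^ p)^-1 * 2 `^ p * (2 * ball_mass mu x0 r))) =
    (r `^ p)^-1 * (n%:R / n%:R `^ p * B) * ball_mass mu x0 r by rewrite /B; ring.
  rewrite ler_pM2r// -[leLHS]mulr1 ler_pM2l ?invr_gt0//.
  have -> : n%:R / n%:R `^ p = (n%:R `^ (p - 1))^-1.
    rewrite powRB; last by apply/implyP => _; rewrite gt_eqF.
    by rewrite powRr1 ?(ltW n0)// invf_div.
  by rewrite mulrC ler_pdivlMr ?powR_gt0// mul1r leNgt Bn.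
pose q := p - n%:R^-1.
have q0 : 0 < q by rewrite subr_gt0 (le_lt_trans _ p1)// invf_le1.
have qp : q < p by rewrite gtrBl invr_gt0.
(* As [k <= n], the factor 2 in [key] is at least [(2^k)^(1/n)], which lowers the exponent from [p]
   to [q]. *)
have key2 r : 0 < r -> (r%:E < R0)%E -> exists k, [/\ (0 < k)%N, (k <= n)%N &
    (2 ^+ k)^-1 `^ q * ball_mass mu x0 r <= ball_mass mu x0 (r / 2 ^+ k)].
  move=> r0 rR; have [k [k0 kn hk]] := key r r0 rR; exists k; split=> //.
  have m0 := ball_mass_gt0 cbm x0 r0.
  have k2 : 0 < 2 ^+ k :> R by rewrite exprn_gt0.
  have -> : (2 ^+ k)^-1 `^ q = (2 ^+ k) `^ n%:R^-1 / (2 ^+ k) `^ p :> R.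
    rewrite -(powR_inv1 (ltW k2)) -powRrM mulN1r /q opprB powRB//.
    by apply/implyP => _; rewrite gt_eqF.
  rewrite mulrAC ler_pdivrMr ?powR_gt0// mulrC (mulrC (ball_mass _ _ (_ / _))).
  apply: le_trans hk; rewrite mulrC ler_wpM2r ?(ltW m0)//.
  rewrite -powR_mulrn// -powRrM -[leRHS](powRr1 (ler0n R 2)).
  by apply: ler_powR; rewrite ?ler1n// ler_pdivrMr// mul1r ler_nat.
have K1 : 1 <= Cd ^+ n by rewrite exprn_ege1.
(* Induction on the number of dyadic scales between [rho] and [r]. Either [key2] moves down to
   [r / 2^k], or [rho] is within a factor [2^n] of [r] and at most [n] doublings finish. *)
have claim : forall N r rho, 0 < rho -> rho <= r -> (r%:E < R0)%E -> r <= 2 ^+ N * rho ->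
    (rho / r) `^ q * ball_mass mu x0 r <= Cd ^+ n * ball_mass mu x0 rho.
  elim=> [|N ih] r rho rho0 rhor rR rN.
    have -> : r = rho by apply/le_anti; rewrite rhor andbT; move: rN; rewrite expr0 mul1r.
    rewrite divff ?gt_eqF// powR1 ler_wpM2r//; exact: (ltW (ball_mass_gt0 cbm x0 rho0)).
  have r0 := lt_le_trans rho0 rhor; have m0 := ball_mass_gt0 cbm x0 r0.
  have [k [k0 kn hk]] := key2 r r0 rR.
  have k2 : 0 < 2 ^+ k :> R by rewrite exprn_gt0.
  have [hr|hr] := leP rho (r / 2 ^+ k).
    have r'r : r / 2 ^+ k <= r.
      by rewrite ler_pdivrMr// ler_peMr ?(ltW r0)// exprn_ege1// ler1n.
    have r'N : r / 2 ^+ k <= 2 ^+ N * rho.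
      rewrite ler_pdivrMr// mulrAC (le_trans rN)// ler_wpM2r ?(ltW rho0)//.
      by rewrite -exprD ler_weXn2l ?ler1n// -addn1 leq_add2l.
    have := ih _ _ rho0 hr (le_lt_trans _ rR) r'N; rewrite lee_fin => /(_ r'r).
    apply: le_trans.
    have -> : rho / r = (rho / (r / 2 ^+ k)) * (2 ^+ k)^-1.
      by field; rewrite !gt_eqF.
    rewrite powRM ?invr_ge0 ?(ltW k2)// ?divr_ge0 ?(ltW rho0) ?(ltW r0) ?(ltW k2)//.
    by rewrite -mulrA ler_wpM2l ?powR_ge0.
  have : rho / r <= 1 by rewrite ler_pdivrMr// mul1r.
  move=> rr1; apply: (@le_trans _ _ (1 * ball_mass mu x0 r)).
    rewrite ler_wpM2r ?(ltW m0)//; apply: (@le_trans _ _ (1 `^ q)); last by rewrite powR1.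
    by apply: ge0_ler_powR => //; rewrite ?nnegrE ?(ltW q0)// divr_ge0// ltW.
  rewrite mul1r; apply: le_trans (iter_doubling n rho0).
  apply: le_ball_mass => //; apply: (@le_trans _ _ (2 ^+ k * rho)).
    by rewrite mulrC -ler_pdivrMr// ltW.
  by rewrite ler_wpM2r ?(ltW rho0)// ler_weXn2l// ler1n.
exists q; split=> //; exists (Cd ^+ n); first by rewrite (lt_le_trans ltr01).
move=> rho r rho0 rhor rR; have r0 := lt_trans rho0 rhor.
have m0 := ball_mass_gt0 cbm x0 r0.
rewrite !(ball_massE cbm)// inver gt_eqF// -!EFinM lee_fin mulrA ler_pdivlMr//.
apply: (claim (Num.truncn (r / rho)).+1) => //; first exact: ltW.
rewrite -ler_pdivrMr//; apply: le_trans (ltW (truncnS_gt _)) _.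
by rewrite -natrX ler_nat ltnW// ltn_expl.
Qed.

End annulus_upper_bound.

(** * Outer regularity and Lipschitz majorants *)

Section regularity.
Context {R : realType} {d : measure_display} {X : metricMeasurableType R d}.
Variables (mu : {measure set X -> \bar R}) (W : set X).
Hypothesis open_meas : forall A : set X, open A -> measurable A.
Hypotheses (mW : measurable W) (Wfin : (mu W < +oo)%E).

Lemma closed_meas (F : set X) : closed F -> measurable F.
Proof. by move=> cF; rewrite -(setCK F); apply: measurableC; apply: open_meas; exact: closed_openC. Qed.

(** Approximation is demanded from both sides so that the property passes to complements; with
    countable unions this yields all Borel sets. Errors are measured within [W], which has finite
    mass, whereas [mu] itself need not be finite. *)
Definition squeezed (A : set X) : Prop := forall e : R, 0 < e ->
  exists F U : set X, [/\ closed F, open U, F `<=` A, A `<=` U &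
    (mu ((U `\` F) `&` W) <= e%:E)%E].

Lemma decreasing_measure_small (D : nat -> set X) (e : R) : 0 < e ->
  (forall n, measurable (D n)) -> (forall n m, (n <= m)%N -> D m `<=` D n) ->
  (forall x, ~ (forall n, D n x)) ->
  exists n, (mu (D n `&` W) <= e%:E)%E.
Proof.
move=> e0 mD dD D0.
have mDW n : measurable (D n `&` W) by exact: measurableI.
have cap0 : \bigcap_n (D n `&` W) = set0.
  apply/seteqP; split=> // x h; apply: (D0 x) => n.
  by have [] := h n I.
have /= := @nonincreasing_cvg_mu _ _ _ mu (fun n => D n `&` W) _ mDW _ _.
rewrite cap0 measure0.
have h0 : (mu (D 0%N `&` W) < +oo)%E.
  by apply: le_lt_trans Wfin; apply: le_measure; rewrite ?inE.
move=> /(_ h0 measurable0).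
have nd : nonincreasing_seq (fun n => D n `&` W).
  by move=> n m nm; apply/subsetPset; exact: setSI (dD _ _ nm).
move=> /(_ nd) /fine_cvgP[_ /cvgrPdist_le /(_ _ e0)].
have fin n : mu (D n `&` W) \is a fin_num.
  rewrite ge0_fin_numE//; apply: le_lt_trans Wfin; apply: le_measure; rewrite ?inE//.
move=> [n _ /(_ n (leqnn _))] /=; rewrite sub0r normrN => h; exists n.
by rewrite -(fineK (fin n)) lee_fin (le_trans (ler_norm _)).
Qed.

Lemma squeezed_open (A : set X) : open A -> squeezed A.
Proof.
move=> oA e e0.
(* Open neighbourhoods of the complement that shrink to it: their complements are closed subsets
   exhausting [A]. *)
pose U n : set X := [set x | exists y, ~ A y /\ mdist x y < n.+1%:R^-1].
have oU n : open (U n).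
  rewrite openE => x [y [Ay xy]]; apply/nbhs_ballP; exists (n.+1%:R^-1 - mdist x y).
    by rewrite /= subr_gt0.
  move=> z; rewrite ballEmdist/= ltrBrDr => xz; exists y; split=> //.
  by apply: le_lt_trans xz; rewrite (metric_sym x z) metric_triangle.
have dU n m : (n <= m)%N -> U m `<=` U n.
  move=> nm x [y [Ay xy]]; exists y; split=> //; apply: lt_le_trans xy _.
  by rewrite lef_pV2 ?posrE// ler_nat.
have [|n m nm|x h|n hn] := @decreasing_measure_small (fun n => A `&` U n) e e0.
- by move=> n; apply: open_meas; exact: openI.
- by apply: setIS; exact: dU.
- have [Ax _] := h 0%N; move: oA; rewrite openE => /(_ x Ax) /nbhs_ballP[r /= r0 hr].
  have [_ [y [Ay xy]]] := h (Num.truncn r^-1).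
  apply: Ay; apply: hr; rewrite ballEmdist/= (lt_trans xy)//.
  by rewrite invf_plt ?posrE// truncnS_gt.
exists (~` U n), A; split=> //; first exact: open_closedC.
- move=> x Ux; apply: contrapT => Ax; apply: Ux; exists x; split=> //.
  by rewrite mdistxx invr_gt0.
- by rewrite setDE setCK.
Qed.

Lemma squeezed_setC (A : set X) : squeezed A -> squeezed (~` A).
Proof.
move=> sA e e0; have [F [U [cF oU FA AU h]]] := sA e e0.
exists (~` U), (~` F); split.
- exact: open_closedC.
- exact: closed_openC.
- exact: subsetC.
- exact: subsetC.
- by rewrite (_ : ~` F `\` ~` U = U `\` F)// !setDE setCK setIC.
Qed.

Lemma squeezed_bigcup (A : nat -> set X) : (forall n, squeezed (A n)) ->
  squeezed (\bigcup_n A n).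
Proof.
move=> sA e e0; have e20 : 0 < e / 2 by rewrite divr_gt0.
have H n : exists FU : set X * set X, [/\ closed FU.1, open FU.2, FU.1 `<=` A n, A n `<=` FU.2 &
    (mu ((FU.2 `\` FU.1) `&` W) <= (e / 2 / (2 ^ n.+1)%:R)%:E)%E].
  have [F [U h]] := sA n (e / 2 / (2 ^ n.+1)%:R) ltac:(by rewrite divr_gt0// ltr0n expn_gt0).
  by exists (F, U).
have /boolp.choice[FU hFU] := H.
pose F n := (FU n).1; pose U n := (FU n).2.
have cF n : closed (F n) by have [] := hFU n.
have oU n : open (U n) by have [] := hFU n.
have mF n : measurable (F n) by exact: closed_meas.
have mU n : measurable (U n) by exact: open_meas.
(* An infinite union of closed sets need not be closed, so only finitely many [F k] are kept; the
   loss [D n] within [W] tends to 0 and takes the other half of [e]. *)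
pose D n := \bigcup_k F k `\` \big[setU/set0]_(k < n) F k.
have mD n : measurable (D n).
  by apply: measurableD; [exact: bigcup_measurable|exact: bigsetU_measurable].
have [n m nm|x h|N hN] := @decreasing_measure_small D (e / 2) e20 mD.
- by apply: setDS; apply: subset_bigsetU.
- have [[k _ Fk] _] := h 0%N; have [_] := h k.+1; apply.
  by rewrite -bigcup_mkord; exists k => //=.
exists (\big[setU/set0]_(k < N) F k), (\bigcup_n U n); split.
- by apply: closed_bigsetU => k _; exact: cF.
- by apply: bigcup_open => k _; exact: oU.
- move=> x; rewrite -bigcup_mkord => -[k _ Fk]; exists k => //.
  by have [_ _ FA _ _] := hFU k; exact: FA.
- move=> x [k _ Ak]; exists k => //.
  by have [_ _ _ AU _] := hFU k; exact: AU.
have mV n : measurable ((U n `\` F n) `&` W).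
  by apply: measurableI => //; exact: measurableD.
apply: (@le_trans _ _ (mu ((\bigcup_n ((U n `\` F n) `&` W)) `|` (D N `&` W)))).
  apply: le_measure; rewrite ?inE.
  - apply: measurableI => //; apply: measurableD; first exact: bigcup_measurable.
    exact: bigsetU_measurable.
  - apply: measurableU; first exact: bigcup_measurable.
    exact: measurableI.
  move=> x [[[k _ Uk] nF] Wx]; have [Fx|nFx] := pselect ((\bigcup_k F k) x).
    by right.
  left; exists k => //; split=> //; split=> // Fk; apply: nFx; by exists k.
apply: (@le_trans _ _ (mu (\bigcup_n ((U n `\` F n) `&` W)) + mu (D N `&` W))%E).
  by apply: measureU2; [exact: bigcup_measurable|exact: measurableI].
rewrite [e in leRHS](_ : e = e / 2 + e / 2); last by field.
rewrite EFinD; apply: leeD => //.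
have mVU : measurable (\bigcup_n ((U n `\` F n) `&` W)) by exact: bigcup_measurable.
apply: le_trans (measure_sigma_subadditive mu mV mVU (@subset_refl _ _)) _.
apply: le_trans (epsilon_trick0 xpredT (ltW e20)).
apply: lee_nneseries => //.
by move=> n _; have [_ _ _ _] := hFU n.
Qed.

Lemma borel_outer_regular (A : set X) (e : R) : <<s @open X >> A -> 0 < e ->
  exists U : set X, [/\ open U, A `<=` U & (mu ((U `\` A) `&` W) <= e%:E)%E].
Proof.
move=> bA e0.
have : squeezed A.
  apply: (@smallest_sub _ _ (@open X) squeezed _ _ A bA).
    split.
    - by apply: squeezed_open; exact: open0.
    - by move=> B; rewrite setTD; exact: squeezed_setC.
    - exact: squeezed_bigcup.
  exact: squeezed_open.
move=> /(_ e e0)[F [U [cF oU FA AU h]]]; exists U; split=> //.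
apply: le_trans h; apply: le_measure; rewrite ?inE.
- apply: measurableI => //; apply: measurableD; first exact: open_meas.
  move: bA; apply: smallest_sub => //; exact: sigma_algebra_measurable.
- by apply: measurableI => //; apply: measurableD; [exact: open_meas|exact: closed_meas].
- by apply: setSI; apply: setDS.
Qed.

End regularity.

(** * Approximation of Borel upper gradients from above *)

Section lipschitz_majorants.
Context {R : realType} {d : measure_display} {X : metricMeasurableType R d}.
Variables (mu : {measure set X -> \bar R}) (W : set X) (g : X -> \bar R).
Variables (delta p e : R).
Hypothesis open_meas : forall A : set X, open A -> measurable A.
Hypotheses (mW : measurable W) (Wfin : (mu W < +oo)%E).
Hypotheses (g0 : forall x, (0 <= g x)%E) (bg : borel_fun g).
Hypotheses (delta0 : 0 < delta) (p1 : 1 < p) (e0 : 0 < e).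

Let p0 : 0 < p. Proof. exact: lt_trans p1. Qed.

Let lev k : R := delta * 2 ^+ k.
Let A k : set X := [set x | ((lev k)%:E < g x)%E].
(** The next level is used because the majorant takes at least the value [lev k.+1] on a
    neighbourhood of [A k]. *)
Let b k : R := lev k.+1 `^ p.

Let lev0 k : 0 < lev k. Proof. by rewrite mulr_gt0// exprn_gt0. Qed.
Let b0 k : 0 < b k. Proof. exact: powR_gt0. Qed.

Let bA k : <<s @open X >> (A k).
Proof.
have := bg measurableT (emeasurable_itv `](lev k)%:E, +oo[%E).
rewrite setTI; congr (<<s _ >> _); apply/seteqP; split=> x /=; rewrite in_itv/= andbT//.
Qed.

Let mA k : measurable (A k).
Proof. by move: (bA k); apply: smallest_sub => //; exact: sigma_algebra_measurable. Qed.

(** The tolerance is divided by the weight [b k], so that the weighted excess sets contribute at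
    most [e] in total. *)
Let exU : exists U : nat -> set X, forall k, [/\ open (U k), A k `<=` U k &
  (mu ((U k `\` A k) `&` W) <= (e / (2 ^ k.+1)%:R / b k)%:E)%E].
Proof.
have H k : exists U : set X, [/\ open U, A k `<=` U &
    (mu ((U `\` A k) `&` W) <= (e / (2 ^ k.+1)%:R / b k)%:E)%E].
  apply: (borel_outer_regular open_meas mW Wfin (bA k)).
  by rewrite !divr_gt0// ltr0n expn_gt0.
by have /boolp.choice[U hU] := H; exists U.
Qed.

Let levS k : lev k.+1 = 2 * lev k. Proof. by rewrite /lev exprS mulrCA. Qed.

Let bE k : b k = 2 `^ p * lev k `^ p.
Proof. by rewrite /b levS powRM// ltW. Qed.

(* The level-set sum is geometric: its largest term dominates the rest. *)
Let sum_lev n : \sum_(k < n) b k <= 2 `^ p * lev n `^ p.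
Proof.
under eq_bigr do rewrite bE.
rewrite -mulr_sumr ler_wpM2l ?powR_ge0//.
elim: n => [|n ih]; first by rewrite big_ord0 powR_ge0.
rewrite big_ord_recr/=; apply: (@le_trans _ _ (2 * lev n `^ p)); first by lra.
rewrite levS powRM ?(ltW (lev0 _))// ler_wpM2r ?powR_ge0//.
by rewrite -[leLHS](powRr1 (ler0n R 2)); apply: ler_powR; rewrite ?ler1n// ltW.
Qed.

Let sumA_le x n : (\sum_(0 <= k < n) (cst (b k)%:E \_ (A k)) x <= (2 * 2 `^ p)%:E * g x `^ p)%E.
Proof.
have := g0 x; case gx : (g x) => [c| |]//; last first.
  by rewrite poweRyr ?gt_eqF// gt0_muley ?leey// lte_fin mulr_gt0// powR_gt0.
rewrite lee_fin => c0; rewrite poweR_EFin -EFinM.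
have E k : (cst (b k)%:E \_ (A k)) x = (if lev k < c then b k else 0)%:E.
  rewrite patchE; case: ifPn => [|/negP].
    by rewrite inE /A/= gx lte_fin => ->.
  by rewrite inE /A/= gx lte_fin => /negP/negbTE ->.
under eq_bigr do rewrite E.
rewrite sumEFin lee_fin big_mkord.
elim: n => [|n ih]; first by rewrite big_ord0 !mulr_ge0 ?powR_ge0.
rewrite big_ord_recr/=; case: ifPn => [hc|_]; last by rewrite addr0.
apply: (@le_trans _ _ (\sum_(k < n) b k + b n)).
  by rewrite lerD2r; apply: ler_sum => k _; case: ifPn => // _; exact: ltW.
rewrite bE; apply: (@le_trans _ _ (2 * 2 `^ p * lev n `^ p)); first by have := sum_lev n; lra.
rewrite ler_wpM2l ?mulr_ge0 ?powR_ge0//.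
by apply: ge0_ler_powR; rewrite ?nnegrE ?(ltW p0) ?(ltW (lev0 _)) ?(ltW hc).
Qed.

Let seriesA_le x :
  (\sum_(0 <= k <oo) (cst (b k)%:E \_ (A k)) x <= (2 * 2 `^ p)%:E * g x `^ p)%E.
Proof.
apply: lime_le.
  apply: is_cvg_nneseries => k _ _; apply: erestrict_ge0 => y _.
  by rewrite lee_fin ltW.
by apply: nearW => n; exact: sumA_le.
Qed.

(** A Vitali-Caratheodory construction: [h] is the supremum of [delta] and of the values [lev k.+1]
    on the open sets [U k]. Where [lev k < g <= lev k.+1], it is at least [lev k.+1]. Only a bound
    up to a factor is claimed, so a geometric sum over the levels suffices. *)
Lemma lower_semicontinuous_majorant : exists h : X -> \bar R,
  [/\ forall x, (delta%:E <= h x)%E, forall x, (g x <= h x)%E,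
      forall a : R, open [set x | (a%:E < h x)%E] &
      (\int[mu]_(x in W) (h x `^ p) <= (delta `^ p)%:E * mu W +
        (2 * 2 `^ p)%:E * \int[mu]_(x in W) (g x `^ p) + e%:E)%E].
Proof.
have [U hU] := exU.
have oU k : open (U k) by have [] := hU k.
have mU k : measurable (U k) by exact: open_meas.
pose S x := [set delta%:E] `|` [set (lev k.+1)%:E | k in [set k | U k x]].
pose h x := ereal_sup (S x).
have hd x : (delta%:E <= h x)%E by apply: ereal_sup_ubound; left.
have hU' k x : U k x -> ((lev k.+1)%:E <= h x)%E.
  by move=> Uk; apply: ereal_sup_ubound; right; exists k.
have oh a : open [set x | (a%:E < h x)%E].
  rewrite openE => x /= /ereal_sup_gt[_ [->|[k /= Uk <-]] ak].
    apply: filterS filterT => y _; exact: lt_le_trans (hd y).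
  apply: (filterS _ (open_nbhs_nbhs (conj (oU k) Uk))) => y /= Uy.
  exact: lt_le_trans (hU' _ _ Uy).
exists h; split=> //.
- move=> x; rewrite leNgt; apply/negP => hg.
  have := hd x; case Eh : (h x) hg => [c| |]//; last by rewrite ltNge leey.
  move=> cg; rewrite lee_fin => dc.
  have exk : exists k, c < lev k.+1.
    exists (Num.truncn (c / delta)); rewrite /lev mulrC -ltr_pdivrMr//.
    apply: lt_trans (truncnS_gt _) _; rewrite -natrX ltr_nat.
    exact: ltn_expl.
  have [k hk kmin] := ex_minnP exk.
  have kc : lev k <= c.
    case: k hk kmin => [|k] hk kmin; first by rewrite /lev expr0 mulr1.
    by rewrite leNgt; apply/negP => /kmin; rewrite ltnn.
  have Uk : U k x.
    have [_ AU _] := hU k; apply: AU; rewrite /A/=.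
    by apply: le_lt_trans cg; rewrite lee_fin.
  by have := hU' _ _ Uk; rewrite Eh lee_fin leNgt hk.
have mh : measurable_fun [set: X] h.
  apply: (@measurability _ _ X (\bar R) _ _ (@ErealGenOInfty.G R)).
    exact: ErealGenOInfty.measurableE.
  move=> _ [_ [a ->] <-]; rewrite setTI; apply: open_meas.
  have := oh a; congr open; apply/seteqP; split=> x /=; rewrite in_itv/= andbT//.
pose Phi x : \bar R := ((delta `^ p)%:E + \sum_(0 <= k <oo) (cst (b k)%:E \_ (U k)) x)%E.
have cU0 k x : (0 <= (cst (b k)%:E \_ (U k)) x)%E.
  by apply: erestrict_ge0 => y _; rewrite lee_fin ltW.
have mcU k : measurable_fun W (cst (b k)%:E \_ (U k)).
  apply: (measurable_funS measurableT) => //.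
  by apply/(measurable_restrictT _ (mU _)).1; exact: measurable_cst.
have mcA k : measurable_fun W (cst (b k)%:E \_ (A k)).
  apply: (measurable_funS measurableT) => //.
  by apply/(measurable_restrictT _ (mA _)).1; exact: measurable_cst.
have cA0 k x : (0 <= (cst (b k)%:E \_ (A k)) x)%E.
  by apply: erestrict_ge0 => y _; rewrite lee_fin ltW.
have ser0 x : (0 <= \sum_(0 <= k <oo) (cst (b k)%:E \_ (U k)) x)%E.
  by apply: nneseries_ge0 => k _ _.
(* [h] is a supremum of values whose [p]-th powers are at most [Phi]; comparing with the [p]-th root
   of [Phi] allows checking each value separately. *)
have hPhi x : (h x `^ p <= Phi x)%E.
  have P0 : (0 <= Phi x)%E by rewrite adde_ge0// lee_fin powR_ge0.
  have pp : p^-1 * p = 1 by rewrite mulVf// gt_eqF.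
  rewrite -[leRHS](poweRe1 P0) -pp poweRrM; apply: gt0_ler_poweR; first exact: ltW.
  - by rewrite in_itv/= leey andbT (le_trans _ (hd x))// lee_fin ltW.
  - by rewrite in_itv/= leey andbT poweR_ge0.
  apply: ge_ereal_sup => t St.
  have [t0 tP] : (0 <= t)%E /\ (t `^ p <= Phi x)%E.
    case: St => [->|[k /= Uk <-]]; rewrite poweR_EFin.
      by split; [rewrite lee_fin ltW|rewrite leeDl].
    split; first by rewrite lee_fin ltW.
    apply: (@le_trans _ _ (\sum_(0 <= k <oo) (cst (b k)%:E \_ (U k)) x)%E); last first.
      by rewrite leeDr// lee_fin powR_ge0.
    apply: le_trans (nneseries_lim_ge k.+1 _) => //.
    rewrite big_nat_recr//= patchT ?inE// leeDr//.
    by apply: sume_ge0 => i _.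
  rewrite -[leLHS](poweRe1 t0) -pp mulrC poweRrM; apply: gt0_ler_poweR => //.
  - by rewrite invr_ge0 ltW.
  - by rewrite in_itv/= leey andbT poweR_ge0.
  - by rewrite in_itv/= leey andbT.
have mPhi : measurable_fun W (fun x => \sum_(0 <= k <oo) (cst (b k)%:E \_ (U k)) x)%E.
  by apply: ge0_emeasurable_sum => // k x _ _; exact: cU0.
apply: (@le_trans _ _ (\int[mu]_(x in W) Phi x)%E).
  apply: ge0_le_integral => //.
  - by move=> x _; exact: poweR_ge0.
  - apply: (measurable_funS measurableT) => //.
    exact: (measurableT_comp (measurable_poweR p)).
  - by apply: emeasurable_funD => //; exact: measurable_cst.
rewrite ge0_integralD//; last first.
  by move=> x _; rewrite lee_fin powR_ge0.
rewrite integral_cst// -addeA leeD2l//.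
rewrite integral_nneseries//.
have mAW k : (mu (A k `&` W) < +oo)%E.
  by apply: le_lt_trans Wfin; apply: le_measure; rewrite ?inE//; exact: measurableI.
apply: (@le_trans _ _ (\sum_(0 <= k <oo)
    (\int[mu]_(x in W) (cst (b k)%:E \_ (A k)) x + (e / (2 ^ k.+1)%:R)%:E))%E).
  apply: lee_nneseries; first by move=> k _ _; exact: integral_ge0.
  move=> k _; rewrite -!integral_mkcondr !integral_cst//; [|exact: measurableI..].
  have [_ AU hk] := hU k.
  apply: (@le_trans _ _ ((b k)%:E * (mu (A k `&` W) + mu ((U k `\` A k) `&` W)))%E).
    rewrite lee_wpmul2l ?lee_fin ?(ltW (b0 _))//.
    rewrite (setIC W) -measureU; [|exact: measurableI|by apply: measurableI => //; exact: measurableD|].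
      by rewrite -setIUl setDUK.
    by apply/seteqP; split=> // x [[Ax _] [[_ nA] _]].
  rewrite ge0_muleDr//; rewrite (setIC W) leeD2l//.
  apply: (@le_trans _ _ ((b k)%:E * (e / (2 ^ k.+1)%:R / b k)%:E)%E).
    by rewrite lee_wpmul2l ?lee_fin ?(ltW (b0 _)).
  by rewrite -EFinM lee_fin mulrC divfK// gt_eqF.
apply: le_trans (epsilon_trick xpredT _ (ltW e0)) _.
  by move=> k; exact: integral_ge0.
rewrite leeD2r// -integral_nneseries//.
rewrite -ge0_integralZl_EFin//.
- apply: ge0_le_integral => //.
  + by move=> x _; exact: nneseries_ge0.
  + by apply: ge0_emeasurable_sum => // k x _ _; exact: cA0.
  + apply: (measurable_funS measurableT) => //; apply: emeasurable_funM; first exact: measurable_cst.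
    apply: (measurableT_comp (measurable_poweR p)); exact: borel_measurable.
- by move=> x _; exact: poweR_ge0.
- apply: (measurable_funS measurableT) => //.
  by apply: (measurableT_comp (measurable_poweR p)); exact: borel_measurable.
Qed.

(** Infimal convolution of the truncated majorant with [j] times the distance. This is
    [j]-Lipschitz, increases with [j] and, by lower semicontinuity of [h], exceeds any number below
    [g x] once [j] is large. The [G j] lie below [h] and inherit its integral bound. *)
Lemma lipschitz_majorants : exists G : nat -> X -> R,
  [/\ forall j x y, `|G j x - G j y| <= j%:R * mdist x y,
      forall j x, delta <= G j x <= delta + j%:R,
      forall i j x, (i <= j)%N -> G i x <= G j x,
      forall x (a : R), (a%:E < g x)%E -> exists j, a < G j x &
      forall j, (\int[mu]_(x in W) ((G j x)%:E `^ p) <= (delta `^ p)%:E * mu W +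
        (2 * 2 `^ p)%:E * \int[mu]_(x in W) (g x `^ p) + e%:E)%E].
Proof.
have [h [hd gh oh hint]] := lower_semicontinuous_majorant.
pose H j y : R := fine (mine (h y) (delta + j%:R)%:E).
have HE j y : (H j y)%:E = mine (h y) (delta + j%:R)%:E.
  rewrite /H fineK// ge0_fin_numE; last first.
    rewrite le_min lee_fin addr_ge0 ?(ltW delta0)// andbT.
    by apply: le_trans (hd y); rewrite lee_fin ltW.
  by rewrite gt_min ltry orbT.
have Hd j y : delta <= H j y by rewrite -lee_fin HE le_min hd /= lee_fin lerDl ler0n.
have Hj j y : H j y <= delta + j%:R by rewrite -lee_fin HE ge_min lexx orbT.
have Hh j y : ((H j y)%:E <= h y)%E by rewrite HE ge_min lexx.
pose S j x := [set H j y + j%:R * mdist x y | y in [set: X]].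
pose G j x := inf (S j x).
have jd j x y : 0 <= j%:R * mdist x y by rewrite mulr_ge0// mdist_ge0.
have lS j x : lbound (S j x) delta.
  by move=> _ [y _ <-]; rewrite (le_trans (Hd j y))// lerDl jd.
have S0 j x : S j x !=set0 by exists (H j x + j%:R * mdist x x), x.
have Gle j x y : G j x <= H j y + j%:R * mdist x y.
  by apply: ge_inf; [exists delta; exact: lS|by exists y].
have leG j x c : (forall y, c <= H j y + j%:R * mdist x y) -> c <= G j x.
  by move=> hc; apply: lb_le_inf => // _ [y _ <-].
have GH j x : G j x <= H j x by have := Gle j x x; rewrite mdistxx mulr0 addr0.
have Glip1 j x y : G j x <= G j y + j%:R * mdist x y.
  rewrite -lerBlDr; apply: leG => z; rewrite lerBlDr; apply: le_trans (Gle j x z) _.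
  rewrite -addrA lerD2l addrC -mulrDr ler_wpM2l//.
  exact: metric_triangle.
have Glip j x y : `|G j x - G j y| <= j%:R * mdist x y.
  have h1 := Glip1 j x y; have h2 := Glip1 j y x; rewrite (metric_sym y x) in h2.
  by rewrite ler_norml lerBlDl h1 andbT lerBrDl lerBlDr.
exists G; split => //.
- move=> j x; rewrite (le_trans (GH j x) (Hj j x)) andbT.
  by apply: lb_le_inf => //; exact: lS.
- move=> i j x ij; apply: leG => y; apply: le_trans (Gle i x y) _.
  rewrite lerD//; last by rewrite ler_wpM2r ?mdist_ge0// ler_nat.
  by rewrite -lee_fin !HE; apply: le_min2 => //; rewrite lee_fin lerD2l ler_nat.
- move=> x a /lt_le_trans/(_ (gh x)) ah.
  have [a' aa' a'h] : exists2 a' : R, a < a' & (a'%:E < h x)%E.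
    case: (h x) ah => [c| |]//; last by exists (a + 1); rewrite ?ltrDl ?ltry.
    by rewrite lte_fin => ac; exists ((a + c) / 2); rewrite ?lte_fin; lra.
  have := oh a'; rewrite openE => /(_ x a'h)/nbhs_ballP[r /= r0 hr].
  (* Points within [r] of [x] are handled by [a' < h] and [a' < j], points farther away by the
     penalty [j * r > a']. *)
  pose j := (Num.truncn (Num.max a' (a' / r))).+1.
  have : Num.max a' (a' / r) < j%:R by exact: truncnS_gt.
  rewrite gt_max ltr_pdivrMr// => /andP[ja jr].
  exists j; apply: lt_le_trans aa' _; apply: leG => y.
  have [xy|xy] := ltP (mdist x y) r.
    have : (a'%:E < h y)%E by apply: hr; rewrite ballEmdist.
    move=> a'y; apply: (@le_trans _ _ (H j y)); last by rewrite lerDl jd.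
    rewrite -lee_fin HE le_min ltW//= lee_fin (le_trans (ltW ja))// lerDr.
    exact: ltW.
  apply: (le_trans (ltW jr)); apply: (@le_trans _ _ (j%:R * mdist x y)).
    by rewrite ler_wpM2l.
  by rewrite lerDr (le_trans _ (Hd j y))// ltW.
- move=> j; apply: le_trans hint.
  have mG : measurable_fun [set: X] (EFin \o G j).
    apply: borel_measurable => //; apply: continuous_borel.
    exact: lipschitz_continuous (Glip j).
  have mh : measurable_fun [set: X] h.
    apply: (@measurability _ _ X (\bar R) _ _ (@ErealGenOInfty.G R)).
      exact: ErealGenOInfty.measurableE.
    move=> _ [_ [a ->] <-]; rewrite setTI; apply: open_meas.
    have := oh a; congr open; apply/seteqP; split=> x /=; rewrite in_itv/= andbT//.
  have Gp x : (0 <= (G j x)%:E)%E.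
    by rewrite lee_fin (le_trans (ltW delta0))//; apply: lb_le_inf => //; exact: lS.
  apply: ge0_le_integral => //.
  + by move=> x _; exact: poweR_ge0.
  + apply: (measurable_funS measurableT) => //.
    exact: (measurableT_comp (measurable_poweR p) mG).
  + apply: (measurable_funS measurableT) => //.
    exact: (measurableT_comp (measurable_poweR p) mh).
  + move=> x _; have Ghx : ((G j x)%:E <= h x)%E.
      by apply: le_trans (Hh j x); rewrite lee_fin.
    apply: gt0_ler_poweR => //; first exact: ltW.
      by rewrite in_itv/= leey andbT.
    by rewrite in_itv/= leey andbT (le_trans _ Ghx).
Qed.

End lipschitz_majorants.

(** * Chains *)

Section chains.
Context {R : realType} {d : measure_display} {X : metricMeasurableType R d}.
Variables (x0 : X) (G : X -> R) (eps s : R).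

(** The costs are left-endpoint Riemann sums of [G] along chains with steps at most [eps]. Chains
    start free of charge anywhere in a closed ball around [x0]; for [s > 0] the cost thus vanishes
    on a set of positive measure, which averages can see. *)
Inductive reach : X -> R -> Prop :=
| reach_start z : mdist x0 z <= s -> reach z 0
| reach_step x y c : reach x c -> mdist x y <= eps -> reach y (c + G x * mdist x y).

(** The cap at 1 keeps the infimum meaningful at points that no chain reaches and, together with
    [G >= delta], makes [1 - chain_cost] vanish far from [x0], hence integrable. *)
Definition chain_cost (x : X) : R := inf ([set c | reach x c] `|` [set 1]).

Variables (delta L M : R).
Hypotheses (delta0 : 0 < delta) (eps0 : 0 < eps) (L0 : 0 <= L).
Hypothesis GL : forall x y, `|G x - G y| <= L * mdist x y.
Hypothesis Gbound : forall x, delta <= G x <= M.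

Let G0 x : 0 < G x. Proof. by have /andP[h _] := Gbound x; exact: lt_le_trans h. Qed.

Lemma reach_ge0 x c : reach x c -> 0 <= c.
Proof.
by elim=> // {}x y {}c _ c0 _; rewrite addr_ge0// mulr_ge0 ?mdist_ge0// ltW.
Qed.

Lemma reach_dist x c : reach x c -> delta * (mdist x0 x - s) <= c.
Proof.
elim=> [z xz|{}x y {}c _ h _]; first by rewrite pmulr_rle0// subr_le0.
have /andP[dG _] := Gbound x.
apply: (@le_trans _ _ (delta * (mdist x0 x - s) + delta * mdist x y)).
  rewrite -mulrDr ler_wpM2l ?(ltW delta0)//.
  by have := metric_triangle x0 x y; lra.
by rewrite lerD// ler_wpM2r ?mdist_ge0.
Qed.

Let cost_lb x : lbound ([set c | reach x c] `|` [set 1]) 0.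
Proof. by move=> c [/reach_ge0//|->]. Qed.

Let cost_neq0 x : ([set c | reach x c] `|` [set 1]) !=set0.
Proof. by exists 1; right. Qed.

Lemma chain_cost_ge0 x : 0 <= chain_cost x.
Proof. by apply: lb_le_inf => //; exact: cost_lb. Qed.

Lemma chain_cost_le1 x : chain_cost x <= 1.
Proof. by apply: ge_inf; [exists 0; exact: cost_lb|right]. Qed.

Lemma chain_cost_le x c : reach x c -> chain_cost x <= c.
Proof. by move=> h; apply: ge_inf; [exists 0; exact: cost_lb|left]. Qed.

Lemma chain_cost_start x : mdist x0 x <= s -> chain_cost x = 0.
Proof.
move=> h; apply/le_anti; rewrite chain_cost_ge0 andbT.
by apply: chain_cost_le; exact: reach_start.
Qed.

Lemma chain_cost_far x : s + delta^-1 <= mdist x0 x -> chain_cost x = 1.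
Proof.
move=> h; apply/le_anti; rewrite chain_cost_le1/=; apply: lb_le_inf => // c [/reach_dist|->//].
apply: le_trans; rewrite -ler_pdivrMl// mulr1; lra.
Qed.

Lemma chain_cost_step x y : mdist x y <= eps ->
  chain_cost y <= chain_cost x + G x * mdist x y.
Proof.
move=> xy; rewrite -lerBlDr; apply: lb_le_inf => // c [h|->]; rewrite lerBlDr.
  by apply: chain_cost_le; exact: reach_step.
by apply: le_trans (chain_cost_le1 y) _; rewrite lerDl mulr_ge0 ?mdist_ge0// ltW.
Qed.

(** Pairs more than [eps] apart cannot be joined by one step, but for them the cap at 1 already
    gives the bound with constant [eps^-1]. *)
Lemma chain_cost_lipschitz x y :
  `|chain_cost x - chain_cost y| <= (M + eps^-1) * mdist x y.
Proof.
have M0 : 0 < M by have /andP[_ h] := Gbound x; exact: lt_le_trans h.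
have [xy|xy] := leP (mdist x y) eps.
  have h1 := chain_cost_step xy; rewrite (metric_sym x y) in xy.
  have h2 := chain_cost_step xy; rewrite (metric_sym y x) in xy h2.
  have /andP[_ Gx] := Gbound x; have /andP[_ Gy] := Gbound y.
  have m0 := mdist_ge0 x y.
  have g1 : G x * mdist x y <= M * mdist x y by rewrite ler_wpM2r.
  have g2 : G y * mdist x y <= M * mdist x y by rewrite ler_wpM2r.
  have e1 : 0 <= eps^-1 * mdist x y by rewrite mulr_ge0// invr_ge0 ltW.
  rewrite mulrDl ler_norml; apply/andP; split; lra.
apply: (@le_trans _ _ 1).
  have := chain_cost_ge0 x; have := chain_cost_ge0 y.
  have := chain_cost_le1 x; have := chain_cost_le1 y.
  by rewrite ler_norml => *; apply/andP; split; lra.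
apply: (@le_trans _ _ (eps^-1 * mdist x y)).
  by rewrite ler_pdivlMl// mulr1 ltW.
by rewrite ler_wpM2r ?mdist_ge0// lerDr ltW.
Qed.

(** Points of a curve less than [eps] apart in arclength are joined by a single step, so the cost
    changes by at most [G * dt] up to second order; this is integrated for the cost and for its
    negative. *)
Lemma chain_cost_upper_gradient :
  upper_gradient (EFin \o chain_cost) (EFin \o G).
Proof.
split.
- by move=> x; rewrite lee_fin ltW.
- by apply: continuous_borel; exact: lipschitz_continuous GL.
move=> l gam lg; have [l0 _] := lg.
pose gc t := gam (clamp l t).
have gcL a b : mdist (gc a) (gc b) <= `|a - b|.
  by have := arclength_clamp_lipschitz lg a b; rewrite mul1r.
have H t : 0 <= G (gc t) by rewrite ltW.
have HL a b : `|G (gc a) - G (gc b)| <= L * `|a - b|.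
  by apply: le_trans (GL _ _) _; rewrite ler_wpM2l.
have E : (\int[lebesgue_measure]_(t in `[0%R, l]) (EFin \o G) (gam t) =
          \int[lebesgue_measure]_(t in `[0%R, l]) (G (gc t))%:E)%E.
  by apply: eq_integral => t; rewrite inE/= in_itv/= => tl; rewrite /gc clamp_id.
rewrite E /=.
have gc0 : gc 0 = gam 0 by rewrite /gc clamp_id// lexx ltW.
have gcl : gc l = gam l by rewrite /gc clamp_id// lexx ltW.
have inc a b : a <= b -> b - a < eps ->
    chain_cost (gc b) - chain_cost (gc a) <= (G (gc a) + L * (b - a)) * (b - a) /\
    chain_cost (gc a) - chain_cost (gc b) <= (G (gc a) + L * (b - a)) * (b - a).
  move=> ab be; have ba0 : 0 <= b - a by rewrite subr_ge0.
  have gab : mdist (gc a) (gc b) <= b - a.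
    by apply: le_trans (gcL a b) _; rewrite distrC ger0_norm.
  have gba : mdist (gc b) (gc a) <= b - a by rewrite metric_sym.
  have h1 := chain_cost_step (le_trans gab (ltW be)).
  have h2 := chain_cost_step (le_trans gba (ltW be)).
  have g1 : G (gc a) * mdist (gc a) (gc b) <= G (gc a) * (b - a) by rewrite ler_wpM2l.
  have g2 : G (gc b) * mdist (gc b) (gc a) <= G (gc b) * (b - a) by rewrite ler_wpM2l.
  have Lba : 0 <= L * (b - a) * (b - a) by rewrite !mulr_ge0.
  have Gb : G (gc b) <= G (gc a) + L * (b - a).
    have := HL b a; rewrite (ger0_norm ba0) => h.
    by have := ler_norm (G (gc b) - G (gc a)); lra.
  have g3 : G (gc b) * (b - a) <= (G (gc a) + L * (b - a)) * (b - a) by rewrite ler_wpM2r.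
  by rewrite mulrDl in g3 *; split; lra.
have I1 := integral_ge_increment (ltW l0) L0 H HL (F := chain_cost \o gc) eps0
  (fun a b _ ab _ be => (proj1 (inc a b ab be))).
have H2 a b : 0 <= a -> a <= b -> b <= l -> b - a < eps ->
    - chain_cost (gc b) - - chain_cost (gc a) <= (G (gc a) + L * (b - a)) * (b - a).
  by move=> _ ab _ be; have := proj2 (inc a b ab be); lra.
have I2 := integral_ge_increment (ltW l0) L0 H HL (F := fun t => - chain_cost (gc t)) eps0 H2.
rewrite /= gc0 gcl in I1.
rewrite /= gc0 gcl (_ : - _ - - _ = chain_cost (gam 0) - chain_cost (gam l)) in I2; last by lra.
have [h|h] := leP (chain_cost (gam 0)) (chain_cost (gam l)).
  by rewrite ler0_norm ?subr_le0// opprB.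
by rewrite gtr0_norm ?subr_gt0.
Qed.

(* The chain is parametrized by its accumulated cost: gam t is the vertex
   reached before paying more than t. *)
Lemma reach_trace (e : R) y c : M * eps <= e -> reach y c ->
  exists gam : R -> X, [/\ mdist x0 (gam 0) <= s,
    forall t, c <= t -> gam t = y,
    forall t, mdist x0 (gam t) <= s + c / delta &
    forall a b m, 0 <= a -> a <= b -> (forall t, a <= t <= b -> m <= G (gam t)) ->
      m * mdist (gam a) (gam b) <= b - a + e].
Proof.
move=> eM; elim=> [z xz|{}x {}y {}c xc [gam [g0 gc gd gI]] xy].
  have e0 : 0 <= e.
    have /andP[h1 h2] := Gbound z; apply: le_trans eM; rewrite mulr_ge0 ?(ltW eps0)//.
    by rewrite (le_trans _ h2)// (le_trans _ h1)// ltW.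
  exists (fun=> z); split => // [t|a b m a0 ab _]; first by rewrite mul0r addr0.
  by rewrite mdistxx mulr0 addr_ge0// subr_ge0.
set c' := c + G x * mdist x y.
have cc' : c <= c' by rewrite lerDl mulr_ge0 ?mdist_ge0// ltW.
have c0 := reach_ge0 xc.
have stepe : G x * mdist x y <= e.
  have /andP[_ h2] := Gbound x; apply: le_trans eM.
  by apply: ler_pM => //; [exact: ltW|exact: mdist_ge0].
pose gam' t := if t < c' then gam t else y.
(* A step of zero cost leaves the vertex unchanged because [G > 0]; so even if [c' = c], the old and
   new traces agree at time [c]. *)
have same t : t <= c -> gam' t = gam t.
  rewrite /gam' => tc; case: ltP => // c't.
  have : G x * mdist x y = 0.
    have h1 : 0 <= G x * mdist x y by rewrite mulr_ge0 ?mdist_ge0// ltW.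
    by rewrite /c' in c't; lra.
  move=> /eqP; rewrite mulf_eq0 gt_eqF//= => /eqP /mdist_positivity <-.
  by rewrite gc// (le_trans cc').
have e0 : 0 <= e by apply: le_trans stepe; rewrite mulr_ge0 ?mdist_ge0// ltW.
exists gam'; split.
- by rewrite same.
- by move=> t c't; rewrite /gam' ltNge c't.
- move=> t; rewrite /gam'; case: ltP => _.
    by apply: le_trans (gd t) _; rewrite lerD2l ler_wpM2r// invr_ge0 ltW.
  have := reach_dist (reach_step xc xy).
  by rewrite -ler_pdivlMl// mulrC -/c'; lra.
(* The slack [e] does not accumulate: if [a <= c], the last step is paid in full by [c' - c]; if [a]
   lies strictly between [c] and [c'], that single step is covered by [e]. *)
- move=> a b m a0 ab hm; have [bc|cb] := ltP b c'.
    have ac : a < c' by exact: le_lt_trans bc.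
    rewrite /gam' ac bc; apply: gI => // t /andP[at_ tb].
    by have := hm t; rewrite /gam' (le_lt_trans tb bc) => -> //; rewrite at_.
  have gb : gam' b = y by rewrite /gam' ltNge cb.
  have [ac|ca] := ltP a c'; last first.
    by rewrite gb /gam' ltNge ca mdistxx mulr0 addr_ge0// subr_ge0.
  have [ac2|ca2] := leP a c.
    have hma t : a <= t <= c -> m <= G (gam t).
      move=> /andP[at_ tc]; rewrite -same//; apply: hm.
      by rewrite at_ (le_trans tc)// (le_trans cc').
    have := gI a c m a0 ac2 hma; rewrite gb (same _ ac2) (gc c)// => h1.
    have mGx : m <= G x by rewrite -(gc c)// hma// ac2 lexx.
    have m0 := mdist_ge0 x y; have m0' := mdist_ge0 (gam a) x.
    have [m_le0|m_gt0] := leP m 0.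
      apply: (@le_trans _ _ 0); first by rewrite mulr_le0_ge0// mdist_ge0.
      by rewrite addr_ge0// subr_ge0.
    have h2 : m * mdist x y <= G x * mdist x y by rewrite ler_wpM2r.
    have h3 : m * mdist (gam a) y <= m * (mdist (gam a) x + mdist x y).
      by rewrite ler_wpM2l ?(ltW m_gt0)// metric_triangle.
    by rewrite mulrDr in h3; rewrite /c' in cb; lra.
  have ga : gam' a = x by rewrite /gam' ac gc// ltW.
  have mGx : m <= G x by rewrite -ga; apply: hm; rewrite lexx.
  rewrite gb ga; apply: (@le_trans _ _ (G x * mdist x y)).
    by rewrite ler_wpM2r// mdist_ge0.
  by apply: (le_trans stepe); rewrite lerDr subr_ge0.
Qed.

End chains.

Section chains_monotone.
Context {R : realType} {d : measure_display} {X : metricMeasurableType R d}.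
Variables (x0 : X) (G G' : X -> R) (eps eps' s s' : R).
Hypotheses (GG : forall x, G x <= G' x) (ee : eps' <= eps) (ss : s' <= s).
Hypothesis G0 : forall x, 0 <= G x.

Lemma reach_mono x c : reach x0 G' eps' s' x c -> exists2 c', c' <= c & reach x0 G eps s x c'.
Proof.
elim=> [z zs|{}x y {}c _ [c' cc h] xy].
  by exists 0 => //; apply: reach_start; exact: le_trans ss.
exists (c' + G x * mdist x y); last by apply: reach_step => //; exact: le_trans ee.
by rewrite lerD// ler_wpM2r ?mdist_ge0.
Qed.

Lemma chain_cost_mono x : chain_cost x0 G eps s x <= chain_cost x0 G' eps' s' x.
Proof.
have lb : has_lbound ([set c | reach x0 G eps s x c] `|` [set 1]).
  exists 0 => c [h|->//]; elim: h => // z y {}c _ c0 _.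
  by rewrite addr_ge0// mulr_ge0 ?mdist_ge0.
apply: lb_le_inf; first by exists 1; right.
move=> c [/reach_mono[c' cc h]|->]; last by apply: ge_inf => //; right.
by apply: le_trans cc; apply: ge_inf => //; left.
Qed.

End chains_monotone.

Lemma fmap_ultra (S T : Type) (f : S -> T) (U : set_system S) :
  UltraFilter U -> UltraFilter (f @ U).
Proof.
move=> UU; split; first exact: fmap_proper_filter.
move=> H HH sub; apply/seteqP; split; last exact: sub.
move=> A HA; have [//|nA] := in_ultra_setVsetC (f @^-1` A) UU.
have HnA : H (~` A) by apply: sub.
have : H (A `&` ~` A) by exact: filterI.
by rewrite setICr => /filter_ex[].
Qed.

(** * Limits of chains *)

Section limit_curve.
Context {R : realType} {d : measure_display} {X : metricMeasurableType R d}.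
Variables (x0 y : X) (K : set X) (T delta : R) (G : nat -> X -> R) (gam : nat -> R -> X).
Hypotheses (cK : compact K) (T0 : 0 < T) (delta0 : 0 < delta).
Hypotheses (GL : forall j x z, `|G j x - G j z| <= j%:R * mdist x z)
  (Gd : forall j x, delta <= G j x) (Gnd : forall i j x, (i <= j)%N -> G i x <= G j x).
Hypotheses (gam0 : forall j, mdist x0 (gam j 0) <= j.+1%:R^-1)
  (gamT : forall j, gam j T = y) (gamK : forall j t, K (gam j t)).
Hypothesis gamI : forall j a b m, 0 <= a -> a <= b ->
  (forall t, a <= t <= b -> m <= G j (gam j t)) ->
  m * mdist (gam j a) (gam j b) <= b - a + j.+1%:R^-1.

Let gam_speed j a b : 0 <= a -> a <= b ->
  delta * mdist (gam j a) (gam j b) <= b - a + j.+1%:R^-1.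
Proof. by move=> a0 ab; apply: gamI => // t _; exact: Gd. Qed.

(** On [[a, b]] the trace stays within [(b - a + j.+1%:R^-1) / delta] of its point at time [a], so
    the Lipschitz bound controls how far [G i] can drop there. *)
Let gam_cost i j a b : (i <= j)%N -> 0 <= a -> a <= b ->
  (G i (gam j a) - i%:R * ((b - a + j.+1%:R^-1) / delta)) * mdist (gam j a) (gam j b) <=
  b - a + j.+1%:R^-1.
Proof.
move=> ij a0 ab; apply: gamI => // t /andP[at_ tb].
apply: le_trans (Gnd _ ij).
have h1 : mdist (gam j a) (gam j t) <= (b - a + j.+1%:R^-1) / delta.
  by rewrite ler_pdivlMr// mulrC (le_trans (gam_speed j a0 at_))// lerD2r lerD2r.
have h2 := GL i (gam j a) (gam j t).
have h3 : i%:R * mdist (gam j a) (gam j t) <= i%:R * ((b - a + j.+1%:R^-1) / delta).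
  by rewrite ler_wpM2l.
rewrite lerBlDr -lerBlDl.
exact: le_trans (ler_norm _) (le_trans h2 h3).
Qed.

(* The limit is taken along an ultrafilter, pointwise in time. The last clause
   says that G_i |dc| <= dt along c, up to an error that is small on short
   intervals; hence the arclength integral of each G_i is at most T. *)
Lemma limit_curve : exists c : R -> X, [/\ c 0 = x0, c T = y,
  forall a b, 0 <= a -> a <= b -> delta * mdist (c a) (c b) <= b - a &
  forall i a b, 0 <= a -> a <= b ->
    (G i (c a) - i%:R * ((b - a) / delta)) * mdist (c a) (c b) <= b - a].
Proof.
(* An ultrafilter provides limits at all times simultaneously; the traces are step functions,
   equicontinuous only up to an error that tends to 0. *)
have [U [UU sU]] := ultraFilterLemma (eventually_filter : ProperFilter \oo).
have lim t : exists z : X, (fun j => gam j t) @ U --> z.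
  have := cK; rewrite compact_ultra => /(_ _ (fmap_ultra (fun j => gam j t) UU)).
  have h : U [set j | K (gam j t)] by apply: filterS filterT => j _; exact: gamK.
  by move=> /(_ h)[z [_ hz]]; exists z.
have /boolp.choice[c hc] := lim.
have inv0 : (fun j : nat => j.+1%:R^-1 : R) @ U --> 0.
  by apply: cvg_trans (cvg_app _ sU) _; exact: cvg_harmonic.
have dlim t z : (fun j => mdist z (gam j t)) @ U --> mdist z (c t).
  apply/cvgrPdist_lt => e e0.
  apply: filterS (metricType_numDomainType.cvgr_dist_lt (hc t) e0) => j /=.
  apply: le_lt_trans.
  exact: mdist_lip.
have ddlim a b : (fun j => mdist (gam j a) (gam j b)) @ U --> mdist (c a) (c b).
  apply/cvgrPdist_lt => e e0.
  have e20 : 0 < e / 2 by rewrite divr_gt0.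
  apply: filterS (filterI (metricType_numDomainType.cvgr_dist_lt (hc a) e20)
    (metricType_numDomainType.cvgr_dist_lt (hc b) e20)) => j /= [h1 h2].
  have h3 := mdist_lip (c a) (c b) (gam j b).
  have h4 := mdist_lip (gam j b) (c a) (gam j a).
  rewrite !(metric_sym (gam j b)) in h4.
  apply: le_lt_trans (ler_distD (mdist (c a) (gam j b)) _ _) _; lra.
have Glim i t : (fun j => G i (gam j t)) @ U --> G i (c t).
  apply: continuous_cvg (hc t).
  exact: (lipschitz_continuous (GL i)).
exists c; split.
- apply/esym/mdist_positivity/le_anti; rewrite mdist_ge0 andbT.
  by apply: (ler_cvg_to (dlim 0 x0) inv0); apply: filterS filterT => j _; exact: gam0.
- apply/esym/mdist_positivity/le_anti; rewrite mdist_ge0 andbT.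
  have z0 : (fun=> 0 : R) @ U --> (0 : R) by exact: cvg_cst.
  apply: (ler_cvg_to (dlim T y) z0); apply: filterS filterT => j _.
  by rewrite gamT mdistxx.
- move=> a b a0 ab.
  have l1 : (fun j => delta * mdist (gam j a) (gam j b)) @ U --> delta * mdist (c a) (c b).
    by apply: cvgM => //; exact: cvg_cst.
  have l2 : (fun j : nat => b - a + j.+1%:R^-1) @ U --> b - a + 0.
    by apply: cvgD => //; exact: cvg_cst.
  rewrite -[leRHS]addr0.
  by apply: (ler_cvg_to l1 l2); apply: filterS filterT => j _; exact: gam_speed.
- move=> i a b a0 ab.
  have l2 : (fun j : nat => b - a + j.+1%:R^-1) @ U --> b - a.
    by rewrite -[X in _ --> X]addr0; apply: cvgD => //; exact: cvg_cst.
  have l1 : (fun j => (G i (gam j a) - i%:R * ((b - a + j.+1%:R^-1) / delta)) *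
      mdist (gam j a) (gam j b)) @ U -->
      (G i (c a) - i%:R * ((b - a) / delta)) * mdist (c a) (c b).
    apply: cvgM => //; apply: cvgB => //; apply: cvgM; first exact: cvg_cst.
    by apply: cvgM => //; exact: cvg_cst.
  apply: (ler_cvg_to l1 l2).
  have : \oo [set j | (i <= j)%N] by exact: nbhs_infty_ge.
  by move=> /sU; apply: filterS => j ij; exact: gam_cost.
Qed.

(** The limit curve is reparametrized by arclength; the time change [sg] has total increase at most
    [T] and bounds the integral of each [G i]. Monotone convergence then bounds the integral of [g],
    which lies below the supremum of the [G i]. *)
Lemma upper_gradient_limit_curve (u : X -> R) (g : X -> \bar R) :
  upper_gradient (EFin \o u) g ->
  (forall x (a : R), (a%:E < g x)%E -> exists j, a < G j x) ->
  `|u x0 - u y| <= T.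
Proof.
move=> [g0 bg h] gG; have [c [c0 cT cs cI]] := limit_curve.
(* Upper gradients concern nonconstant curves only, so coinciding endpoints are treated
   separately. *)
have [->|x0y] := pselect (x0 = y); first by rewrite subrr normr0 ltW.
have lip a b : 0 <= a -> a <= b -> b <= T -> mdist (c a) (c b) <= delta^-1 * (b - a).
  by move=> a0 ab _; rewrite ler_pdivlMl// cs.
have neq : c 0 <> c T by rewrite c0 cT.
have di0 : 0 <= delta^-1 by rewrite invr_ge0 ltW.
have [l [gc [sg [lg [gc0 gcl] gcs sgnd sglen]]]] := arclength_reparametrization T0 di0 lip neq.
have [l0 _] := lg.
rewrite -lee_fin; have := h l gc lg; rewrite /= gc0 gcl c0 cT => /le_trans; apply.
pose gcc t := gc (clamp l t).
have E f : (\int[lebesgue_measure]_(t in `[0%R, l]) f (gc t) =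
            \int[lebesgue_measure]_(t in `[0%R, l]) f (gcc t))%E.
  by apply: eq_integral => t; rewrite inE/= in_itv/= => tl; rewrite /gcc clamp_id.
have gcL a b : mdist (gcc a) (gcc b) <= `|a - b|.
  by have := arclength_clamp_lipschitz lg a b; rewrite mul1r.
have i0 i : (0 : R) <= i%:R by exact: ler0n.
have GcL i a b : `|G i (gcc a) - G i (gcc b)| <= i%:R * `|a - b|.
  by apply: le_trans (GL _ _ _) _; rewrite ler_wpM2l.
have Gc0 i t : 0 <= G i (gcc t) by rewrite (le_trans (ltW delta0)).
have sg0 := gcs 0 ltac:(by rewrite lexx ltW).
have sgl := gcs l ltac:(by rewrite lexx ltW).
have bound i : (\int[lebesgue_measure]_(t in `[0%R, l]) (G i (gcc t))%:E <= T%:E)%E.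
  (* [i / delta] is counted twice: once for the change of [G i] between [c (sg a)] and [c z], once
     for the error term in the estimate of the limit curve. *)
  have C0 : 0 <= 2 * (i%:R / delta) by rewrite mulr_ge0// divr_ge0// ltW.
  have inc a b : 0 <= a -> a <= b -> b <= l ->
      G i (gcc a) * (b - a) <= (1 + 2 * (i%:R / delta) * (b - a)) * (sg b - sg a).
    move=> a0 ab bl; have ba : 0 <= b - a by rewrite subr_ge0.
    have al : 0 <= a <= l by rewrite a0 (le_trans ab).
    have bl' : 0 <= b <= l by rewrite bl (le_trans a0).
    have [/andP[sa0 saT] ga] := gcs a al; have [/andP[sb0 sbT] gb] := gcs b bl'.
    have sab := sgnd a b a0 ab bl; have sba : 0 <= sg b - sg a by rewrite subr_ge0.
    rewrite /gcc clamp_id// ga; set D := sg b - sg a in sba *.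
    set m := G i (c (sg a)) - 2 * (i%:R / delta) * D.
    suff : m * (b - a) <= D by rewrite /m; lra.
    have [m0|m0] := leP m 0; first by rewrite (le_trans _ sba)// mulr_le0_ge0.
    have m0' : 0 <= m^-1 by rewrite invr_ge0 ltW.
    rewrite mulrC -ler_pdivlMr// mulrC -lee_fin.
    apply: le_trans (sglen a b a0 ab bl) _.
    apply: curve_length_le => // z w za zw wb.
    have z0 : 0 <= z by exact: le_trans za.
    rewrite ler_pdivlMl//; apply: le_trans (cI i z w z0 zw).
    rewrite ler_wpM2r ?mdist_ge0// /m.
    have h1 : mdist (c (sg a)) (c z) <= D / delta.
      rewrite ler_pdivlMr// mulrC; apply: le_trans (cs _ _ sa0 za) _.
      by rewrite /D lerD2r (le_trans zw).
    have h2 : i%:R * mdist (c (sg a)) (c z) <= i%:R * (D / delta) by rewrite ler_wpM2l.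
    have h3 : i%:R * ((w - z) / delta) <= i%:R * (D / delta).
      rewrite ler_wpM2l// ler_wpM2r ?invr_ge0 ?(ltW delta0)// /D.
      by rewrite lerB.
    have h4 := le_trans (ler_norm _) (GL i (c (sg a)) (c z)).
    have -> : 2 * (i%:R / delta) * D = i%:R * (D / delta) + i%:R * (D / delta) by ring.
    lra.
  have F0l : sg 0 <= sg l by apply: sgnd => //; exact: ltW.
  apply: le_trans (integral_le_increment (ltW l0) (i0 i) (Gc0 i) (GcL i) C0 F0l inc) _.
  rewrite lee_fin; case: sg0 => /andP[s0 _] _; case: sgl => /andP[_ sT] _; lra.
rewrite E.
have cg := arclength_clamp_continuous lg.
have mG i : measurable_fun [set: R] (fun t => (G i (gcc t))%:E).
  by apply/measurable_EFinP; exact: lipschitz_measurable (GcL i).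
pose Gl t := ereal_sup (range (fun i => (G i (gcc t))%:E)).
have ndG t : nondecreasing_seq (fun i => (G i (gcc t))%:E).
  by move=> i j ij; rewrite lee_fin Gnd.
have cvgG t : (fun i => (G i (gcc t))%:E) @ \oo --> Gl t.
  exact: ereal_nondecreasing_cvgn.
have GlE t : Gl t = limn (fun i => (G i (gcc t))%:E) by apply/esym/cvg_lim.
have := @cvg_monotone_convergence _ _ _ lebesgue_measure `[0%R, l]%classic _
  (fun i t => (G i (gcc t))%:E) _ _ _.
have mI : measurable `[0%R, l]%classic by [].
move=> /(_ mI (fun i => measurable_funS measurableT (@subsetT _ _) (mG i))).
move=> /(_ (fun i t _ => Gc0 i t) (fun t _ => ndG t)) CV.
apply: (@le_trans _ _ (\int[lebesgue_measure]_(t in `[0%R, l]) limn (fun i => (G i (gcc t))%:E))%E).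
  apply: ge0_le_integral => //.
  - exact: measurable_funS (continuous_borel_comp cg bg).
  - apply: (measurable_funS measurableT) => //.
    rewrite -(_ : Gl = (fun t => limn (fun i => (G i (gcc t))%:E))); last by apply/funext.
    by apply: (emeasurable_fun_cvg (fun i t => (G i (gcc t))%:E)) => // t _; exact: cvgG.
  - move=> t _; rewrite -GlE leNgt; apply/negP => lt.
    have [a [a1 a2]] : exists a : R, (Gl t <= a%:E)%E /\ (a%:E < g (gcc t))%E.
      have : (0 <= Gl t)%E by apply: ereal_sup_ge; exists (G 0%N (gcc t))%:E; [exists 0%N|rewrite lee_fin].
      by case: (Gl t) lt => [a| |]//; [move=> ? _; exists a|rewrite ltNge leey].
    have [j aj] := gG _ _ a2.
    have : ((G j (gcc t))%:E <= Gl t)%E by apply: ereal_sup_ubound; exists j.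
    by move=> /le_trans/(_ a1); rewrite lee_fin leNgt aj.
have := cvg_lim _ CV => /(_ (@ereal_hausdorff R)) <-.
apply: lime_le; first by apply/cvg_ex; eexists; exact: CV.
by apply: nearW => i; exact: bound.
Qed.

End limit_curve.

(** * Capacity of a point *)

Section point_capacity.
Context {R : realType} {d : measure_display} {X : metricMeasurableType R d}.
Variables (mu : {measure set X -> \bar R}) (p C lam Cd : R) (x0 : X) (R0 : \bar R).
Hypothesis cbm : complete_borel_measure mu.
Hypotheses (p1 : 1 < p) (C0 : 0 < C) (lam1 : 1 <= lam).
Hypothesis poinc : poincare_with mu p C lam.
Hypotheses (Cd1 : 1 <= Cd) (dbl : doubling_with mu Cd).
Variables (q Cq : R).
Hypotheses (qp : q < p) (Cq0 : 0 < Cq) (mass : mass_bound_with mu x0 R0 q Cq).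

Let p0 : 0 < p. Proof. exact: lt_trans p1. Qed.
Let A0 : R := Cd * C * Cq `^ p^-1 / (1 - 2 `^ (- (1 - q / p))).

(** [1 - chain_cost] is 1 near [x0], and telescoping from a tiny radius up to [t] bounds the
    decrease of its average. The bound depends neither on the mesh [eps], nor on the starting radius
    [s], nor on the Lipschitz constant of [G]. *)
Lemma chain_cost_average_le (G : X -> R) (eps s delta L M t J : R) :
  0 < delta -> 0 < eps -> 0 <= L -> 0 < s ->
  (forall x y, `|G x - G y| <= L * mdist x y) ->
  (forall x, delta <= G x <= M) ->
  0 < t -> (t%:E < R0)%E ->
  (\int[mu]_(x in ball x0 (lam * t)) ((G x)%:E `^ p) <= J%:E)%E ->
  ball_average mu (chain_cost x0 G eps s) x0 t <= A0 * t * (J / ball_mass mu x0 t) `^ p^-1.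
Proof.
move=> d0 e0 L0 s0 GL GM t0 tR GJ.
have [oB _ _] := cbm; have mB := measurable_mball cbm.
pose u := chain_cost x0 G eps s.
have u0 x : 0 <= u x by exact: (chain_cost_ge0 _ _ _ d0 GM).
have u1 x : u x <= 1 by exact: (chain_cost_le1 _ _ _ d0 GM).
pose v x := 1 - u x.
have v01 x : 0 <= v x <= 1 by have := u0 x; have := u1 x; rewrite /v; lra.
have mu_ : measurable_fun [set: X] u.
  apply/measurable_EFinP; apply: borel_measurable => //; apply: continuous_borel.
  by apply: lipschitz_continuous => x y; exact: (chain_cost_lipschitz _ _ d0 e0 GM).
have mv : measurable_fun [set: X] v by apply: measurable_funB.
have ug : upper_gradient (EFin \o v) (EFin \o G).
  have [h1 h2 h3] := chain_cost_upper_gradient x0 s d0 e0 L0 GL GM.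
  split=> // l gam lg; apply: le_trans (h3 l gam lg).
  by rewrite /= /v lee_fin (_ : _ - _ = u (gam l) - u (gam 0)) 1?distrC//; ring.
have vi : mu.-integrable [set: X] (EFin \o v).
  apply: (@integrable_zero_off_ball _ _ _ mu cbm v x0 (s + delta^-1)) => // y.
  rewrite ballEmdist/= => /negP; rewrite -leNgt => /(chain_cost_far eps d0 GM) h.
  by rewrite /v /u h subrr.
pose rho := Num.min s t.
have rho0 : 0 < rho by rewrite lt_min s0 t0.
have rhot : rho <= t by rewrite ge_min lexx orbT.
have mass' b (b0 : 0 < b) (bt : b <= t) := mass b0 bt tR.
have := @ball_average_telescope _ _ _ mu cbm p C lam p1 C0 lam1 poinc v (EFin \o G) mv v01 vi ug
  Cd x0 q Cq t J Cd1 dbl qp Cq0 t0 mass' GJ rho rho0 rhot.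
have -> : ball_average mu v x0 rho = 1.
  have mr := ball_mass_gt0 cbm x0 rho0.
  rewrite /ball_average (@eq_Rintegral _ _ _ _ _ (cst 1)); last first.
    move=> y; rewrite inE ballEmdist/= => yr.
    rewrite /v /u (chain_cost_start eps d0 GM) ?subr0// (le_trans (ltW yr))//.
    by rewrite ge_min lexx.
  by rewrite Rintegral_cst// mul1r mulVf ?gt_eqF.
have mt := ball_mass_gt0 cbm x0 t0.
have -> : ball_average mu v x0 t = 1 - ball_average mu u x0 t.
  rewrite /ball_average RintegralB//.
  - by rewrite Rintegral_cst// mulrBr mul1r mulVf ?gt_eqF.
  - apply: (@bounded_integrable_ball _ _ _ mu cbm _ _ _ 1) => //.
    by move=> y _; rewrite normr1.
  - apply: (@bounded_integrable_ball _ _ _ mu cbm _ _ _ 1) => //.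
    by move=> y _; rewrite ger0_norm.
by rewrite opprB addrC subrK => /(le_trans (ler_norm _)).
Qed.

(** By Chebyshev's inequality an average of at most [1 / 8] leaves at most half of the mass to the
    set where [u >= 1 / 4]. *)
Lemma ball_mass_small_cost (u : X -> R) t : measurable_fun [set: X] u ->
  (forall x, 0 <= u x <= 1) -> 0 < t -> ball_average mu u x0 t <= 8^-1 ->
  ball_mass mu x0 t / 2 <= fine (mu ([set x | u x < 4^-1] `&` ball x0 t)).
Proof.
move=> mu_ u01 t0; have mB := measurable_mball cbm x0 t.
have mt := ball_mass_gt0 cbm x0 t0.
have mE : measurable [set x | u x < 4^-1].
  have := mu_ measurableT _ (measurable_itv `]-oo, 4^-1[); rewrite setTI.
  by congr measurable; apply/seteqP; split=> x /=; rewrite in_itv.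
have mbad : measurable (ball x0 t `\` [set x | u x < 4^-1]) by exact: measurableD.
have mgood : measurable ([set x | u x < 4^-1] `&` ball x0 t) by exact: measurableI.
have ui : mu.-integrable (ball x0 t) (EFin \o u).
  apply: (@bounded_integrable_ball _ _ _ mu cbm _ _ _ 1) => //.
  by move=> y _; have /andP[h0 h1] := u01 y; rewrite ger0_norm.
rewrite /ball_average mulrC ler_pdivrMr// => Iu.
have := @Rintegral_ge_cst _ _ _ mu u _ _ 4^-1 mB mbad (@subDsetl _ _ _) ui _ _ _.
rewrite (ball_massE cbm)// ltry => /(_ isT) h.
have {}h := h (fun y _ => proj1 (andP (u01 y))) _.
have {}h : 4^-1 * fine (mu (ball x0 t `\` [set x | u x < 4^-1])) <= \int[mu]_(x in ball x0 t) u x.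
  by apply: h => y [_] /negP; rewrite -leNgt.
have fin (E : set X) : measurable E -> E `<=` ball x0 t -> mu E \is a fin_num.
  by move=> mE' sub; rewrite ge0_fin_numE// (mu_sub_ball_fin cbm sub).
have : ball_mass mu x0 t = fine (mu ([set x | u x < 4^-1] `&` ball x0 t)) +
    fine (mu (ball x0 t `\` [set x | u x < 4^-1])).
  rewrite -fineD; [|exact: fin..]; last 1 first.
  rewrite -measureU//; first by rewrite setIC setUIDK.
  by apply/seteqP; split=> // x [[h1 _] [_ h2]].
lra.
Qed.

(* Small-cost points of B_t are joined to x0 by curves of small g-length, which
   forces f to be close to f x0 = 1 there. *)
Lemma local_average_ge (f : X -> R) (g : X -> \bar R) (K : set X) (s t I e : R) :
  0 < s -> ball x0 s `<=` K -> compact K -> 0 < t -> (t%:E < R0)%E -> 0 < e ->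
  measurable_fun [set: X] f -> (forall x, 0 <= f x <= 1) -> f x0 = 1 ->
  upper_gradient (EFin \o f) g ->
  (\int[mu]_x (g x `^ p) <= I%:E)%E ->
  A0 * t * (((s^-1) `^ p * ball_mass mu x0 (lam * t) + 2 * 2 `^ p * I + e) /
    ball_mass mu x0 t) `^ p^-1 <= 8^-1 ->
  3 / 8 <= ball_average mu f x0 t.
Proof.
move=> s0 sK cK t0 tR e0 mf f01 fx0 ug gI small.
have [oB _ _] := cbm; have [g0 bg _] := ug.
have mt := ball_mass_gt0 cbm x0 t0.
have lt0 : 0 < lam * t by rewrite mulr_gt0// (lt_le_trans ltr01).
have mW := measurable_mball cbm x0 (lam * t).
have Wfin : (mu (ball x0 (lam * t)) < +oo)%E by rewrite (ball_massE cbm)// ltry.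
pose delta := s^-1.
have d0 : 0 < delta by rewrite invr_gt0.
have [G [GL Gd Gnd Gg GJ]] := lipschitz_majorants oB mW Wfin g0 bg d0 p1 e0.
pose J := delta `^ p * ball_mass mu x0 (lam * t) + 2 * 2 `^ p * I + e.
have GJ' j : (\int[mu]_(x in ball x0 (lam * t)) ((G j x)%:E `^ p) <= J%:E)%E.
  apply: le_trans (GJ j) _; rewrite (ball_massE cbm)// /J !EFinD !EFinM.
  rewrite leeD2r// leeD2l// lee_wpmul2l ?lee_fin ?mulr_ge0 ?powR_ge0//.
  apply: le_trans gI; apply: ge0_subset_integral => //.
    by apply: (measurableT_comp (measurable_poweR p)); exact: borel_measurable.
  by move=> x _; exact: poweR_ge0.
have j0 j : 0 < j.+1%:R :> R by rewrite ltr0n.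
have dj j : 0 < delta + j%:R by rewrite ltr_wpDr.
(* One step costs at most [(delta + j) * eps j = 1 / (j + 1)], the error allowed for the traces. *)
pose eps j : R := (j.+1%:R * (delta + j%:R))^-1.
have eps0 j : 0 < eps j by rewrite invr_gt0 mulr_gt0.
(* The starting radii tend to 0, so that the limit curve starts at [x0], and are at most [s / 2],
   which leaves room for the chains in [ball x0 s]. *)
pose st j : R := Num.min 1 (s / 2) / j.+1%:R.
have sg0 : 0 < Num.min 1 (s / 2) by rewrite lt_min ltr01 divr_gt0.
have st0 j : 0 < st j by rewrite divr_gt0.
have st1 j : st j <= j.+1%:R^-1.
  by rewrite /st -[leRHS]mul1r ler_wpM2r ?invr_ge0 ?(ltW (j0 j))// ge_min lexx.
have sts j : st j <= s / 2.
  rewrite /st ler_pdivrMr//; apply: (@le_trans _ _ (s / 2)); first by rewrite ge_min lexx orbT.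
  by rewrite ler_peMr ?ler1n// divr_ge0// ltW.
pose u j := chain_cost x0 (G j) (eps j) (st j).
have u01 j x : 0 <= u j x <= 1.
  by rewrite (chain_cost_ge0 _ _ _ d0 (Gd j)) (chain_cost_le1 _ _ _ d0 (Gd j)).
have mu_ j : measurable_fun [set: X] (u j).
  apply/measurable_EFinP; apply: borel_measurable => //; apply: continuous_borel.
  by apply: lipschitz_continuous => x y; exact: (chain_cost_lipschitz _ _ d0 (eps0 j) (Gd j)).
(* The costs increase with [j], so the sets [E j] below decrease and their intersection still
   carries half of the mass of [B_t]. *)
have und i j x : (i <= j)%N -> u i x <= u j x.
  move=> ij; apply: chain_cost_mono.
  - by move=> z; exact: Gnd.
  - rewrite lef_pV2 ?posrE ?mulr_gt0//; apply: ler_pM.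
    + exact: ltW.
    + exact: ltW.
    + by rewrite ler_nat.
    + by rewrite lerD2l ler_nat.
  - by rewrite /st ler_wpM2l ?(ltW sg0)// lef_pV2 ?posrE// ler_nat.
  - by move=> z; have /andP[h _] := Gd i z; rewrite (le_trans _ h)// ltW.
pose E j := [set x | u j x < 4^-1] `&` ball x0 t.
have mE j : measurable (E j).
  apply: measurableI; last exact: (measurable_mball cbm).
  have := mu_ j measurableT _ (measurable_itv `]-oo, 4^-1[); rewrite setTI.
  by congr measurable; apply/seteqP; split=> x /=; rewrite in_itv.
have Efin j : mu (E j) \is a fin_num.
  by rewrite ge0_fin_numE//; exact: (mu_sub_ball_fin cbm (@subIsetr _ _ _) (mE j)).
have Ehalf j : ((ball_mass mu x0 t / 2)%:E <= mu (E j))%E.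
  rewrite -(fineK (Efin j)) lee_fin; apply: ball_mass_small_cost => //.
  apply: le_trans small.
  exact: (@chain_cost_average_le _ _ _ _ _ _ _ _ d0 (eps0 j) (ler0n R j) (st0 j) (GL j) (Gd j) t0 tR (GJ' j)).
pose Ei := \bigcap_j E j.
have mEi : measurable Ei by exact: bigcap_measurable.
have Eihalf : ((ball_mass mu x0 t / 2)%:E <= mu Ei)%E.
  have ndE : nonincreasing_seq E.
    move=> i j ij; apply/subsetPset => x [ux Bx]; split=> //.
    exact: le_lt_trans (und i j x ij) ux.
  have cv := @nonincreasing_cvg_mu _ _ _ mu E.
  have {}cv := cv ltac:(by rewrite -ge0_fin_numE) mE mEi ndE.
  rewrite -(cvg_lim (@ereal_hausdorff R) cv); apply: lime_ge.
    by apply/cvg_ex; eexists; exact: cv.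
  by apply: nearW => j; exact: Ehalf.
have fE y : Ei y -> 3 / 4 <= f y.
  move=> Ey.
  have tr j : exists gam : R -> X, [/\ mdist x0 (gam 0) <= j.+1%:R^-1,
      gam 4^-1 = y, forall t, K (gam t) &
      forall a b m, 0 <= a -> a <= b -> (forall t, a <= t <= b -> m <= G j (gam t)) ->
        m * mdist (gam a) (gam b) <= b - a + j.+1%:R^-1].
    have [uy _] := Ey j Logic.I.
    have [|c [rc|->]] := inf_lt _ uy; [by exists 1; right| |lra].
    move=> c4.
    have epsE : (delta + j%:R) * eps j <= j.+1%:R^-1.
      by rewrite /eps invfM mulrCA divff ?mulr1// gt_eqF.
    have [gam [h0 hc hd hI]] := reach_trace d0 (eps0 j) (Gd j) epsE rc.
    exists gam; split => //.
    - exact: le_trans h0 (st1 j).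
    - by apply: hc; exact: ltW.
    - move=> z; apply: sK; rewrite ballEmdist/=; apply: le_lt_trans (hd z) _.
      have h4 : c / delta <= 4^-1 * s by rewrite /delta invrK ler_wpM2r// ltW.
      by have := sts j; lra.
  have /boolp.choice[gam hgam] := tr.
  have T0 : 0 < 4^-1 :> R by rewrite invr_gt0.
  have Gd1 j x : delta <= G j x by have /andP[] := Gd j x.
  have gam0 j : mdist x0 (gam j 0) <= j.+1%:R^-1 by have [] := hgam j.
  have gamT j : gam j 4^-1 = y by have [] := hgam j.
  have gamK j z : K (gam j z) by have [_ _ h _] := hgam j; exact: h.
  have gamI j a b m : 0 <= a -> a <= b ->
      (forall z, a <= z <= b -> m <= G j (gam j z)) ->
      m * mdist (gam j a) (gam j b) <= b - a + j.+1%:R^-1.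
    by have [_ _ _ h] := hgam j; exact: h.
  have := upper_gradient_limit_curve cK T0 d0 GL Gd1 Gnd gam0 gamT gamK gamI ug Gg.
  by rewrite fx0 => /(le_trans (ler_norm _)); lra.
have Eisub : Ei `<=` ball x0 t by move=> y /(_ 0%N Logic.I)[].
have fi : mu.-integrable (ball x0 t) (EFin \o f).
  apply: (@bounded_integrable_ball _ _ _ mu cbm _ _ _ 1) => //.
  by move=> y _; have /andP[h0 h1] := f01 y; rewrite ger0_norm.
have Bfin : (mu (ball x0 t) < +oo)%E by rewrite (ball_massE cbm)// ltry.
have := @Rintegral_ge_cst _ _ _ mu f _ _ (3 / 4) (measurable_mball cbm x0 t) mEi Eisub fi Bfin
  (fun y _ => proj1 (andP (f01 y))) fE.
rewrite /ball_average ler_pdivlMl//; apply: le_trans.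
have : ball_mass mu x0 t / 2 <= fine (mu Ei).
  rewrite -lee_fin fineK// ge0_fin_numE//.
  exact: (mu_sub_ball_fin cbm Eisub mEi).
lra.
Qed.

End point_capacity.

Section point_lower_bound.
Context {R : realType} {d : measure_display} {X : metricMeasurableType R d}.
Variables (mu : {measure set X -> \bar R}) (p C lam Cd : R) (x0 : X) (R0 : \bar R).
Hypothesis cbm : complete_borel_measure mu.
Hypotheses (p1 : 1 < p) (C0 : 0 < C) (lam1 : 1 <= lam).
Hypothesis poinc : poincare_with mu p C lam.
Hypotheses (Cd1 : 1 <= Cd) (dbl : doubling_with mu Cd).
Hypothesis R0diam : (R0 <= (4^-1)%:E * diam X)%E.

Let p0 : 0 < p. Proof. exact: lt_trans p1. Qed.

Lemma point_bound_of_mass_bound q (s0 : R) (K : set X) :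
  q < p -> lower_mass_bound mu x0 R0 q ->
  0 < s0 -> ball x0 s0 `<=` K -> compact K ->
  point_capacity_bound mu p x0 R0.
Proof.
move=> qp /(mass_bound_withP cbm)[Cq Cq0 mass] s00 sK cK.
pose A0 : R := Cd * C * Cq `^ p^-1 / (1 - 2 `^ (- (1 - q / p))).
pose A := capacity_constant p C Cd q Cq.
have Cd0 : 0 < Cd by exact: lt_le_trans ltr01 Cd1.
have A_gt0 : 0 < A by exact: (capacity_constant_gt0 p1 C0 Cd1 Cq qp).
have A00 : 0 < A0.
  rewrite divr_gt0 ?mulr_gt0 ?powR_gt0// subr_gt0 powRN invf_lt1 ?powR_gt0//.
  have b0 : 0 < 1 - q / p by rewrite subr_gt0 ltr_pdivrMr// mul1r.
  have : (1 : R) < 2 by rewrite ltr1n.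
  by move=> /(gt0_ltr_powR b0); rewrite powR1; apply; rewrite nnegrE.
have [n hn] : exists n : nat, lam <= 2 ^+ n.
  exists (Num.truncn lam).+1; apply: le_trans (ltW (truncnS_gt _)) _.
  by rewrite -natrX ler_nat ltnW// ltn_expl.
pose La := Cd ^+ n.
have La0 : 0 < La by rewrite exprn_gt0.
have Ap0 : 0 < A0 `^ p by exact: powR_gt0.
(* The smallness condition of [local_average_ge], raised to the power [p], has two parts, one from
   the lower bound [1 / s] of the majorants and one from the energy. Each is allotted half of
   [8^-p]: the first fixes [th], the second [ka]. *)
pose B : R := 8^-1 `^ p / 2.
have B0 : 0 < B by rewrite divr_gt0// powR_gt0// invr_gt0.
pose th : R := Num.min 1 ((B / (A0 `^ p * La)) `^ p^-1).
have th0 : 0 < th by rewrite lt_min ltr01 powR_gt0// divr_gt0// mulr_gt0.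
have th1 : th <= 1 by rewrite ge_min lexx.
have thp : A0 `^ p * (th `^ p * La) <= B.
  rewrite mulrCA -ler_pdivlMr ?mulr_gt0//.
  have -> : B / (A0 `^ p * La) = ((B / (A0 `^ p * La)) `^ p^-1) `^ p.
    by rewrite -powRrM mulVf ?gt_eqF// powRr1// divr_ge0 ?mulr_ge0// ltW.
  by apply: ge0_ler_powR; rewrite ?nnegrE ?powR_ge0 ?(ltW p0) ?(ltW th0)// ge_min lexx orbT.
pose D : R := 2 * 2 `^ p + 1.
have D0 : 0 < D by rewrite addr_gt0// mulr_gt0// powR_gt0.
pose ka : R := B / (A0 `^ p * D).
have ka0 : 0 < ka by rewrite divr_gt0// mulr_gt0.
have v0 : 0 < 3 / 8 :> R by rewrite divr_gt0.
pose K1 := (A / (3 / 8)) `^ p.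
have K10 : 0 < K1 by rewrite powR_gt0// divr_gt0.
pose K2 := Cq / ka.
have K20 : 0 < K2 by rewrite divr_gt0.
exists (K1 + K2) => [|r r0 rR]; first by rewrite addr_gt0.
rewrite (ball_massE cbm)// -EFinM; apply: ge_capacity => //; first by rewrite addr_gt0.
move=> f g mf f01 f1 f0 ug.
have mr := ball_mass_gt0 cbm x0 r0.
pose s := Num.min s0 r.
have s_gt0 : 0 < s by rewrite lt_min s00.
have sr : s <= r by rewrite ge_min lexx orbT.
pose t := th * s.
have t0 : 0 < t by rewrite mulr_gt0.
have ts : t <= s by rewrite ler_piMl// ltW.
have tr : t <= r by exact: le_trans sr.
have tR : (t%:E < R0)%E by apply: le_lt_trans rR; rewrite lee_fin.
have mt := ball_mass_gt0 cbm x0 t0.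
have tp0 : 0 < t `^ p by exact: powR_gt0.
have I0 : (0 <= \int[mu]_(y in ball x0 r) (g y `^ p))%E.
  by apply: integral_ge0 => y _; exact: poweR_ge0.
have IE := integral_restrict_poweR mu p1 (ball x0 r) g.
case EI : (\int[mu]_(y in ball x0 r) (g y `^ p))%E I0 => [I| |]//; last first.
  by rewrite gt0_muley ?leey// lte_fin addr_gt0.
rewrite lee_fin => I0.
(* For large energy the mass bound between [B_t] and [B_r] suffices, with constant [K2]; [K1] serves
   the case of small energy. *)
have [Ismall|Ibig] := leP I (ka * ball_mass mu x0 t / t `^ p); last first.
  rewrite -EFinM lee_fin.
  apply: (@le_trans _ _ (K2 * I)); last by rewrite ler_wpM2r// lerDr ltW.
  have h := mass _ _ t0 tr rR.
  have tr0 : 0 < t / r by rewrite divr_gt0.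
  have tr1 : t / r <= 1 by rewrite ler_pdivrMr// mul1r.
  have qpr : (t / r) `^ p <= (t / r) `^ q.
    by apply: ger_powR; [rewrite tr0|exact: ltW].
  have E : r `^ (- p) = (t / r) `^ p / t `^ p.
    rewrite powRM ?invr_ge0 ?(ltW t0) ?(ltW r0)// -(powR_inv1 (ltW r0)) -powRrM mulN1r.
    by rewrite mulrAC divff ?mul1r// gt_eqF.
  rewrite E mulrAC ler_pdivrMr//.
  apply: (@le_trans _ _ ((t / r) `^ q * ball_mass mu x0 r)).
    by rewrite ler_wpM2r// ltW.
  apply: (le_trans h); move: Ibig; rewrite ltr_pdivrMr// => /ltW Ibig.
  rewrite (_ : K2 * I * t `^ p = Cq * (I * t `^ p / ka)); last by rewrite /K2; ring.
  by rewrite ler_wpM2l ?(ltW Cq0)// ler_pdivlMr// mulrC.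
(* The free error of the majorants is set equal to the bound on [I], so that both are absorbed in
   [D * e]. *)
pose e := ka * ball_mass mu x0 t / t `^ p.
have e0 : 0 < e by rewrite divr_gt0// mulr_gt0.
have fx0 : f x0 = 1 by exact: f1.
have ugr := upper_gradient_restrict (@open_mball _ _ _ x0 r) f0 ug.
have gI : (\int[mu]_y ((g \_ (ball x0 r)) y `^ p) <= I%:E)%E by rewrite IE EI.
have sK' : ball x0 s `<=` K by apply: subset_trans sK; apply: le_ball; rewrite ge_min lexx.
have small : A0 * t * (((s^-1) `^ p * ball_mass mu x0 (lam * t) + 2 * 2 `^ p * I + e) /
    ball_mass mu x0 t) `^ p^-1 <= 8^-1.
  set J := (_ + _ + _).
  have J0 : 0 <= J.
    apply: addr_ge0; last exact: ltW.
    apply: addr_ge0; last by rewrite !mulr_ge0 ?powR_ge0.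
    rewrite mulr_ge0 ?powR_ge0//.
    by apply/ltW/(ball_mass_gt0 cbm); rewrite mulr_gt0// (lt_le_trans ltr01).
  have At0 : 0 <= A0 * t by rewrite mulr_ge0// ltW.
  have Jm0 : 0 <= J / ball_mass mu x0 t by rewrite divr_ge0// ltW.
  have root b : 0 <= b -> (b `^ p) `^ p^-1 = b :> R.
    by move=> b0; rewrite -powRrM mulfV ?gt_eqF// powRr1.
  rewrite -[X in X * _](root _ At0) -powRM ?powR_ge0//.
  have e8 : 0 <= 8^-1 :> R by rewrite invr_ge0.
  rewrite -[leRHS](root _ e8); apply: ge0_ler_powR; rewrite ?nnegrE ?invr_ge0 ?(ltW p0) ?powR_ge0//.
    by rewrite mulr_ge0 ?powR_ge0.
  have lamt : ball_mass mu x0 (lam * t) <= La * ball_mass mu x0 t.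
    apply: le_trans (iter_doubling x0 Cd1 dbl n t0).
    apply: (le_ball_mass cbm); first by rewrite mulr_gt0// (lt_le_trans ltr01).
    by rewrite ler_wpM2r// ltW.
  have tE : (A0 * t) `^ p = A0 `^ p * t `^ p by rewrite powRM// ltW.
  have sE : s^-1 `^ p = th `^ p / t `^ p.
    rewrite /t powRM ?(ltW th0) ?(ltW s_gt0)// invfM mulrA divff ?gt_eqF ?powR_gt0// mul1r.
    by rewrite -(powR_inv1 (ltW s_gt0)) -powRrM mulN1r powRN.
  have h1 : s^-1 `^ p * ball_mass mu x0 (lam * t) <= th `^ p / t `^ p * (La * ball_mass mu x0 t).
    by rewrite sE ler_wpM2l// divr_ge0 ?powR_ge0.
  have h2 : 2 * 2 `^ p * I <= 2 * 2 `^ p * e by rewrite ler_wpM2l// mulr_ge0// powR_ge0.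
  have JE : J <= th `^ p / t `^ p * (La * ball_mass mu x0 t) + D * e by rewrite /J /D; lra.
  rewrite tE mulrA ler_pdivrMr//.
  apply: (@le_trans _ _ (A0 `^ p * t `^ p * (th `^ p / t `^ p * (La * ball_mass mu x0 t) + D * e))).
    by rewrite ler_wpM2l// mulr_ge0 ?powR_ge0.
  have -> : A0 `^ p * t `^ p * (th `^ p / t `^ p * (La * ball_mass mu x0 t) + D * e) =
      (A0 `^ p * (th `^ p * La) + B) * ball_mass mu x0 t.
    by rewrite /e /ka; field; rewrite !gt_eqF.
  rewrite ler_wpM2r ?(ltW mt)// [leRHS](_ : _ = B + B); last by rewrite /B; field.
  by rewrite lerD2r.
have avg := local_average_ge cbm p1 C0 lam1 poinc Cd1 dbl qp Cq0 mass s_gt0 sK' cK t0 tR e0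
  mf f01 fx0 ugr gI small.
have := le_integral_of_ball_average cbm p1 C0 lam1 poinc Cd1 dbl R0diam qp Cq0 mass mf f01
  r0 rR f0 ug t0 tr v0 avg.
rewrite EI -!EFinM !lee_fin => /le_trans; apply.
by rewrite ler_wpM2r// lerDl ltW.
Qed.

End point_lower_bound.

(** A function equal to 1 on [B_rho] is in particular 1 at [x0], so the capacity of the point is the
    smaller one and the same constant works. *)
Lemma annulus_bound_of_point_bound (R : realType) (d : measure_display)
  (X : metricMeasurableType R d) (mu : {measure set X -> \bar R}) (x0 : X) (p : R) (R0 : \bar R) :
  point_capacity_bound mu p x0 R0 -> annulus_capacity_bound mu p x0 R0.
Proof.
move=> [K K0 h]; exists K => // rho r rho0 rhor rR.
apply: le_trans (h r (lt_trans rho0 rhor) rR) _.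
rewrite lee_wpmul2l ?lee_fin ?(ltW K0)//.
apply: le_ereal_inf => _ [u [g [nu u1 u0 ug ->]]]; exists u, g; split=> // x ->.
by apply: u1; exact: ballxx.
Qed.

(** Local compactness of [G] provides a compact neighbourhood relative to [G]; openness of [G] makes
    it contain a ball of [X]. *)
Lemma locally_compact_ball (R : realType) (d : measure_display)
  (X : metricMeasurableType R d) (x0 : X) (G : set X) :
  open G -> locally_compact G -> G x0 ->
  exists s K, [/\ 0 < s, ball x0 s `<=` K & compact K].
Proof.
move=> oG lG Gx; have [U wU [cU _]] := lG x0 Gx.
have {}wU : nbhs x0 [set x | G x -> U x] by exact: wU.
have nG : nbhs x0 G by exact: open_nbhs_nbhs.
have : nbhs x0 (G `&` [set x | G x -> U x]) by exact: filterI.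
move=> /nbhs_ballP[s /= s0 hs]; exists s, U; split=> //.
by move=> y /hs[Gy]; exact.
Qed.

(** An infimum is below [p] exactly when some element is, so it does not matter whether [Q] is
    attained; if no exponent is admissible, the infimum is infinite and both sides fail. *)
Lemma lower_dimension_lt (R : realType) (d : measure_display)
  (X : metricMeasurableType R d) (mu : {measure set X -> \bar R}) (x0 : X) (p : R) (R0 : \bar R) :
  (lower_dimension mu x0 R0 < p%:E)%E <->
  exists q, [/\ 0 < q, q < p & lower_mass_bound mu x0 R0 q].
Proof.
split=> [/ereal_inf_lt[_ [q [q0 hq] <-]]|[q [q0 qp hq]]].
  by rewrite lte_fin => qp; exists q.
by apply: (@le_lt_trans _ _ q%:E) => //; apply: ereal_inf_lbound; exists q.
Qed.

Theorem theorem1p3 (R : realType) (d : measure_display)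
  (X : metricMeasurableType R d) (mu : {measure set X -> \bar R})
  (x0 : X) (p : R) (R0 : \bar R) :
  complete_borel_measure mu ->
  1 < p ->
  doubling mu ->
  poincare mu p ->
  (0 < R0)%E ->
  (R0 <= (4^-1)%:E * diam X)%E ->
  (annulus_capacity_bound mu p x0 R0 <-> (lower_dimension mu x0 R0 < p%:E)%E) /\
  ((exists G : set X, [/\ open G, locally_compact G & G x0]) ->
   (point_capacity_bound mu p x0 R0 <-> annulus_capacity_bound mu p x0 R0) /\
   (point_capacity_bound mu p x0 R0 <-> (lower_dimension mu x0 R0 < p%:E)%E)).
Proof.
move=> cbm p1 /(doubling_withP cbm)[Cd Cd1 dbl] [C [lam [C0 lam1 poinc]]] _ R0diam.
have annulus : annulus_capacity_bound mu p x0 R0 <-> (lower_dimension mu x0 R0 < p%:E)%E.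
  split=> [h|/lower_dimension_lt[q [_ qp hq]]].
    apply/lower_dimension_lt.
    exact: (mass_bound_of_annulus_bound cbm p1 Cd1 dbl h).
  exact: (annulus_bound_of_mass_bound cbm p1 C0 lam1 poinc Cd1 dbl R0diam qp hq).
split=> // -[G [oG lG Gx]].
have [s [K [s0 sK cK]]] := locally_compact_ball oG lG Gx.
have point : (lower_dimension mu x0 R0 < p%:E)%E -> point_capacity_bound mu p x0 R0.
  move=> /lower_dimension_lt[q [_ qp hq]].
  exact: (point_bound_of_mass_bound cbm p1 C0 lam1 poinc Cd1 dbl R0diam qp hq s0 sK cK).
split; split=> h.
- exact: annulus_bound_of_point_bound.
- by apply: point; apply/annulus.
- by apply/annulus; exact: annulus_bound_of_point_bound.
- exact: point.
Qed.
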